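(* Let $p\in[2,\infty)$ be fixed and let $\beta_c(p):=\frac{3}{p^{2/p}}\cdot\frac{\Gamma(1+1/p)}{\Gamma(1+3/p)}$. For all $\beta\ge 0$, \begin{align*} \lim_{n\to\infty}\frac1n \log \mathcal{Z}_{n,p}(\beta) &=\sup_{z,w\ge 0}\left\{\psi_{p}\left(\sqrt{\beta}\frac{zw}{(1+z^p)^{1/p}}\right)-\frac{1}{p}\log(1+z^p)-\frac{p-2}{2p}w^{2p/(p-2)}\right\}\\ &= \sup_{0\le u< 1,\,v\ge 0 }\left\{\psi_{p}\left(\sqrt{\beta u^2 v^{p-2} }\right)+\frac{1}{p}\log(1-u^{p})-\frac{p-2}{2p}v^p\right\}. \end{align*} Moreover: (a) If $\beta<\beta_c(p)$, then $m_{n,\beta,p}$ is concentrated at zero and $\sqrt{n}\, m_{n,\beta,p}=\frac{1}{\sqrt{n}}\sum_{i=1}^n \sigma_i$ converges in distribution to $\mathrm{N}(0,(\beta_c(p)-\beta)^{-1})$ as $n\to\infty$; furthermore $\mathcal{Z}_{n,p}(\beta)$ is uniformly bounded in $n$, and in particular $\lim_{n\to\infty}\frac1n \log\mathcal{Z}_{n,p}(\beta)=0$. (b) If $\beta>\beta_c(p)$, then $m_{n,\beta,p}$ is concentrated at $K\cup (-K)$ for some closed set $K\subset (0,1]$ (i.e. the law of $m_{n,\beta,p}$ puts asymptotically vanishing mass outside any neighborhood of $K\cup(-K)$), and $\lim_{n\to\infty}\frac1n \log\mathcal{Z}_{n,p}(\beta)>0$.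
   Context: For $p>0$ let $S_{n,p}:=\{\sigma\in\mathbb{R}^n: \frac1n\sum_{i=1}^n|\sigma_i|^p=1\}$ and let $d_{n,p}\sigma$ denote the uniform probability measure on $S_{n,p}$ (equivalently, the law of $\widehat X=X/\|X\|_{n,p}$ where $X_1,\dots,X_n$ are i.i.d. with density $\rho_p$ and $\|x\|_{n,p}=(\frac1n\sum_i|x_i|^p)^{1/p}$). Here $\rho_p(x)=c_p e^{-|x|^p/p}$, $x\in\mathbb{R}$, with $c_p=\frac{p^{-1/p}}{2\Gamma(1+1/p)}$. The Hamiltonian is $H_n(\sigma)=\frac1n\sum_{i<j}\sigma_i\sigma_j$, the partition function is $\mathcal{Z}_{n,p}(\beta)=\int_{S_{n,p}}\exp(\beta H_n(\sigma))\,d_{n,p}\sigma$, and the Gibbs measure is $d\mu_{n,\beta,p}(\sigma)=\mathcal{Z}_{n,p}(\beta)^{-1}\exp(\beta H_n(\sigma))\,d_{n,p}\sigma$. The magnetization is $m_{n,\beta,p}=\frac1n\sum_{i=1}^n\sigma_i$ with $\sigma\sim\mu_{n,\beta,p}$. Finally $\psi_p(t):=\log\mathbb{E}[e^{tX}]$ for $X\sim\rho_p$, $t\in\mathbb{R}$.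
   Formalization: The first variational formula (sup over z,w) is asserted only for p>2, since its exponent 2p/(p-2) is undefined at p=2; the second formula and all other claims are asserted for every p≥2, with v^{p-2}=1 at p=2. *)

(* Defs.v *)
From HB Require Import structures.
From mathcomp Require Import all_boot all_order all_algebra.
From mathcomp Require Import all_classical all_reals all_analysis.
Set Implicit Arguments. Unset Strict Implicit. Unset Printing Implicit Defensive.
Import Order.TTheory GRing.Theory Num.Def Num.Theory.
Import numFieldNormedType.Exports.
Local Open Scope classical_set_scope.
Local Open Scope ring_scope.

Section defs.
Context {R : realType}.
Local Notation leb := (@lebesgue_measure R).

Definition Gamma (s : R) : R :=
  fine (\int[leb]_(x in `]0%R, +oo[%classic) (powR x (s - 1) * expR (- x))%:E)%E.

Definition cp (p : R) : R := powR p (- p^-1) / (2 * Gamma (1 + p^-1)).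
Definition rho (p : R) (x : R) : R := cp p * expR (- (powR `|x| p / p)).

Definition psi (p : R) (t : R) : R :=
  ln (fine (\int[leb]_x (expR (t * x) * rho p x)%:E)%E).

Definition betac (p : R) : R :=
  3 / powR p (2 / p) * (Gamma (1 + p^-1) / Gamma (1 + 3 / p)).

(** Vectors of R^n are represented as sequences of length n. *)
(** Iterated integral against the product density rho^{(x) n}:
    iprod rho n F = E[F(X_1,...,X_n)] with X_i i.i.d. of density rho. *)
Fixpoint iprod (dens : R -> R) (n : nat) (F : seq R -> \bar R) : \bar R :=
  match n with
  | 0%N => F [::]
  | k.+1 => (\int[leb]_x ((dens x)%:E * iprod dens k (fun s => F (x :: s))))%E
  end.

Definition normp (p : R) (s : seq R) : R :=
  powR ((size s)%:R^-1 * \sum_(x <- s) powR `|x| p) p^-1.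

Definition hatv (p : R) (s : seq R) : seq R := map (fun x => x / normp p s) s.

Definition Ham (s : seq R) : R :=
  (size s)%:R^-1 *
  \sum_(i < size s) \sum_(j < size s | (i < j)%N) s`_i * s`_j.

Definition magn (s : seq R) : R := (size s)%:R^-1 * \sum_(x <- s) x.

Definition Zpart (p : R) (n : nat) (beta : R) : R :=
  fine (iprod (rho p) n (fun s => (expR (beta * Ham (hatv p s)))%:E)).

Definition gibbsE (p : R) (n : nat) (beta : R) (f : seq R -> R) : R :=
  fine (iprod (rho p) n
          (fun s => (expR (beta * Ham (hatv p s)) * f (hatv p s))%:E))
  / Zpart p n beta.

Definition magn_prob (p : R) (n : nat) (beta : R) (A : set R) : R :=
  gibbsE p n beta (fun s => \1_A (magn s)).

Definition F1 (p beta z w : R) : R :=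
  psi p (Num.sqrt beta * (z * w / powR (1 + powR z p) p^-1))
  - p^-1 * ln (1 + powR z p)
  - (p - 2) / (2 * p) * powR w (2 * p / (p - 2)).

Definition F2 (p beta u v : R) : R :=
  psi p (Num.sqrt (beta * u ^+ 2 * powR v (p - 2)))
  + p^-1 * ln (1 - powR u p)
  - (p - 2) / (2 * p) * powR v p.

End defs.

(* Main.v *)
(** Let [N] be the normalised p-norm of [s], [m] the magnetization of [s / N] and
    [S = n N ^ p] the sum of the [|x_i| ^ p].  The Hamiltonian of [s / N] is [n m^2 / 2 - A / 2]
    with [0 <= A <= 1], so up to a bounded factor the partition function is
    [E exp (n beta m^2 / 2)] for i.i.d. coordinates of density [rho].

    Scaling the coordinates gives, for a 0-homogeneous [F],
    [E (F h(S) exp ((1 - 1/r) S / p)) = r^(n/p) E (F h(r S))]: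
    an exponential tilt in [S] has an explicit price, and [S / n] concentrates at [1]
    independently of [F].  The exponent [t n m N] of the moment generating function of the sum
    splits, by AM-GM and Young, into multiples of [m^2] and [S] and a constant; this yields
    [exp (n F2(u, v)) <= E exp (n beta m^2 / 2)] for every [n].  Conversely the parabola in [m]
    lies below finitely many tangent lines up to a small error, and for each of them the tilt that
    makes Young's inequality sharp turns the upper bound into a value of [F2].

    The inequality [E X^(2k+2) <= (2k+1) E X^2 E X^(2k)], an equality for [p = 2], gives
    [psi p t <= t^2 / (2 betac)].  Below [betac] a Gaussian average linearizes the square and bounds
    the partition function; the limit law follows from the convergence of the characteristic
    functions under the weight [exp (- beta A / 2)], since a function dominated by
    [exp (b x^2 / 2)] is approximated by trigonometric polynomials uniformly relative to
    [exp (c x^2 / 2)], [b < c].  Above [betac] the function [F2] is positive somewhere near the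
    origin, and values of [m] with [beta m^2 / 2] below the free energy are negligible. *)
Require Import Defs.
From HB Require Import structures.
From mathcomp Require Import all_boot all_order all_algebra.
From mathcomp Require Import all_classical all_reals all_analysis.
From mathcomp Require Import measurable_realfun ring lra.
Import Order.TTheory GRing.Theory Num.Def Num.Theory.
Import numFieldNormedType.Exports.
Local Open Scope classical_set_scope.
Local Open Scope ring_scope.
Set Implicit Arguments. Unset Strict Implicit. Unset Printing Implicit Defensive.

(** The constraint couples the coordinates only through the norm: under the product of [rho] the
    direction, hence [m], is independent of [S]. No surface measure is ever formed; scaling the
    coordinates carries this independence. The three terms of [F2] have separate origins: [psi]
    comes from the moment generating function of a sum of independent variables, the logarithm is
    the price of tilting [S / n] from 1 to 1 / (1 - u^p), and the power of [v] is the constant left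
    by Young's inequality. Along u^p = lam / (1 + lam), v^p = lam, the two costs add up to lam / 2
    to first order for every p, while [psi] gains beta E[X^2] lam / 2; this is why the threshold
    [betac] is the inverse variance of [rho]. Below it, the strict gap between beta and [betac]
    leaves room for a parameter in between, which pays for the fluctuation of the norm and for the
    unbounded weight in the limit law. *)

Section density_probability.
Import HBNNSimple.
Context d (T : measurableType d) (R : realType).
Variable mu : {measure set T -> \bar R}.

Definition is_density (f : T -> R) :=
  [/\ measurable_fun setT f, forall x, 0 <= f x & (\int[mu]_x (f x)%:E = 1)%E].

Variables (f : T -> R) (hf : is_density f).

(** The proof of [is_density] is an argument of the measure itself, so that the instances of measure
    and probability can be attached to the resulting function. *)
Definition density_prob of is_density f := fun A : set T => (\int[mu]_(x in A) (f x)%:E)%E.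
Local Notation P := (density_prob hf).

Let mf : measurable_fun setT (EFin \o f).
Proof. by apply/measurable_EFinP; case: hf. Qed.

Let f0 (x : T) : (0 <= (f x)%:E)%E.
Proof. by rewrite lee_fin; case: hf. Qed.

Let P0 : P set0 = 0%E. Proof. exact: integral_set0. Qed.

Let P_ge0 A : (0 <= P A)%E. Proof. exact: integral_ge0. Qed.

Let P_sigma_additive : semi_sigma_additive P.
Proof.
move=> F mF tF mUF; rewrite /density_prob ge0_integral_bigcup//; last exact: measurable_funTS.
by apply: is_cvg_ereal_nneg_natsum_cond => n _ _; exact: integral_ge0.
Qed.

HB.instance Definition _ := isMeasure.Build _ _ _ P P0 P_ge0 P_sigma_additive.

Let P_setT : P setT = 1%E. Proof. by case: hf. Qed.

HB.instance Definition _ := @Measure_isProbability.Build _ _ R P P_setT.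

Let ge0_integral_density (g : T -> \bar R) : measurable_fun setT g ->
  (forall x, 0 <= g x)%E ->
  (\int[P]_x g x = \int[mu]_x ((f x)%:E * g x))%E.
Proof.
move=> mg g0; pose h := nnsfun_approx measurableT mg.
have hg x : EFin \o h^~x @ \oo --> g x by exact: cvg_nnsfun_approx.
have ndh x a b : (a <= b)%N -> ((h a x)%:E <= (h b x)%:E)%E.
  by move=> ab; rewrite lee_fin; exact/lefP/nd_nnsfun_approx.
have mh n : measurable_fun setT (EFin \o h n) by exact/measurable_EFinP.
transitivity (limn (fun n => \int[P]_x (h n x)%:E)%E).
  rewrite -monotone_convergence//=.
  - by apply: eq_integral => x _; apply/esym/cvg_lim => //; exact: hg.
  - by move=> n x _; rewrite lee_fin.
  - by move=> x _ a b ab; exact: ndh.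
transitivity (limn (fun n => \int[mu]_x ((f x)%:E * (h n x)%:E))%E); last first.
  rewrite -monotone_convergence//=.
  - apply: eq_integral => x _; apply/cvg_lim => //; apply: cvgeZl => //; exact: hg.
  - by move=> n; apply: emeasurable_funM => //; exact: mh.
  - by move=> n x _; rewrite mule_ge0// lee_fin.
  - by move=> x _ a b ab; rewrite lee_wpmul2l// ndh.
congr (limn _); apply/funext => n.
under [LHS]eq_integral do rewrite fimfunE -fsumEFin//.
rewrite ge0_integral_fsum//; last 2 first.
- by move=> r; exact/measurable_EFinP/measurable_funM.
- by move=> r x _; rewrite nnfun_muleindic_ge0.
under [RHS]eq_integral.
  move=> x _; rewrite fimfunE -fsumEFin// ge0_mule_fsumr//; last first.
    by move=> r; rewrite nnfun_muleindic_ge0.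
  over.
rewrite ge0_integral_fsum//; last 2 first.
- move=> r; apply: emeasurable_funM => //; exact/measurable_EFinP/measurable_funM.
- by move=> r x _; rewrite mule_ge0// nnfun_muleindic_ge0.
apply: eq_fsbigr => r _; rewrite integralZl_indic_nnsfun//.
under [RHS]eq_integral do rewrite EFinM muleCA.
(* The sum over values runs through all reals. A negative value has an empty preimage; in the other
   case the scalar can be pulled out of a nonnegative integral. *)
have [r0|r0] := leP 0 r; last first.
  rewrite preimage_nnfun0// [in LHS]integral0_eq ?mule0; last by move=> x _; rewrite indic0.
  by rewrite [RHS]integral0_eq// => x _; rewrite indic0 !mule0.
rewrite ge0_integralZl//; last 2 first.
- apply: emeasurable_funM => //; exact/measurable_EFinP.
- by move=> x _; rewrite mule_ge0// lee_fin.
congr (_ * _)%E; rewrite integral_indic//= setIT.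
by rewrite /density_prob integral_mkcond; apply: eq_integral => x _; rewrite restrict_EFin/= patchE indicE; case: ifPn; rewrite ?mule1 ?mule0.
Qed.

Lemma integral_density (g : T -> \bar R) : measurable_fun setT g ->
  (\int[P]_x g x = \int[mu]_x ((f x)%:E * g x))%E.
Proof.
move=> mg; rewrite [LHS]integralE [RHS]integralE.
rewrite !ge0_integral_density//; [|exact: measurable_funeneg|exact: measurable_funepos].
congr (_ - _)%E; apply: eq_integral => x _.
  by rewrite !funeposE maxe_pMr// mule0.
by rewrite !funenegE -muleN maxe_pMr// mule0.
Qed.

End density_probability.

(** * Scaling of Lebesgue measure *)

Section lebesgue_scaling.
Context (R : realType).
Local Notation leb := (@lebesgue_measure R).

Definition homothety (c x : measurableTypeR R) : measurableTypeR R := c * x.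

Let measurable_homothety c : measurable_fun setT (homothety c).
Proof. exact: measurable_funM. Qed.

(** Preimages under scaling by c have their lengths divided by |c|; the factor |c| restores them, so
    this is Lebesgue measure again, in a form where a change of variables is an integral against a
    push-forward. *)
Definition homothety_measure (c : R) : {measure set (measurableTypeR R) -> \bar R} :=
  mscale (NngNum (normr_ge0 c))
    (measure_function_pushforward__canonical__measure_function_Measure
       leb (measurable_homothety c)).

Lemma homothety_preimage_ocitv (c a b : R) : c != 0 ->
  homothety c @^-1` [set` `]a, b] ] =
  if 0 < c then [set` `]c^-1 * a, c^-1 * b] ] else [set` `[c^-1 * b, c^-1 * a[ ].
Proof.
rewrite neq_lt => /orP[c0|c0]; rewrite ?c0 1?ltNge ?(ltW c0)/=;
  apply/seteqP; split=> x /=; rewrite /homothety !in_itv/= => /andP[ax xb].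
- by rewrite ler_ndivrMl// ltr_ndivlMl// xb ax.
- by rewrite -ltr_ndivlMl// -ler_ndivrMl// xb ax.
- by rewrite ltr_pdivrMl// ler_pdivlMl// ax.
- by rewrite -ltr_pdivrMl// -ler_pdivlMl// ax.
Qed.

(** Uniqueness of Lebesgue measure reduces the claim to half-open intervals. For negative c the
    preimage exchanges its closed and its open end, with the same length. *)
Lemma homothety_measureE (c : R) (A : set R) : c != 0 -> measurable A ->
  homothety_measure c A = leb A.
Proof.
move=> c0 mA; apply/esym/lebesgue_measure_unique => //= _ [[a b]] _ <-.
rewrite /mscale/= /pushforward homothety_preimage_ocitv//.
have [cp|cn] := ltP 0 c.
  rewrite !lebesgue_measure_itv/= !lte_fin ltr_pM2l ?invr_gt0//.
  case: ifPn => _; last by rewrite mule0.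
  by rewrite gtr0_norm// -!EFinB -EFinM -mulrBr mulrA divff ?mul1r// gt_eqF.
have {}cn : c < 0 by rewrite lt_neqAle c0.
rewrite !lebesgue_measure_itv/= !lte_fin ltr_nM2l ?invr_lt0//.
case: ifPn => _; last by rewrite mule0.
by rewrite ltr0_norm// -!EFinB -EFinM -mulrBr mulrA mulNr divff// mulN1r opprB.
Qed.

Lemma integral_homothety (c : R) (g : R -> \bar R) : c != 0 ->
  measurable_fun setT g -> (forall x, 0 <= g x)%E ->
  (\int[leb]_x g x = `|c|%:E * \int[leb]_x g (c * x)%R)%E.
Proof.
move=> c0 mg g0.
rewrite (eq_measure_integral (homothety_measure c)); last first.
  by move=> A mA _; rewrite homothety_measureE.
by rewrite ge0_integral_mscale//= ge0_integral_pushforward.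
Qed.

End lebesgue_scaling.

(** * Finite products as probability measures on tuples *)

Section tuple_probability.
Context d (T : measurableType d) (R : realType) (mu : probability T R).

Definition cons_tuple n (xt : T * n.-tuple T) : n.+1.-tuple T := [tuple of xt.1 :: xt.2].

Lemma measurable_cons_tuple n : measurable_fun setT (@cons_tuple n).
Proof. by apply: measurable_cons. Qed.

HB.instance Definition _ n :=
  isMeasurableFun.Build _ _ _ _ (@cons_tuple n) (@measurable_cons_tuple n).

(** Built by pushing a binary product forward along cons, so that integrals unfold one coordinate at
    a time, as [iprod] does. *)
Fixpoint tuple_prob n : probability (n.-tuple T) R :=
  match n with
  | 0 => \d_([tuple])
  | k.+1 => distribution (mu \x tuple_prob k)%E (@cons_tuple k)
  end.

Lemma integral_tuple_prob0 (F : 0.-tuple T -> \bar R) : measurable_fun setT F ->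
  (\int[tuple_prob 0]_t F t = F [tuple])%E.
Proof. by move=> mF; rewrite integral_dirac// diracT mul1e. Qed.

Lemma measurable_cons_l d' (T' : measurableType d') n (F : n.+1.-tuple T -> T') x : measurable_fun setT F ->
  measurable_fun setT (fun t : n.-tuple T => F [tuple of x :: t]).
Proof.
move=> mF; apply: (measurableT_comp mF).
by apply: measurable_cons => //; exact: measurable_cst.
Qed.

Lemma ge0_integral_tuple_probS n (F : n.+1.-tuple T -> \bar R) :
  measurable_fun setT F -> (forall t, 0 <= F t)%E ->
  (\int[tuple_prob n.+1]_t F t = \int[mu]_x \int[tuple_prob n]_t F [tuple of x :: t])%E.
Proof.
move=> mF F0; rewrite ge0_integral_distribution//= fubini_tonelli1//.
by apply: measurableT_comp => //; exact: measurable_cons_tuple.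
Qed.

Lemma bounded_integrable d' (T' : measurableType d') (P : probability T' R) (F : T' -> \bar R) M :
  measurable_fun setT F -> (forall t, `|F t| <= M%:E)%E -> P.-integrable setT F.
Proof.
move=> mF FM; apply: (@le_integrable _ _ _ _ _ measurableT F (EFin \o cst M)) => //=.
  by move=> x _; apply: (le_trans (FM x)); rewrite lee_fin ler_norm.
exact: finite_measure_integrable_cst.
Qed.

(** Signed version, for the test functions inside Gibbs averages; boundedness supplies the
    integrability that Fubini asks for. *)
Lemma bounded_integral_tuple_probS n (F : n.+1.-tuple T -> \bar R) M :
  measurable_fun setT F -> (forall t, `|F t| <= M%:E)%E ->
  (\int[tuple_prob n.+1]_t F t = \int[mu]_x \int[tuple_prob n]_t F [tuple of x :: t])%E.
Proof.
move=> mF FM.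
have mFc : measurable_fun setT (F \o @cons_tuple n).
  by apply: measurableT_comp => //; exact: measurable_cons_tuple.
rewrite integral_distribution//=; last by apply: (@bounded_integrable _ _ _ _ M) => // t; exact: FM.
by rewrite -integral12_prod_meas1//; apply: (@bounded_integrable _ _ _ _ M) => // t; exact: FM.
Qed.

Lemma measurable_fun_integral_tuple_prob n (F : n.+1.-tuple T -> \bar R) M :
  measurable_fun setT F -> (forall t, `|F t| <= M%:E)%E ->
  measurable_fun setT (fun x => \int[tuple_prob n]_t F [tuple of x :: t])%E.
Proof.
move=> mF FM.
apply: (@measurable_fubini_F _ _ _ _ _ mu (tuple_prob n) (F \o @cons_tuple n)).
apply: (@bounded_integrable _ _ _ _ M) => [|t]; last exact: FM.
by apply: measurableT_comp => //; exact: measurable_cons_tuple.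
Qed.

Lemma measurable_tuple_sum n (g : T -> R) : measurable_fun setT g ->
  measurable_fun setT (fun t : n.-tuple T => \sum_(x <- t) g x).
Proof.
move=> mg; rewrite (_ : (fun _ => _) = fun t : n.-tuple T => \sum_(i < n) g (tnth t i)).
  by apply: measurable_sum => i; exact: (measurableT_comp mg (measurable_tnth i)).
by apply/funext => t; rewrite big_tuple.
Qed.

Lemma measurable_tuple_prod n (g : T -> R) : measurable_fun setT g ->
  measurable_fun setT (fun t : n.-tuple T => \prod_(x <- t) g x).
Proof.
move=> mg; rewrite (_ : (fun _ => _) = fun t : n.-tuple T => \prod_(i < n) g (tnth t i)).
  by apply: measurable_prod => i _; exact: (measurableT_comp mg (measurable_tnth i)).
by apply/funext => t; rewrite big_tuple.
Qed.

Lemma integral_tuple_prob_prod n (g : T -> R) : measurable_fun setT g ->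
  (forall x, 0 <= g x) ->
  (\int[tuple_prob n]_t (\prod_(x <- t) g x)%:E = (\int[mu]_x (g x)%:E) ^+ n)%E.
Proof.
move=> mg g0; elim: n => [|n IH].
  rewrite integral_tuple_prob0 ?big_nil//.
  by apply/measurable_EFinP; exact: measurable_tuple_prod.
rewrite ge0_integral_tuple_probS; last 2 first.
- by apply/measurable_EFinP; exact: measurable_tuple_prod.
- by move=> t; rewrite lee_fin; apply: prodr_ge0.
under eq_integral => x _.
  under eq_integral do rewrite big_cons EFinM.
  rewrite ge0_integralZl//; last 3 first.
  - by apply/measurable_EFinP; exact: measurable_tuple_prod.
  - by move=> t _; rewrite lee_fin; apply: prodr_ge0.
  - by rewrite lee_fin.
  rewrite IH; over.
rewrite ge0_integralZr//; first by rewrite expeS.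
- exact/measurable_EFinP.
- by move=> x _; rewrite lee_fin.
- by rewrite expe_ge0// integral_ge0// => x _; rewrite lee_fin.
Qed.

End tuple_probability.

(** * The iterated integral of the statement as a product measure *)

Section iprod.
Context (R : realType).
Local Notation leb := (@lebesgue_measure R).
Variables (f : R -> R) (hf : is_density leb f).

Lemma iprodE n (F : seq R -> \bar R) M :
  measurable_fun setT (fun t : n.-tuple (measurableTypeR R) => F t) ->
  (forall s, size s = n -> `|F s| <= M%:E)%E ->
  iprod f n F = (\int[tuple_prob (density_prob hf) n]_t F t)%E.
Proof.
elim: n F => [|n IH] F mF FM.
  by apply/esym; apply: (integral_tuple_prob0 (density_prob hf) mF).
rewrite (bounded_integral_tuple_probS (density_prob hf) (M := M) mF)//=; last first.
  by move=> t; apply: FM; rewrite size_tuple.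
rewrite integral_density//; last first.
  apply: (measurable_fun_integral_tuple_prob (density_prob hf) mF (M := M)) => t; by apply: FM; rewrite size_tuple.
apply: eq_integral => x _; congr (_ * _)%E; rewrite IH//; first exact: (measurable_cons_l x mF).
by move=> s sn; apply: FM; rewrite /= sn.
Qed.

End iprod.

(** * Integration by parts and moments of the density *)

Section calculus.
Context (R : realType).
Local Notation leb := (@lebesgue_measure R).
Implicit Types (f F : R -> R).

Lemma is_derive_continuous f x df : is_derive x (1 : R) f df -> {for x, continuous f}.
Proof.
by move=> dfx; apply/differentiable_continuous/derivable1_diffP; exact: (@ex_derive _ _ _ _ _ _ df).
Qed.

Lemma integral_itvcy_derive f F (a l : R) :
  (forall x, a <= x -> 0 <= f x) ->
  (forall x, a <= x -> {for x, continuous f}) ->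
  (forall x, a <= x -> is_derive x (1 : R) F (f x)) ->
  F x @[x --> +oo] --> l ->
  (\int[leb]_(x in `[a, +oo[) (f x)%:E = (l - F a)%:E)%E.
Proof.
move=> f0 cf dF Fl; rewrite (@ge0_continuous_FTC2y R f F a l)//.
- apply: continuous_in_subspaceT => x; rewrite inE/= in_itv/= andbT; exact: cf.
- by move=> x ax; have := dF x (ltW ax) => -[].
- exact/cvg_at_right_filter/(is_derive_continuous (dF a (lexx _))).
- move=> x; rewrite in_itv/= andbT => ax.
  by rewrite derive1E; apply: derive_val; exact: dF (ltW ax).
Qed.

Lemma integral_itvcc_derive f F (a b : R) : a <= b ->
  (forall x, a <= x <= b -> {for x, continuous f}) ->
  (forall x, a <= x <= b -> is_derive x (1 : R) F (f x)) ->
  (\int[leb]_(x in `[a, b]) (f x)%:E = (F b - F a)%:E)%E.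
Proof.
rewrite le_eqVlt => /predU1P[<- _ _|ab cf dF].
  by rewrite set_itv1 integral_set1 subrr.
rewrite (@continuous_FTC2 R f F a b)//.
- apply: continuous_in_subspaceT => x; rewrite inE/= in_itv/=; exact: cf.
- split.
  + by move=> x; rewrite in_itv/= => /andP[ax xb]; have /dF[] : a <= x <= b by rewrite !ltW.
  + apply: cvg_at_right_filter; apply: is_derive_continuous (dF _ _).
    by rewrite lexx ltW.
  + apply: cvg_at_left_filter; apply: is_derive_continuous (dF _ _).
    by rewrite lexx ltW.
- move=> x; rewrite in_itv/= => /andP[ax xb].
  by rewrite derive1E; apply: derive_val; apply: dF; rewrite !ltW.
Qed.

Lemma integral_expR_tail (c a : R) : 0 < c ->
  (\int[leb]_(s in `[a, +oo[) (c * expR (- c * s))%:E = (expR (- c * a))%:E)%E.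
Proof.
move=> c0.
transitivity (0 - - expR (- c * a))%:E; last by rewrite opprK add0r.
apply: (integral_itvcy_derive (F := fun s => - expR (- c * s))).
- by move=> x _; rewrite mulr_ge0 ?expR_ge0 ?ltW.
- move=> x _; apply: (is_derive_continuous (df := c * (expR (- c * x) * - c))).
  by apply: is_derive_eq; rewrite /GRing.scale/=; ring.
- by move=> x _; apply: is_derive_eq; rewrite /GRing.scale/=; ring.
- rewrite -oppr0; apply: cvgN.
  rewrite (_ : (fun x => expR (- c * x)) = (fun z => expR (- z)) \o (fun z => c * z)).
    by apply: (@cvg_comp _ _ _ _ _ _ (pinfty_nbhs R)); [exact: gt0_cvgMry|exact: cvgr_expR].
  by apply: eq_fun => x; rewrite mulNr.
Qed.

Lemma ler_powRl (r x y : R) : 0 < r -> 0 <= x -> 0 <= y ->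
  (powR x r <= powR y r) = (x <= y).
Proof.
move=> r0 x0 y0; apply/idP/idP => [|xy]; last exact: (ge0_ler_powR (ltW r0)).
by apply: contraTT; rewrite -!ltNge; exact: gt0_ltr_powR.
Qed.

Lemma cvgr_powRN (b : R) : 0 < b -> powR x (- b) @[x --> +oo] --> (0 : R).
Proof.
move=> b0; apply/cvgr0Pnorm_lt => e e0; near=> x.
have x0 : 0 < x by near: x; exact: nbhs_pinfty_gt.
rewrite ger0_norm ?powR_ge0// powRN invf_plt ?posrE ?powR_gt0//.
have -> : e^-1 = powR (powR e^-1 b^-1) b by rewrite -powRrM mulVf ?gt_eqF// powRr1// invr_ge0 ltW.
rewrite gt0_ltr_powR ?nnegrE ?powR_ge0 ?(ltW x0)//.
Unshelve. all: by end_near. Qed.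

Lemma integral_powR_tail (b : R) : 0 < b ->
  (\int[leb]_(x in `[1%R, +oo[) (powR x (- b - 1))%:E = (b^-1)%:E)%E.
Proof.
move=> b0.
transitivity (0 - - b^-1 * powR 1 (- b))%:E; last by rewrite powR1 mulr1 opprK add0r.
apply: (integral_itvcy_derive (F := fun s => - b^-1 * powR s (- b))).
- by move=> x _; rewrite powR_ge0.
- move=> x x1; have x0 : 0 < x by exact: lt_le_trans x1.
  exact: is_derive_continuous (is_derive1_powR _ x0).
- move=> x x1; have x0 : 0 < x by exact: lt_le_trans x1.
  have /= H := is_derive1_powR (- b) x0.
  by apply: is_derive_eq; rewrite /GRing.scale/= mulrA mulrNN mulVf ?mul1r ?gt_eqF.
- rewrite -(mulr0 (- b^-1)); apply: cvgM; first exact: cvg_cst.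
  exact: cvgr_powRN.
Qed.

Lemma is_derive_exprn n (x : R) : is_derive x 1 (fun y : R => y ^+ n) (n%:R * x ^+ n.-1).
Proof. by split; [exact: exprn_derivable|rewrite exp_derive /GRing.scale/= mulr1]. Qed.

Lemma integral_even_power (k : nat) (y : R) : 0 <= y ->
  (\int[leb]_(x in `[(- y)%R, y]) (x ^+ k.*2)%:E = (2 * y ^+ k.*2.+1 / k.*2.+1%:R)%:E)%E.
Proof.
move=> y0.
have dF x : is_derive x (1 : R) (fun x : R => k.*2.+1%:R^-1 * x ^+ k.*2.+1) (x ^+ k.*2).
  apply: (is_derive_eq (is_deriveZ _ (is_derive_exprn k.*2.+1 x))).
  by rewrite /GRing.scale/= mulrA mulVf ?mul1r// pnatr_eq0.
pose F (x : R) := k.*2.+1%:R^-1 * x ^+ k.*2.+1.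
transitivity (F y - F (- y))%:E.
  apply: integral_itvcc_derive => //; [lra|move=> x _; exact: exprn_continuous].
congr (_%:E); rewrite /F exprNn -signr_odd/= odd_double/= expr1; ring.
Qed.

End calculus.

Lemma ge0_integral_comb d (T : measurableType d) (R : realType)
    (mu : {measure set T -> \bar R}) (f g : T -> R) (a b : R) :
  measurable_fun setT f -> measurable_fun setT g ->
  (forall x, 0 <= f x) -> (forall x, 0 <= g x) -> 0 <= a -> 0 <= b ->
  (\int[mu]_x (a * f x + b * g x)%:E =
   a%:E * \int[mu]_x (f x)%:E + b%:E * \int[mu]_x (g x)%:E)%E.
Proof.
move=> mf mg f0 g0 a0 b0.
have mZ (c : R) h : measurable_fun setT h -> measurable_fun setT (fun x : T => (c * h x)%:E).
  by move=> mh; apply/measurable_EFinP; exact: measurable_funM.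
have Z (c : R) (h : T -> R) : measurable_fun setT h -> (forall x, 0 <= h x) -> 0 <= c ->
    (\int[mu]_x (c * h x)%:E = c%:E * \int[mu]_x (h x)%:E)%E.
  move=> mh h0 c0; rewrite -ge0_integralZl//; first exact/measurable_EFinP.
  by move=> x _; rewrite lee_fin.
rewrite -!Z// -ge0_integralD//.
- by move=> x _; rewrite lee_fin mulr_ge0.
- exact: mZ.
- by move=> x _; rewrite lee_fin mulr_ge0.
- exact: mZ.
Qed.

Section moments.
Context (R : realType) (p : R).
Hypothesis hp : 2 <= p.
Local Notation leb := (@lebesgue_measure R).

Let p0 : 0 < p. Proof. by apply: lt_le_trans hp. Qed.

Definition absp (x : R) : R := powR `|x| p.
Definition epow (x : R) : R := expR (- (absp x / p)).

Lemma absp_ge0 x : 0 <= absp x. Proof. exact: powR_ge0. Qed.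

Lemma measurable_absp : measurable_fun setT absp.
Proof. by apply: (measurableT_comp (measurable_powR p)); exact: normr_measurable. Qed.

Lemma measurable_epow : measurable_fun setT epow.
Proof.
apply: measurableT_comp => //; apply: measurableT_comp => //.
by apply: measurable_funM => //; exact: measurable_absp.
Qed.

Definition Gamma_int (a : R) : \bar R :=
  (\int[leb]_(x in `]0%R, +oo[) (powR x a * expR (- x))%:E)%E.

(** Half of the exponential absorbs the power, x^n <= 2^n n! exp(x / 2) for an integer n > a, and
    the other half is integrable; C >= 1 takes care of x <= 1. *)
Lemma Gamma_int_fin (a : R) : 0 <= a -> (Gamma_int a < +oo)%E.
Proof.
move=> a0; pose n := (truncn a).+1.
pose C : R := 2 ^+ n * n`!%:R.
have C1 : 1 <= C by rewrite /C -natrX -natrM ler1n muln_gt0 expn_gt0 fact_gt0.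
have bound x : 0 < x -> powR x a * expR (- x) <= 2 * C * (2^-1 * expR (- 2^-1 * x)).
  move=> x0.
  have -> : - x = - 2^-1 * x + - 2^-1 * x by lra.
  rewrite expRD mulrA [leRHS]mulrA ler_wpM2r ?expR_ge0//.
  have -> : 2 * C * 2^-1 = C by lra.
  rewrite mulNr expRN ler_pdivrMr ?expR_gt0//.
  have [x1|x1] := leP x 1.
    apply: (@le_trans _ _ (1 * 1)); last by rewrite ler_pM// -[leLHS]expR0 ler_expR; lra.
    rewrite mulr1 -(powRr0 x); apply: ger_powR => //.
    by rewrite x0.
  apply: (@le_trans _ _ (x ^+ n)).
    rewrite -powR_mulrn ?(ltW x0)//; apply: ler_powR; first exact: ltW.
    by rewrite ltW// truncnS_gt.
  have -> : x ^+ n = 2 ^+ n * (2^-1 * x) ^+ n by rewrite -exprMn mulrA divff ?mul1r.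
  rewrite /C -mulrA ler_wpM2l ?exprn_ge0// [leRHS]mulrC -ler_pdivrMr ?ltr0n ?fact_gt0//.
  have x20 : 0 <= 2^-1 * x by rewrite mulr_ge0 ?ltW.
  by apply: le_trans (expR_ge1Dxn (truncn a) x20); rewrite lerDr.
have mg : measurable_fun (`]0%R, +oo[ : set R) (fun x => (2^-1 * expR (- 2^-1 * x))%:E).
  apply/measurable_EFinP; apply: measurable_funTS.
  apply: measurable_funM => //; apply: measurableT_comp => //.
apply: (@le_lt_trans _ _ (\int[leb]_(x in `]0%R, +oo[) ((2 * C)%:E * (2^-1 * expR (- 2^-1 * x))%:E))%E).
  apply: ge0_le_integral => //.
  - by move=> x _; rewrite lee_fin mulr_ge0 ?powR_ge0 ?expR_ge0.
  - apply/measurable_EFinP; apply: measurable_funTS; apply: measurable_funM.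
      exact: measurable_powR.
    by apply: measurableT_comp => //; exact: measurableT_comp.
  - exact: measurable_funeM.
  - by move=> x /=; rewrite in_itv/= andbT => x0; rewrite -EFinM lee_fin bound.
rewrite ge0_integralZl//; last by rewrite lee_fin mulr_ge0// (le_trans _ C1).
rewrite integral_itv_obnd_cbnd// integral_expR_tail//.
by rewrite -EFinM ltry.
Qed.

(** The layer-cake form of the exponential: it turns an integral against [epow] into integrals over
    sublevel sets of [absp]. *)
Lemma expR_layer (c : R) :
  (expR (- c))%:E = (\int[leb]_s (\1_`[c, +oo[ s * expR (- s))%:E)%E.
Proof.
have := @integral_expR_tail R 1 c ltr01; rewrite mulN1r => <-.
rewrite integral_mkcond; apply: eq_integral => s _.
rewrite patchE indicE; case: ifPn => _; last by rewrite mul0r.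
by rewrite mulN1r !mul1r.
Qed.

Lemma exprn_double_ge0 (x : R) k : 0 <= x ^+ k.*2.
Proof. by rewrite exprn_even_ge0 ?odd_double. Qed.

(** Layer cake and Tonelli in place of a substitution: at level s the variable x runs over [-y, y]
    with y = (p s)^(1/p), where the even power has an explicit integral, and what remains in s is a
    Gamma integral. *)
Lemma even_moment_layer (k : nat) :
  (\int[leb]_x (x ^+ k.*2 * epow x)%:E =
   (2 * powR p (k.*2.+1%:R / p) / k.*2.+1%:R)%:E * Gamma_int (k.*2.+1%:R / p))%E.
Proof.
pose a := k.*2.+1%:R / p : R.
have a0 : 0 < a by rewrite divr_gt0.
pose h (xs : R * R) : R := xs.1 ^+ k.*2 * (\1_[set xs : R * R | absp xs.1 / p <= xs.2] xs * expR (- xs.2)).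
have mset : measurable [set xs : R * R | absp xs.1 / p <= xs.2].
  rewrite [X in measurable X](_ : _ = (fun xs : R * R => absp xs.1 / p <= xs.2) @^-1` [set true]); last first.
    by apply/seteqP; split=> xs /=; [move=> ->|].
  rewrite -[X in measurable X]setTI; apply: measurable_fun_ler => //.
  apply: measurable_funM => //.
  by apply: (measurableT_comp measurable_absp).
have mh : measurable_fun setT (EFin \o h).
  apply/measurable_EFinP; apply: measurable_funM; first exact: measurable_funX.
  apply: measurable_funM; first exact: measurable_indic.
  by apply: measurableT_comp => //; exact: measurableT_comp.
have h0 xs : (0 <= (EFin \o h) xs)%E.
  by rewrite lee_fin !mulr_ge0 ?expR_ge0 ?exprn_double_ge0.
transitivity (\int[leb]_x \int[leb]_s (EFin \o h) (x, s))%E.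
  apply: eq_integral => x _.
  rewrite EFinM expR_layer -ge0_integralZl//.
  - apply: eq_integral => s _; rewrite -EFinM /= /h/=; congr (_ * (_ * _))%:E.
    by rewrite !indicE; congr (nat_of_bool _)%:R; apply/idP/idP; rewrite !inE/= in_itv/= andbT.
  - apply/measurable_EFinP; apply: measurable_funM => //.
    by apply: measurableT_comp => //; exact: measurableT_comp.
  - by rewrite lee_fin exprn_double_ge0.
rewrite fubini_tonelli//.
rewrite /Gamma_int -ge0_integralZl//; last 3 first.
- apply/measurable_EFinP; apply: measurable_funTS; apply: measurable_funM.
    exact: measurable_powR.
  by apply: measurableT_comp => //; exact: measurableT_comp.
- by move=> x _; rewrite lee_fin mulr_ge0 ?powR_ge0 ?expR_ge0.
- by rewrite lee_fin !mulr_ge0 ?powR_ge0.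
rewrite [RHS]integral_mkcond.
apply: eq_integral => s _; have [s0|s0] := ltP s 0.
  rewrite patchE memNset; last by rewrite /= in_itv/= andbT; apply/negP; rewrite -leNgt ltW.
  rewrite integral0_eq// => x _; rewrite /= /h/= indicE memNset ?mul0r ?mulr0//=.
  by apply/negP; rewrite -ltNge (lt_le_trans s0)// divr_ge0 ?absp_ge0// ltW.
pose y := powR (p * s) p^-1.
transitivity (expR (- s) * (2 * y ^+ k.*2.+1 / k.*2.+1%:R))%:E.
  rewrite EFinM -(integral_even_power k (powR_ge0 _ _)) -ge0_integralZl//; last 2 first.
  - by apply/measurable_EFinP; apply: measurable_funTS; exact: measurable_funX.
  - by move=> x _; rewrite lee_fin exprn_double_ge0.
  rewrite [RHS]integral_mkcond; apply: eq_integral => x _; rewrite patchE /= /h/= indicE.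
  have E : (absp x / p <= s) = (x \in `[(- y)%R, y]).
    rewrite in_itv/= -ler_norml ler_pdivrMr// mulrC.
    have ps0 : 0 <= p * s by rewrite mulr_ge0// ltW.
    have yp : powR y p = p * s by rewrite /y -powRrM mulVf ?gt_eqF// powRr1.
    by rewrite -yp /absp ler_powRl ?powR_ge0.
  case: ifPn => [|/negP]; rewrite inE/= -E => xs.
    by rewrite mem_set//= mul1r mulrC EFinM.
  by rewrite memNset//= mul0r mulr0.
rewrite -powR_mulrn ?powR_ge0// /y -powRrM (mulrC p^-1) powRM ?(ltW p0)//.
rewrite patchE; case: ifPn => [_|/negP]; rewrite ?inE/= ?in_itv/= ?andbT.
  by rewrite -EFinM; congr (_%:E); ring.
(* The Gamma integral leaves out s = 0, where y = 0 and the other side vanishes as well. *)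
move=> /negP; rewrite -leNgt => s0'; have -> : s = 0 by apply/eqP; rewrite eq_le s0'.
by rewrite (powR0 (x := _ / _)) ?gt_eqF// !(mulr0, mul0r).
Qed.

End moments.

Section density_moments.
Context (R : realType) (p : R).
Hypothesis hp : 2 <= p.
Local Notation leb := (@lebesgue_measure R).

Let p0 : 0 < p. Proof. by apply: lt_le_trans hp. Qed.
Local Notation absp := (absp p).
Local Notation epow := (epow p).

Lemma abspM (c x : R) : absp (c * x) = powR `|c| p * absp x.
Proof. by rewrite /absp normrM powRM. Qed.

Lemma absp0 : absp 0 = 0.
Proof. by rewrite /absp normr0 powR0// gt_eqF. Qed.

(** For [absp_even_moment]: at x = 0 its layer integral vanishes while x^0 does not, so the
    integrands are compared off a null set. *)
Lemma eq_integral_off0 (f g : R -> \bar R) :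
  measurable_fun setT f -> measurable_fun setT g ->
  (forall x, x != 0 -> f x = g x) -> (\int[leb]_x f x = \int[leb]_x g x)%E.
Proof.
move=> mf mg fg.
have mD : measurable ([set: R] `\ 0) by exact: measurableD.
transitivity (\int[leb]_(x in setT `\ 0%R) f x)%E.
  by apply/esym/integral_setD1 => //; exact: measurable_funTS.
transitivity (\int[leb]_(x in setT `\ 0%R) g x)%E.
  by apply: eq_integral => x; rewrite inE/= => -[_ /eqP x0]; exact: fg.
by apply/integral_setD1 => //; exact: measurable_funTS.
Qed.

Let J k := (\int[leb]_x (absp x * x ^+ k.*2 * epow x)%:E)%E.

Let measurable_J k mu : measurable_fun setT (fun x : R => (absp x * x ^+ k.*2 * expR (- (mu * (absp x / p))))%:E).
Proof.
apply/measurable_EFinP; apply: measurable_funM.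
  by apply: measurable_funM; [exact: measurable_absp|exact: measurable_funX].
apply: measurableT_comp => //; apply: measurableT_comp => //.
by apply: measurable_funM => //; apply: measurable_funM => //; exact: measurable_absp.
Qed.

Let J_scale k (mu : R) : 0 < mu ->
  (\int[leb]_x (absp x * x ^+ k.*2 * expR (- (mu * (absp x / p))))%:E =
   (powR mu (- (k.*2.+1%:R / p) - 1))%:E * J k)%E.
Proof.
move=> mu0; pose c := powR mu (- p^-1).
have c0 : 0 < c by rewrite powR_gt0.
have muc : mu * powR c p = 1.
  rewrite /c -powRrM mulNr mulVf ?gt_eqF// powRN powRr1 ?ltW//.
  by rewrite divff// gt_eqF.
rewrite (@integral_homothety R c
    (fun x => (absp x * x ^+ k.*2 * expR (- (mu * (absp x / p))))%:E)); last first.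
- by move=> x; rewrite lee_fin !mulr_ge0 ?absp_ge0 ?exprn_double_ge0 ?expR_ge0.
- exact: measurable_J.
- by rewrite gt_eqF.
have -> : powR mu (- (k.*2.+1%:R / p) - 1) = c * (powR c p * c ^+ k.*2).
  rewrite mulrCA -exprS mulrC -powR_mulrn ?ltW// /c -!powRrM -powRD.
    by congr powR; field; rewrite gt_eqF.
  by rewrite (gt_eqF mu0) implybT.
have E x : absp (c * x) * (c * x) ^+ k.*2 * expR (- (mu * (absp (c * x) / p))) =
    (powR c p * c ^+ k.*2) * (absp x * x ^+ k.*2 * epow x).
  rewrite abspM exprMn gtr0_norm// /epow.
  have -> : mu * (powR c p * absp x / p) = absp x / p by rewrite !mulrA muc mul1r.
  ring.
under eq_integral do rewrite E EFinM.
rewrite ge0_integralZl//; last 3 first.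
- by have := measurable_J k 1; under eq_fun do rewrite mul1r.
- by move=> x _; rewrite lee_fin !mulr_ge0 ?absp_ge0 ?exprn_double_ge0 ?expR_ge0.
- by rewrite lee_fin !mulr_ge0 ?powR_ge0 ?exprn_ge0 ?ltW.
by rewrite muleA -EFinM gtr0_norm.
Qed.

(** Integration by parts without boundary terms. For x != 0, [epow x] is the integral over m >= 1 of
    (|x|^p / p) exp(- m |x|^p / p). Exchanging the integrals and rescaling x at fixed m leaves [J k]
    / p times the integral of m^(- a - 1), with a = (2 k + 1) / p, that is [J k] / (2 k + 1). *)
Lemma absp_even_moment k :
  (\int[leb]_x (absp x * x ^+ k.*2 * epow x)%:E =
   k.*2.+1%:R%:E * \int[leb]_x (x ^+ k.*2 * epow x)%:E)%E.
Proof.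
pose a := k.*2.+1%:R / p : R.
have a0 : 0 < a by rewrite divr_gt0.
pose h (xm : R * R) : R := \1_(`[1%R, +oo[ : set R) xm.2 * (p^-1 * (absp xm.1 * xm.1 ^+ k.*2 * expR (- (xm.2 * (absp xm.1 / p))))).
have mh : measurable_fun setT (EFin \o h).
  have ma : measurable_fun setT (absp \o @fst R R) by exact: (measurableT_comp (measurable_absp p)).
  apply/measurable_EFinP; apply: measurable_funM.
    by apply: (measurableT_comp (measurable_indic _)) => //; exact: measurable_itv.
  apply: measurable_funM => //; apply: measurable_funM.
    by apply: measurable_funM => //; exact: measurable_funX.
  apply: measurableT_comp => //; apply: measurableT_comp => //.
  by apply: measurable_funM => //; exact: measurable_funM.
have h0 xs : (0 <= (EFin \o h) xs)%E.
  by rewrite lee_fin !mulr_ge0 ?absp_ge0 ?expR_ge0 ?exprn_double_ge0// invr_ge0 ltW.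
have E1 : (\int[leb]_x \int[leb]_m (EFin \o h) (x, m) = \int[leb]_x (x ^+ k.*2 * epow x)%:E)%E.
  apply: eq_integral_off0.
  - exact: measurable_fun_fubini_tonelli_F.
  - apply/measurable_EFinP; apply: measurable_funM; last exact: measurable_epow.
    exact: measurable_funX.
  move=> x x0.
  have ap : 0 < absp x / p by rewrite divr_gt0// powR_gt0// normr_gt0.
  transitivity (\int[leb]_(m in `[1%R, +oo[) ((x ^+ k.*2)%:E * ((absp x / p) * expR (- (absp x / p) * m))%:E))%E.
    rewrite [RHS]integral_mkcond; apply: eq_integral => m _; rewrite patchE /h/= indicE.
    case: ifPn => _; last by rewrite mul0r.
    by rewrite mul1r -EFinM mulNr (mulrC m); congr (_%:E); ring.
  rewrite ge0_integralZl//; last 3 first.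
  - apply/measurable_EFinP; apply: measurable_funTS; apply: measurable_funM => //.
    by apply: measurableT_comp => //; exact: measurable_funM.
  - by move=> m _; rewrite lee_fin mulr_ge0 ?expR_ge0// ltW.
  - by rewrite lee_fin exprn_double_ge0.
  by rewrite integral_expR_tail// mulr1.
have J0 : (0 <= J k)%E.
  by apply: integral_ge0 => x _; rewrite lee_fin !mulr_ge0 ?absp_ge0 ?exprn_double_ge0 ?expR_ge0.
have E2 : (\int[leb]_m \int[leb]_x (EFin \o h) (x, m) = (p^-1 / a)%:E * J k)%E.
  transitivity (\int[leb]_(m in `[1%R, +oo[) ((p^-1)%:E * (powR m (- a - 1))%:E * J k))%E.
    rewrite [RHS]integral_mkcond; apply: eq_integral => m _; rewrite patchE.
    case: ifPn => [|/negP]; rewrite inE/= in_itv/= andbT => m1; last first.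
      rewrite integral0_eq// => x _; rewrite /h/= indicE memNset ?mul0r//=.
      by rewrite in_itv/= andbT.
    rewrite -muleA -J_scale ?(lt_le_trans ltr01)// -ge0_integralZl//.
    - apply: eq_integral => x _; rewrite /h/= indicE mem_set ?mul1r -?EFinM//=.
      by rewrite in_itv/= andbT.
    - exact: measurable_J.
    - by move=> x _; rewrite lee_fin !mulr_ge0 ?absp_ge0 ?exprn_double_ge0 ?expR_ge0.
    - by rewrite lee_fin invr_ge0 ltW.
  have mpow : measurable_fun (`[1%R, +oo[ : set R) (fun m : R => (powR m (- a - 1))%:E).
    by apply/measurable_EFinP; apply: measurable_funTS; exact: measurable_powR.
  rewrite ge0_integralZr//; last 2 first.
  - exact: measurable_funeM.
  - by move=> m _; rewrite mule_ge0// lee_fin ?powR_ge0// invr_ge0 ltW.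
  rewrite ge0_integralZl//; last 2 first.
  - by move=> m _; rewrite lee_fin powR_ge0.
  - by rewrite lee_fin invr_ge0 ltW.
  by rewrite integral_powR_tail// -EFinM.
rewrite -E1 fubini_tonelli// E2 muleA -EFinM.
suff -> : k.*2.+1%:R * (p^-1 / a) = 1 :> R by rewrite mul1e.
by rewrite /a; field; rewrite gt_eqF//= pnatr_eq0.
Qed.

Lemma even_moment_gt0 k : (0 < \int[leb]_x (x ^+ k.*2 * epow x)%:E)%E.
Proof.
pose c : R := 2^-1 ^+ k.*2 * expR (- p^-1).
have c0 : 0 < c by rewrite mulr_gt0 ?expR_gt0// exprn_gt0.
have h1 : (2^-1 : R) < 1 by lra.
apply: (@lt_le_trans _ _ (\int[leb]_(x in `[2^-1%R, 1%R]) c%:E)%E).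
  rewrite integral_cst//= lebesgue_measure_itv/= lte_fin h1 -EFinB -EFinM lte_fin.
  by rewrite mulr_gt0// subr_gt0.
have m1 : measurable_fun setT (fun x : R => (x ^+ k.*2 * epow x)%:E).
  apply/measurable_EFinP; apply: measurable_funM; last exact: measurable_epow.
  exact: measurable_funX.
apply: (@le_trans _ _ (\int[leb]_(x in `[2^-1%R, 1%R]) (x ^+ k.*2 * epow x)%:E)%E); last first.
  by apply: ge0_subset_integral => // x _; rewrite lee_fin mulr_ge0 ?expR_ge0 ?exprn_double_ge0.
apply: ge0_le_integral => //.
- by move=> x _; rewrite lee_fin ltW.
- exact: measurable_funTS.
- move=> x /=; rewrite in_itv/= => /andP[x0 x1].
  have xp : 0 < x by apply: lt_le_trans x0.
  rewrite lee_fin ler_pM ?exprn_ge0 ?expR_ge0//.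
    by rewrite lerXn2r ?nnegrE// ltW.
  rewrite /epow ler_expR lerN2 ler_piMl// ?invr_ge0 ?(ltW p0)//.
  rewrite /absp gtr0_norm// -(powRr0 x).
  by apply: ger_powR; rewrite ?xp ?x1// ltW.
Qed.

Lemma Gamma_even_moment k : (\int[leb]_x (x ^+ k.*2 * epow x)%:E =
  (2 * powR p (k.*2.+1%:R / p) / k.*2.+1%:R * Gamma (1 + k.*2.+1%:R / p))%:E)%E.
Proof.
rewrite even_moment_layer// [RHS]EFinM; congr (_ * _)%E.
have a0 : 0 <= k.*2.+1%:R / p by rewrite divr_ge0// ltW.
rewrite /Gamma (_ : 1 + k.*2.+1%:R / p - 1 = k.*2.+1%:R / p); last by ring.
rewrite fineK// ge0_fin_numE ?Gamma_int_fin//.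
by apply: integral_ge0 => x _; rewrite lee_fin mulr_ge0 ?powR_ge0 ?expR_ge0.
Qed.

(** [Gamma] is the [fine] part of an integral, so its positivity is not immediate; it is read off
    from the positive moment of order 0. *)
Lemma cp_gt0 : 0 < cp p.
Proof.
have := even_moment_gt0 0; rewrite Gamma_even_moment lte_fin pmulr_rgt0 => [G0|].
  by rewrite /cp divr_gt0 ?powR_gt0// mulr_gt0// -[p^-1]mul1r.
by rewrite !divr_gt0// mulr_gt0// powR_gt0.
Qed.

Lemma rhoE x : rho p x = cp p * epow x.
Proof. by []. Qed.

Lemma rho_ge0 x : 0 <= rho p x.
Proof. by rewrite mulr_ge0 ?expR_ge0 ?(ltW cp_gt0). Qed.

Lemma measurable_rho : measurable_fun setT (rho p : R -> R).
Proof. by apply: measurable_funM => //; exact: measurable_epow. Qed.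

Definition mom k : R := fine (\int[leb]_x (x ^+ k.*2 * rho p x)%:E)%E.

Lemma integral_rho (g : R -> R) : measurable_fun setT g -> (forall x, 0 <= g x) ->
  (\int[leb]_x (g x * rho p x)%:E = (cp p)%:E * \int[leb]_x (g x * epow x)%:E)%E.
Proof.
move=> mg g0; rewrite -ge0_integralZl//.
- by apply: eq_integral => x _; rewrite -EFinM rhoE mulrCA.
- by apply/measurable_EFinP; apply: measurable_funM => //; exact: measurable_epow.
- by move=> x _; rewrite lee_fin mulr_ge0 ?expR_ge0.
- by rewrite lee_fin ltW// cp_gt0.
Qed.

Lemma mom_fin k : (\int[leb]_x (x ^+ k.*2 * rho p x)%:E = (mom k)%:E)%E.
Proof.
rewrite /mom fineK// integral_rho//; last by move=> x; exact: exprn_double_ge0.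
by rewrite Gamma_even_moment -EFinM.
Qed.

Lemma momE k : mom k =
  cp p * (2 * powR p (k.*2.+1%:R / p) / k.*2.+1%:R * Gamma (1 + k.*2.+1%:R / p)).
Proof.
apply/EFin_inj; rewrite -mom_fin integral_rho//; last by move=> x; exact: exprn_double_ge0.
by rewrite Gamma_even_moment -EFinM.
Qed.

Lemma mom_gt0 k : 0 < mom k.
Proof.
rewrite -lte_fin -mom_fin integral_rho//; last by move=> x; exact: exprn_double_ge0.
by rewrite mule_gt0 ?even_moment_gt0// lte_fin cp_gt0.
Qed.

Let G0 : Gamma (1 + p^-1) != 0.
Proof.
apply/eqP => G0; have := mom_gt0 0.
by rewrite momE !mul1r G0 mulr0 mulr0 ltxx.
Qed.

Lemma mom0 : mom 0 = 1.
Proof.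
have P0 : powR p p^-1 != 0 by rewrite gt_eqF// powR_gt0.
rewrite momE (_ : 0.*2.+1%:R = 1 :> R)// !div1r /cp powRN.
by field; rewrite P0 G0.
Qed.

(** The origin of the critical constant: it is the inverse of the variance of [rho]. *)
Lemma mom1 : mom 1 = (betac p)^-1.
Proof.
have P0 : powR p p^-1 != 0 by rewrite gt_eqF// powR_gt0.
rewrite momE /cp /betac powRN !invfM !invrK.
have -> : 1.*2.+1%:R = 3 :> R by [].
have -> : powR p (3 / p) = powR p (2 / p) * powR p p^-1.
  rewrite -powRD; last by rewrite (gt_eqF p0) implybT.
  by congr powR; field; rewrite gt_eqF.
by field; rewrite P0 G0.
Qed.

Lemma betac_gt0 : 0 < betac p.
Proof. by have := mom_gt0 1; rewrite mom1 invr_gt0. Qed.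

Lemma rho_density : is_density leb (rho p : R -> R).
Proof.
split; [exact: measurable_rho|exact: rho_ge0|].
rewrite -[1%E]/(1%:E) -mom0 -mom_fin.
by apply: eq_integral => x _; rewrite [_ ^+ 0.*2]expr0 mul1r.
Qed.

Lemma absp_mom k :
  (\int[leb]_x (absp x * x ^+ k.*2 * rho p x)%:E = (k.*2.+1%:R * mom k)%:E)%E.
Proof.
rewrite integral_rho; last 2 first.
- by apply: measurable_funM; [exact: measurable_absp|exact: measurable_funX].
- by move=> x; rewrite mulr_ge0 ?absp_ge0 ?exprn_double_ge0.
rewrite absp_even_moment [RHS]EFinM -mom_fin integral_rho//; last by move=> x; exact: exprn_double_ge0.
by rewrite muleCA.
Qed.

(** A Chebyshev correlation argument in pointwise form. With M = [mom 1], x^2 - M |x|^p changes sign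
    from plus to minus where |x|^(p - 2) = 1 / M, and |x|^(2 k) minus its value there has the
    opposite sign, so the product is nonpositive. The witness is that value; on integration its
    terms cancel, since E|X|^p = 1. *)
Lemma mom_rec_pointwise k : exists2 c : R, 0 <= c & forall x,
  x ^+ k.+1.*2 + mom 1 * c * absp x <= mom 1 * (absp x * x ^+ k.*2) + c * x ^+ 2.
Proof.
have abspE x : absp x = x ^+ 2 * powR `|x| (p - 2).
  have [->|x0] := eqVneq x 0; first by rewrite absp0 expr0n mul0r.
  rewrite -[x ^+ 2]real_normK ?num_real// -powR_mulrn// -powRD ?normr_eq0 ?x0 ?implybT//.
  by rewrite /absp; congr powR; ring.
(* For p = 2 there is no crossing: |x|^p = x^2 and [mom 1] is 1, so both sides agree with c = 0. *)
have [p2|p2] := eqVneq p 2.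
  have E x : absp x = x ^+ 2 by rewrite abspE p2 subrr powRr0 mulr1.
  have m1 : mom 1 = 1.
    apply/EFin_inj; rewrite -mom_fin.
    transitivity (\int[leb]_x (absp x * x ^+ 0.*2 * rho p x)%:E)%E; last by rewrite absp_mom mom0 mulr1.
    by apply: eq_integral => x _; rewrite E [x ^+ 0.*2]expr0 mulr1.
  exists 0 => // x; rewrite m1 E mulr0 !mul0r !addr0 mul1r.
  by rewrite doubleS -addn2 exprD mulrC.
have p2' : 0 < p - 2 by rewrite subr_gt0 lt_neqAle eq_sym p2.
have M0 := mom_gt0 1.
pose c := powR (mom 1) (- (p - 2)^-1).
have c0 : 0 <= c by rewrite powR_ge0.
have Mc : mom 1 * powR c (p - 2) = 1.
  rewrite /c -powRrM mulNr mulVf ?gt_eqF// powRN powRr1 ?ltW//.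
  by rewrite divff// gt_eqF.
exists (c ^+ k.*2) => [|x]; first exact: exprn_ge0.
have xk : x ^+ k.*2 = `|x| ^+ k.*2 by rewrite -!mul2n !exprM real_normK ?num_real.
suff : (x ^+ 2 - mom 1 * absp x) * (x ^+ k.*2 - c ^+ k.*2) <= 0.
  by rewrite doubleS -[k.*2.+2]addn2 exprD; lra.
rewrite abspE xk.
have -> : x ^+ 2 - mom 1 * (x ^+ 2 * powR `|x| (p - 2)) =
    x ^+ 2 * (mom 1 * (powR c (p - 2) - powR `|x| (p - 2))) by rewrite mulrBr Mc; ring.
rewrite -mulrA mulr_ge0_le0 ?sqr_ge0// -mulrA mulr_ge0_le0 ?(ltW M0)//.
have [xc|xc] := leP `|x| c.
  rewrite mulr_ge0_le0 ?subr_ge0 ?subr_le0 ?ler_powRl//.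
  by case: (k.*2) => [|n]; rewrite ?expr0// lerXn2r ?nnegrE.
rewrite mulr_le0_ge0 ?subr_ge0 ?subr_le0 ?ler_powRl// ?(ltW xc)//.
by case: (k.*2) => [|n]; rewrite ?expr0// lerXn2r ?nnegrE// ltW.
Qed.

Lemma mom_rec k : mom k.+1 <= mom 1 * k.*2.+1%:R * mom k.
Proof.
have [c c0 H] := mom_rec_pointwise k.
have m0 := ltW (mom_gt0 1).
have mX n : measurable_fun setT (fun x : R => x ^+ n * rho p x).
  by apply: measurable_funM; [exact: measurable_funX|exact: measurable_rho].
have mA n : measurable_fun setT (fun x : R => absp x * x ^+ n * rho p x).
  apply: measurable_funM; last exact: measurable_rho.
  by apply: measurable_funM; [exact: measurable_absp|exact: measurable_funX].
have X0 n x : 0 <= x ^+ n.*2 * rho p x by rewrite mulr_ge0 ?rho_ge0 ?exprn_double_ge0.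
have A0 n x : 0 <= absp x * x ^+ n.*2 * rho p x.
  by rewrite mulr_ge0 ?rho_ge0// mulr_ge0 ?absp_ge0 ?exprn_double_ge0.
suff : (\int[leb]_x (1 * (x ^+ k.+1.*2 * rho p x) + (mom 1 * c) * (absp x * x ^+ 0.*2 * rho p x))%:E <=
  \int[leb]_x (mom 1 * (absp x * x ^+ k.*2 * rho p x) + c * (x ^+ 1.*2 * rho p x))%:E)%E.
  rewrite (ge0_integral_comb leb (mX _) (mA _) (X0 k.+1) (A0 0) ler01 (mulr_ge0 m0 c0)).
  rewrite (ge0_integral_comb leb (mA _) (mX _) (A0 k) (X0 1) m0 c0).
  rewrite !absp_mom !mom_fin mom0 -!EFinM -!EFinD lee_fin !mulr1 mul1r.
  by rewrite [c * _]mulrC lerD2r mulrA.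
apply: ge0_le_integral => //.
- move=> x _; rewrite lee_fin addr_ge0 ?mul1r ?X0//.
  by apply: mulr_ge0; [exact: mulr_ge0|exact: A0].
- apply/measurable_EFinP.
  by apply: measurable_funD; (apply: measurable_funM => //; first [exact: mX|exact: mA]).
- apply/measurable_EFinP.
  by apply: measurable_funD; (apply: measurable_funM => //; first [exact: mX|exact: mA]).
- move=> x _; rewrite lee_fin [x ^+ 0.*2]expr0 mul1r mulr1.
  by have := ler_wpM2r (rho_ge0 x) (H x); rewrite [x ^+ 1.*2]/(x ^+ 2); lra.
Qed.

End density_moments.

(** * The moment generating function *)

Section mgf.
Context (R : realType) (p : R).
Hypothesis hp : 2 <= p.
Local Notation leb := (@lebesgue_measure R).
Local Notation P := (density_prob (rho_density hp)).
Local Notation M := (mom p 1).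

Let p0 : 0 < p. Proof. by apply: lt_le_trans hp. Qed.

Lemma integral_rhoE (g : R -> R) : measurable_fun setT g ->
  (\int[P]_x (g x)%:E = \int[leb]_x (g x * rho p x)%:E)%E.
Proof.
move=> mg; rewrite integral_density; last exact/measurable_EFinP.
by apply: eq_integral => x _; rewrite -EFinM mulrC.
Qed.

Lemma integral_even k : (\int[P]_x (x ^+ k.*2)%:E = (mom p k)%:E)%E.
Proof. by rewrite integral_rhoE ?mom_fin//; exact: measurable_funX. Qed.

Lemma rhoN x : rho p (- x) = rho p x.
Proof. by rewrite /rho normrN. Qed.

Lemma integral_opp (g : R -> \bar R) : measurable_fun setT g -> (forall x, 0 <= g x)%E ->
  (\int[P]_x g (- x)%R = \int[P]_x g x)%E.
Proof.
move=> mg g0; have mgN : measurable_fun setT (fun x : R => g (- x)).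
  by apply: (measurableT_comp mg).
rewrite !integral_density// [RHS](integral_homothety (c := -1)) ?oppr_eq0 ?oner_eq0//.
- rewrite normrN1 mul1e; apply: eq_integral => x _.
  by rewrite mulN1r rhoN.
- apply: emeasurable_funM => //; apply/measurable_EFinP; exact: measurable_rho.
- by move=> x; rewrite mule_ge0// lee_fin rho_ge0.
Qed.

(** The law is even, so its moment generating function is the mean of cosh, whose Taylor terms are
    nonnegative and can be integrated one by one by monotone convergence. *)
Definition ch (x : R) : R := (expR x + expR (- x)) / 2.

Lemma ch_ge0 x : 0 <= ch x.
Proof. by rewrite divr_ge0// addr_ge0 ?expR_ge0. Qed.

Lemma chN x : ch (- x) = ch x.
Proof. by rewrite /ch opprK addrC. Qed.

Lemma measurable_ch : measurable_fun setT ch.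
Proof. by apply: measurable_funM => //; apply: measurable_funD => //; exact: measurableT_comp. Qed.

Definition ch_sum n (x : R) : R := \sum_(k < n) x ^+ k.*2 / k.*2`!%:R.

Lemma ch_sum_ge0 n x : 0 <= ch_sum n x.
Proof. by apply: sumr_ge0 => k _; rewrite divr_ge0 ?exprn_double_ge0. Qed.

Lemma ch_sum_nd x : nondecreasing_seq (ch_sum ^~ x).
Proof.
apply/nondecreasing_seqP => n; rewrite /ch_sum big_ord_recr/= lerDl.
by rewrite divr_ge0 ?exprn_double_ge0.
Qed.

Lemma cvg_ch_sum x : ch_sum ^~ x @ \oo --> ch x.
Proof.
have E n : ch_sum n x = (series (exp_coeff x) n.*2 + series (exp_coeff (- x)) n.*2) / 2.
  elim: n => [|n IH]; first by rewrite /ch_sum big_ord0 /series/= !big_geq// addr0 mul0r.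
  rewrite /ch_sum big_ord_recr/= -/(ch_sum n x) IH doubleS /series/= !big_nat_recr//=.
  rewrite /exp_coeff/=.
  have -> : (- x) ^+ n.*2 = x ^+ n.*2 by rewrite -!mul2n !exprM sqrrN.
  have -> : (- x) ^+ n.*2.+1 = - x ^+ n.*2.+1.
    by rewrite exprNn -signr_odd/= odd_double expr1 mulN1r.
  by field; rewrite !pnatr_eq0 -!lt0n !fact_gt0.
under eq_fun do rewrite E.
have dbl : n.*2 @[n --> \oo] --> \oo.
  by apply/cvgnyPge => A; exists A => //= n /= An; rewrite -addnn (leq_trans An)// leq_addr.
apply: cvgM; last exact: cvg_cst.
apply: cvgD; apply: (cvg_comp _ _ dbl); exact: is_cvg_series_exp_coeff.
Qed.

Lemma ch_sum_le n x : ch_sum n x <= ch x.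
Proof.
have c := @cvg_ch_sum x; rewrite -(cvg_lim (@Rhausdorff R) c).
by apply: (nondecreasing_cvgn_le (@ch_sum_nd x)); apply/cvg_ex; exists (ch x).
Qed.

(** The right side is the moment of order 2k of a centred Gaussian of variance M, for which the
    recursion [mom_rec] is an equality. *)
Lemma mom_le k : mom p k <= M ^+ k * k.*2`!%:R / (2 ^+ k * k`!%:R).
Proof.
elim: k => [|k IH]; first by rewrite mom0// (_ : 0.*2`!%:R = 1 :> R)// !expr0 !mul1r invr1.
have f0 : (k`!%:R : R) != 0 by rewrite pnatr_eq0 -lt0n fact_gt0.
apply: (le_trans (mom_rec hp k)); rewrite -mulrA.
have -> : M ^+ k.+1 * k.+1.*2`!%:R / (2 ^+ k.+1 * k.+1`!%:R) =
    M * (k.*2.+1%:R * (M ^+ k * k.*2`!%:R / (2 ^+ k * k`!%:R))).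
  rewrite doubleS !factS !natrM !exprS -[k.*2.+2%:R]/((k.+1).*2%:R) -mul2n natrM.
  by field; rewrite f0 expf_neq0// [1 + _]nat1r pnatr_eq0.
by rewrite ler_wpM2l ?(ltW (mom_gt0 hp 1))// ler_wpM2l.
Qed.

Lemma integral_ch_sum n t :
  (\int[P]_x (ch_sum n (t * x))%:E = (\sum_(k < n) t ^+ k.*2 / k.*2`!%:R * mom p k)%:E)%E.
Proof.
rewrite /ch_sum; under eq_integral do rewrite -sumEFin.
rewrite ge0_integral_sum//.
- rewrite -sumEFin; apply: eq_bigr => k _; rewrite EFinM -integral_even -ge0_integralZl//.
  + by apply: eq_integral => x _; rewrite -EFinM exprMn mulrAC.
  + by apply/measurable_EFinP; exact: measurable_funX.
  + by move=> x _; rewrite lee_fin exprn_double_ge0.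
  + by rewrite lee_fin divr_ge0 ?exprn_double_ge0.
- move=> k; apply/measurable_EFinP; apply: measurable_funM => //; apply: measurable_funX.
  exact: measurable_funM.
- by move=> k x _; rewrite lee_fin divr_ge0 ?exprn_double_ge0.
Qed.

(** Termwise comparison with the series of exp(t^2 M / 2): the factor (2k)! of the Gaussian moments
    cancels the one in cosh. *)
Lemma integral_ch_le t : (\int[P]_x (ch (t * x))%:E <= (expR (t ^+ 2 * M / 2))%:E)%E.
Proof.
have mt : measurable_fun setT (fun x : R => t * x) by exact: measurable_funM.
have ms n : measurable_fun setT (fun x : R => (ch_sum n (t * x))%:E).
  apply/measurable_EFinP; apply: measurable_sum => k; apply: measurable_funM => //.
  exact: measurable_funX.
have -> : (\int[P]_x (ch (t * x))%:E = limn (fun n => \int[P]_x (ch_sum n (t * x))%:E))%E.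
  rewrite -monotone_convergence//.
  - apply: eq_integral => x _; apply/esym/cvg_lim => //.
    by apply/fine_cvgP; split; [exact: nearW|exact: cvg_ch_sum].
  - by move=> n x _; rewrite lee_fin ch_sum_ge0.
  - by move=> x _ m n mn; rewrite lee_fin; exact: ch_sum_nd.
apply: lime_le.
  apply: ereal_nondecreasing_is_cvgn => m n mn; apply: ge0_le_integral => //.
  - by move=> x _; rewrite lee_fin ch_sum_ge0.
  - exact: ms.
  - exact: ms.
  - by move=> x _; rewrite lee_fin; exact: ch_sum_nd.
apply: nearW => n; rewrite integral_ch_sum lee_fin.
have y0 : 0 <= t ^+ 2 * M / 2 by rewrite divr_ge0// mulr_ge0 ?sqr_ge0// ltW// mom_gt0.
apply: (@le_trans _ _ (series (exp_coeff (t ^+ 2 * M / 2)) n)); last first.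
  apply: nondecreasing_cvgn_le; last exact: is_cvg_series_exp_coeff.
  by apply: nondecreasing_series => // k _; rewrite exp_coeff_ge0.
rewrite /series/= big_mkord; apply: ler_sum => k _; rewrite /exp_coeff/=.
apply: (@le_trans _ _ (t ^+ k.*2 / k.*2`!%:R * (M ^+ k * k.*2`!%:R / (2 ^+ k * k`!%:R)))).
  by rewrite ler_wpM2l ?mom_le// divr_ge0 ?exprn_double_ge0.
have f0 : (k`!%:R : R) != 0 by rewrite pnatr_eq0 -lt0n fact_gt0.
have f1 : (k.*2`!%:R : R) != 0 by rewrite pnatr_eq0 -lt0n fact_gt0.
rewrite -mul2n in f1 *; rewrite exprM !exprMn exprVn le_eqVlt; apply/orP; left; apply/eqP.
by field; rewrite f0 f1 expf_neq0.
Qed.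

(** Only the first two terms of cosh are kept; this yields the growth of [psi] near 0 that makes the
    free energy positive above [betac]. *)
Lemma integral_ch_ge t : ((1 + t ^+ 2 * M / 2)%:E <= \int[P]_x (ch (t * x))%:E)%E.
Proof.
have -> : (1 + t ^+ 2 * M / 2)%:E = (\int[P]_x (ch_sum 2 (t * x))%:E)%E.
  rewrite integral_ch_sum !big_ord_recr big_ord0/= mom0//; congr (_%:E).
  rewrite [t ^+ 0.*2]expr0 (_ : 0.*2`!%:R = 1 :> R)// (_ : 1.*2`!%:R = 2 :> R)//.
  by rewrite [t ^+ 1.*2]/(t ^+ 2); field.
have mt : measurable_fun setT (fun x : R => t * x) by exact: measurable_funM.
apply: ge0_le_integral => //.
- by move=> x _; rewrite lee_fin ch_sum_ge0.
- apply/measurable_EFinP; apply: measurable_sum => k; apply: measurable_funM => //.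
  exact: measurable_funX.
- by apply/measurable_EFinP; exact: (measurableT_comp measurable_ch).
- by move=> x _; rewrite lee_fin ch_sum_le.
Qed.

Lemma integral_expR_ch t : (\int[P]_x (expR (t * x))%:E = \int[P]_x (ch (t * x))%:E)%E.
Proof.
have mt (s : R) : measurable_fun setT (fun x : R => expR (s * x)).
  by apply: measurableT_comp => //; exact: measurable_funM.
have E x : ch (t * x) = 2^-1 * expR (t * x) + 2^-1 * expR (- t * x).
  by rewrite /ch mulNr; field.
under [RHS]eq_integral do rewrite E.
have e0 (s x : R) : 0 <= expR (s * x) by exact: expR_ge0.
rewrite (ge0_integral_comb P (mt t) (mt (- t)) (e0 t) (e0 (- t)))//.
rewrite -[in X in (_ + X)%E](integral_opp (g := fun x => (expR (- t * x))%:E)); last 2 first.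
- exact/measurable_EFinP.
- by move=> x; rewrite lee_fin expR_ge0.
under [X in (_ + _ * X)%E]eq_integral do rewrite mulrNN.
rewrite -ge0_muleDl ?lee_fin//.
by rewrite -EFinD (_ : 2^-1 + 2^-1 = 1 :> R) ?mul1e//; field.
Qed.

(** The two bounds on the mean of cosh make the integral finite and positive, so that neither [fine]
    nor [ln] in [psi] takes a default value. *)
Lemma expR_psi t : (\int[P]_x (expR (t * x))%:E = (expR (psi p t))%:E)%E.
Proof.
have mt : measurable_fun setT (fun x : R => expR (t * x)).
  by apply: measurableT_comp => //; exact: measurable_funM.
rewrite /psi -integral_rhoE// integral_expR_ch.
have := integral_ch_ge t; have := integral_ch_le t.
case: (\int[P]_x _)%E => [r| |]//= _; rewrite lee_fin => r1; rewrite lnK// posrE.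
by apply: lt_le_trans r1; rewrite ltr_pwDl// divr_ge0// mulr_ge0 ?sqr_ge0// ltW// mom_gt0.
Qed.

Lemma integral_ch t : (\int[P]_x (ch (t * x))%:E = (expR (psi p t))%:E)%E.
Proof. by rewrite -integral_expR_ch expR_psi. Qed.

Lemma psi_le t : psi p t <= t ^+ 2 * M / 2.
Proof. by rewrite -ler_expR -lee_fin -expR_psi integral_expR_ch integral_ch_le. Qed.

Lemma expR_psi_ge t : 1 + t ^+ 2 * M / 2 <= expR (psi p t).
Proof. by rewrite -lee_fin -expR_psi integral_expR_ch integral_ch_ge. Qed.

End mgf.

(** * Tilting homogeneous functions *)

Section tilting.
Context (R : realType) (p : R).
Hypothesis hp : 2 <= p.
Local Notation P := (density_prob (rho_density hp)).
Local Notation Pn n := (tuple_prob P n).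

Let p0 : 0 < p. Proof. by apply: lt_le_trans hp. Qed.

(** Statistics are functions of sequences, as in [iprod]; asking measurability at every length lets
    inductions on n pass from F to F (x :: s). *)
Definition mseq (F : seq R -> R) :=
  forall n, measurable_fun setT (fun t : n.-tuple (measurableTypeR R) => F t).

Definition En n (F : seq R -> R) : \bar R := (\int[Pn n]_t (F t)%:E)%E.

Definition sabs (s : seq R) : R := \sum_(x <- s) absp p x.

Lemma sabs_ge0 s : 0 <= sabs s.
Proof. by apply: sumr_ge0 => x _; exact: absp_ge0. Qed.

Lemma sabs_scale c s : sabs (map ( *%R c) s) = powR `|c| p * sabs s.
Proof. by rewrite /sabs big_map mulr_sumr; apply: eq_bigr => x _; rewrite abspM. Qed.

Lemma mseq_sum (g : R -> R) : measurable_fun setT g -> mseq (fun s => \sum_(x <- s) g x).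
Proof. by move=> mg n; exact: (@measurable_tuple_sum _ (measurableTypeR R) R n g mg). Qed.

Lemma mseq_sabs : mseq sabs.
Proof. by apply: mseq_sum; exact: measurable_absp. Qed.

Lemma mseq_cst c : mseq (fun=> c).
Proof. by move=> n; exact: measurable_cst. Qed.

Lemma mseqD F G : mseq F -> mseq G -> mseq (fun s => F s + G s).
Proof. by move=> mF mG n; apply: measurable_funD; [exact: mF|exact: mG]. Qed.

Lemma mseqM F G : mseq F -> mseq G -> mseq (fun s => F s * G s).
Proof. by move=> mF mG n; apply: measurable_funM; [exact: mF|exact: mG]. Qed.

Lemma mseq_comp (g : R -> R) F : measurable_fun setT g -> mseq F -> mseq (g \o F).
Proof. by move=> mg mF n; exact: (measurableT_comp mg (mF n)). Qed.

Lemma mseq_map c F : mseq F -> mseq (fun s => F (map ( *%R c) s)).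
Proof.
move=> mF n; apply: (measurableT_comp (mF n) (g := fun t => map_tuple ( *%R c) t)).
apply/measurable_fun_tnthP => i.
rewrite [X in measurable_fun _ X](_ : _ = fun t => c * tnth t i); last first.
  by apply/funext => t /=; rewrite tnth_map.
by apply: measurable_funM => //; exact: measurable_tnth.
Qed.

Lemma mseq_cons x F : mseq F -> mseq (fun s => F (x :: s)).
Proof. by move=> mF n; exact: (measurable_cons_l (T := measurableTypeR R) x (mF n.+1)). Qed.

Lemma EnS n F : mseq F -> (forall s, 0 <= F s) ->
  En n.+1 F = (\int[P]_x En n (fun s => F (x :: s)))%E.
Proof.
move=> mF F0; apply: (@ge0_integral_tuple_probS _ (measurableTypeR R) R P n (fun t => (F t)%:E)).
  by apply/measurable_EFinP; exact: mF.
by move=> t; rewrite lee_fin.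
Qed.

Lemma measurable_EnS n F : mseq F -> (forall s, 0 <= F s) ->
  measurable_fun setT (fun x => En n (fun s => F (x :: s))).
Proof.
move=> mF F0.
apply: (@measurable_fun_fubini_tonelli_F _ _ _ _ _ (Pn n) (fun xt => (F (xt.1 :: xt.2))%:E)).
  apply/measurable_EFinP; apply: (measurableT_comp (mF n.+1)).
  exact: measurable_cons_tuple.
by move=> xt; rewrite lee_fin.
Qed.

Lemma En_ge0 n F : (forall s, 0 <= F s) -> (0 <= En n F)%E.
Proof. by move=> F0; apply: integral_ge0 => t _; rewrite lee_fin. Qed.

Lemma En0 F : mseq F -> En 0 F = (F [::])%:E.
Proof.
move=> mF; apply: (@integral_tuple_prob0 _ (measurableTypeR R) R P (fun t => (F t)%:E)).
by apply/measurable_EFinP; exact: mF.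
Qed.

Lemma En_le n F G : mseq F -> mseq G -> (forall s, 0 <= F s) ->
  (forall s, size s = n -> F s <= G s) -> (En n F <= En n G)%E.
Proof.
move=> mF mG F0 FG; apply: ge0_le_integral => //.
- by move=> t _; rewrite lee_fin.
- by apply/measurable_EFinP; exact: mF.
- by apply/measurable_EFinP; exact: mG.
- by move=> t _; rewrite lee_fin FG// size_tuple.
Qed.

Lemma En_comb n F G a b : mseq F -> mseq G -> (forall s, 0 <= F s) -> (forall s, 0 <= G s) ->
  0 <= a -> 0 <= b ->
  En n (fun s => a * F s + b * G s) = (a%:E * En n F + b%:E * En n G)%E.
Proof.
move=> mF mG F0 G0 a0 b0.
by apply: (ge0_integral_comb (Pn n) (mF n) (mG n) _ _ a0 b0) => t.
Qed.

Lemma EnZ n F a : mseq F -> (forall s, 0 <= F s) -> 0 <= a ->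
  En n (fun s => a * F s) = (a%:E * En n F)%E.
Proof.
move=> mF F0 a0; rewrite /En -ge0_integralZl//.
- by apply/measurable_EFinP; exact: mF.
- by move=> t _; rewrite lee_fin.
Qed.

Lemma En_cst n c : 0 <= c -> En n (fun=> c) = c%:E.
Proof.
move=> c0; transitivity (c%:E * Pn n setT)%E; first exact: integral_cst.
by rewrite (probability_setT (Pn n)) mule1.
Qed.

Lemma eq_En n F G : (forall s, size s = n -> F s = G s) -> En n F = En n G.
Proof. by move=> FG; apply: eq_integral => t _; rewrite FG// size_tuple. Qed.

Lemma En_prod n (g : R -> R) : measurable_fun setT g -> (forall x, 0 <= g x) ->
  En n (fun s => \prod_(x <- s) g x) = ((\int[P]_x (g x)%:E) ^+ n)%E.
Proof. exact: (@integral_tuple_prob_prod _ (measurableTypeR R) R P n g). Qed.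

Lemma En_sum n J (F : nat -> seq R -> R) : (forall j, mseq (F j)) -> (forall j s, 0 <= F j s) ->
  (En n (fun s => \sum_(j < J) F j s)%R = \sum_(j < J) En n (F j))%E.
Proof.
move=> mF F0; rewrite /En -ge0_integral_sum//.
- by apply: eq_integral => t _; rewrite sumEFin.
- by move=> j; apply/measurable_EFinP; exact: mF.
- by move=> j t _; rewrite lee_fin.
Qed.

Lemma integral_rho_scale (c : R) (g : R -> \bar R) : c != 0 ->
  measurable_fun setT g -> (forall x, 0 <= g x)%E ->
  (\int[P]_x g x = `|c|%:E *
    \int[P]_x ((expR (- ((powR `|c| p - 1) * absp p x / p)))%:E * g (c * x)%R))%E.
Proof.
move=> c0 mg g0.
have mgc : measurable_fun setT (fun x : R => g (c * x)).
  by apply: (measurableT_comp mg); exact: measurable_funM.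
have mr : measurable_fun setT (fun x => (rho p x)%:E : \bar R).
  by apply/measurable_EFinP; exact: measurable_rho.
have me : measurable_fun setT (fun x : R => (expR (- ((powR `|c| p - 1) * absp p x / p)))%:E : \bar R).
  apply/measurable_EFinP; apply: measurableT_comp => //; apply: measurableT_comp => //.
  by apply: measurable_funM => //; apply: measurable_funM => //; exact: measurable_absp.
rewrite !integral_density//; last exact: emeasurable_funM.
rewrite (integral_homothety c0); last 2 first.
- exact: emeasurable_funM.
- by move=> x; rewrite mule_ge0// lee_fin rho_ge0.
congr (_ * _)%E; apply: eq_integral => x _; rewrite muleA -EFinM; congr (_%:E * _)%E.
by rewrite !rhoE /epow -[RHS]mulrA -expRD abspM; congr (_ * expR _); ring.
Qed.

Lemma En_scale n (c : R) F : c != 0 -> mseq F -> (forall s, 0 <= F s) ->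
  (En n F = (`|c| ^+ n)%:E *
    En n (fun s => expR (- ((powR `|c| p - 1) * sabs s / p)) * F (map ( *%R c) s))%R)%E.
Proof.
move=> c0; elim: n F => [|n IH] F mF F0.
  have mm : mseq (fun s => expR (- ((powR `|c| p - 1) * sabs s / p)) * F (map ( *%R c) s)).
    apply: mseqM; last exact: mseq_map.
    apply: (mseq_comp (g := fun y => expR (- ((powR `|c| p - 1) * y / p)))); last exact: mseq_sabs.
    by apply: measurableT_comp => //; apply: measurableT_comp => //; apply: measurable_funM => //; exact: measurable_funM.
  by rewrite !En0//= /sabs big_nil mulr0 mul0r oppr0 expR0 !mul1e mul1r.
have mm (G : seq R -> R) : mseq G -> mseq (fun s => expR (- ((powR `|c| p - 1) * sabs s / p)) * G s).
  move=> mG; apply: mseqM => //.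
  apply: (mseq_comp (g := fun y => expR (- ((powR `|c| p - 1) * y / p)))); last exact: mseq_sabs.
  by apply: measurableT_comp => //; apply: measurableT_comp => //; apply: measurable_funM => //; exact: measurable_funM.
rewrite EnS// (integral_rho_scale c0); last 2 first.
- exact: measurable_EnS.
- by move=> x; exact: En_ge0.
rewrite exprS EFinM -muleA EnS; last 2 first.
- by apply: mm; exact: mseq_map.
- by move=> s; rewrite mulr_ge0 ?expR_ge0.
congr (_ * _)%E.
have mH : measurable_fun setT (fun x : R => En n (fun s =>
    expR (- ((powR `|c| p - 1) * sabs (x :: s) / p)) * F (map ( *%R c) (x :: s)))).
  by apply: (measurable_EnS n (mm _ (mseq_map c mF))) => s; rewrite mulr_ge0 ?expR_ge0.
rewrite -ge0_integralZl//; last by move=> x _; apply: En_ge0 => s; rewrite mulr_ge0 ?expR_ge0.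
apply: eq_integral => x _; rewrite IH//; last exact: mseq_cons.
rewrite muleCA; congr (_ * _)%E.
rewrite -EnZ ?expR_ge0//.
- apply: eq_En => s _; rewrite mulrA -expRD /sabs big_cons/=; congr (expR _ * _); ring.
- by apply: (mm (fun s => F (c * x :: map ( *%R c) s))); apply: (mseq_map c (mseq_cons _ mF)).
- by move=> s; rewrite mulr_ge0 ?expR_ge0.
Qed.

Definition homogeneous (F : seq R -> R) := forall c s, 0 < c -> F (map ( *%R c) s) = F s.

Lemma En_tilt n (r : R) F (h : R -> R) : 0 < r -> mseq F -> (forall s, 0 <= F s) ->
  homogeneous F -> measurable_fun setT h -> (forall x, 0 <= h x) ->
  (En n (fun s => F s * h (sabs s) * expR ((1 - r^-1) * sabs s / p))%R =
  (powR r (n%:R / p))%:E * En n (fun s => F s * h (r * sabs s))%R)%E.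
Proof.
(* Scaling the coordinates by r^(1/p) multiplies [sabs] by r; the tilt becomes exp((r - 1) S / p),
   which cancels the ratio of the densities. *)
move=> r0 mF F0 hF mh h0; pose c := powR r p^-1.
have c0 : 0 < c by exact: powR_gt0.
have cp : powR c p = r by rewrite /c -powRrM mulVf ?gt_eqF// powRr1// ltW.
have me a : mseq (fun s => expR (a * sabs s / p)).
  apply: (mseq_comp (g := fun y => expR (a * y / p))); last exact: mseq_sabs.
  by apply: measurableT_comp => //; apply: measurable_funM => //; exact: measurable_funM.
rewrite (@En_scale n c) ?gt_eqF//; last 2 first.
- apply: mseqM => //; apply: mseqM => //; exact: (mseq_comp mh mseq_sabs).
- by move=> s; rewrite !mulr_ge0 ?expR_ge0.
rewrite gtr0_norm// cp; congr (_%:E * _)%E.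
  by rewrite -powR_mulrn ?powR_ge0// /c -powRrM mulrC.
apply: eq_En => s _; rewrite hF// sabs_scale gtr0_norm// cp.
rewrite mulrCA -expRD; set e := _ + _.
suff -> : e = 0 by rewrite expR0 mulr1.
by rewrite /e; field; rewrite !gt_eqF.
Qed.

End tilting.

(** * Normalized vectors, the Hamiltonian and the lower bound *)

Section model.
Context (R : realType) (p : R).
Hypothesis hp : 2 <= p.
Local Notation P := (density_prob (rho_density hp)).
Local Notation Pn n := (tuple_prob P n).
Local Notation En := (En hp).
Local Notation sabs := (sabs p).

Let p0 : 0 < p. Proof. by apply: lt_le_trans hp. Qed.

Definition A2 (s : seq R) : R := (size s)%:R^-1 * \sum_(x <- s) x ^+ 2.
Definition mh (s : seq R) : R := magn (hatv p s).
Definition ah (s : seq R) : R := A2 (hatv p s).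

Lemma size_hatv s : size (hatv p s) = size s.
Proof. exact: size_map. Qed.

Lemma normp_ge0 s : 0 <= normp p s.
Proof. exact: powR_ge0. Qed.

Lemma normp_powR s : powR (normp p s) p = (size s)%:R^-1 * sabs s.
Proof.
by rewrite /normp -powRrM mulVf ?gt_eqF// powRr1// mulr_ge0 ?invr_ge0// sabs_ge0.
Qed.

Lemma mhE s : mh s = magn s / normp p s.
Proof. by rewrite /mh /magn size_hatv big_map -mulr_suml mulrA. Qed.

Lemma ahE s : ah s = A2 s / normp p s ^+ 2.
Proof.
rewrite /ah /A2 size_hatv big_map -mulrA mulr_suml; congr (_ * _).
by apply: eq_bigr => x _; rewrite exprMn exprVn.
Qed.

Lemma normp_scale c s : 0 < c -> normp p (map ( *%R c) s) = c * normp p s.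
Proof.
move=> c0; rewrite /normp size_map -/(absp p _) -/(sabs _) sabs_scale mulrCA powRM ?powR_ge0//.
  by rewrite -powRrM mulfV ?gt_eqF// powRr1 ?gtr0_norm ?ltW.
by rewrite mulr_ge0 ?invr_ge0 ?sabs_ge0.
Qed.

Lemma hatv_scale c s : 0 < c -> hatv p (map ( *%R c) s) = hatv p s.
Proof.
move=> c0; rewrite /hatv normp_scale// -map_comp; apply: eq_map => x /=.
by rewrite invfM mulrACA mulfV ?mul1r// gt_eqF.
Qed.

Lemma mh_scale c s : 0 < c -> mh (map ( *%R c) s) = mh s.
Proof. by move=> c0; rewrite /mh hatv_scale. Qed.

Lemma mseq_size (g : R -> R) : mseq (fun s => g (size s)%:R).
Proof.
move=> n; rewrite (_ : (fun _ => _) = fun=> g n%:R); first exact: measurable_cst.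
by apply/funext => t; rewrite size_tuple.
Qed.

Lemma mseq_normp : mseq (normp p).
Proof.
apply: (mseq_comp (measurable_powR p^-1) (F := fun s => (size s)%:R^-1 * sabs s)).
by apply: mseqM; [exact: (mseq_size (fun x => x^-1))|exact: mseq_sabs].
Qed.

Lemma mseq_inv F : mseq F -> (forall s, 0 <= F s) -> mseq (fun s : seq R => (F s)^-1).
Proof.
move=> mF F0 n; rewrite (_ : (fun _ => _) = fun t : n.-tuple _ => powR (F t) (-1)); last first.
  by apply/funext => t; rewrite powR_inv1.
exact: (measurableT_comp (measurable_powR (-1)) (mF n)).
Qed.

Lemma mseq_mh : mseq mh.
Proof.
rewrite (_ : mh = fun s => (size s)%:R^-1 * (\sum_(x <- s) x) * (normp p s)^-1); last first.
  by apply/funext => s; rewrite mhE.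
apply: mseqM; last exact: (mseq_inv mseq_normp normp_ge0).
by apply: mseqM; [exact: (mseq_size (fun x => x^-1))|apply: mseq_sum].
Qed.

Lemma mseq_ah : mseq ah.
Proof.
rewrite (_ : ah = fun s => (size s)%:R^-1 * (\sum_(x <- s) x ^+ 2) * (normp p s)^-1 ^+ 2); last first.
  by apply/funext => s; rewrite ahE exprVn.
apply: mseqM; last first.
  by apply: (mseq_comp (g := fun y => y ^+ 2)) => //; exact: (mseq_inv mseq_normp normp_ge0).
by apply: mseqM; [exact: (mseq_size (fun x => x^-1))|apply: mseq_sum].
Qed.

(** The exponents p / 2 and p / (p - 2) are conjugate. At p = 2 the power of v is v^0 = 1, even for
    v = 0, and both sides equal a^2. *)
Lemma young (a v : R) : 0 <= a -> 0 <= v ->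
  a ^+ 2 * powR v (p - 2) <= 2 / p * powR a p + (1 - 2 / p) * powR v p.
Proof.
move=> a0 v0; have [->|p2] := eqVneq p 2.
  by rewrite subrr powRr0 mulr1 divff ?pnatr_eq0// subrr mul0r addr0 mul1r powR_mulrn.
have p2' : 0 < p - 2 by rewrite subr_gt0 lt_neqAle eq_sym p2.
have q1 : 0 < p / 2 by rewrite divr_gt0.
have q2 : 0 < p / (p - 2) by rewrite divr_gt0.
have q12 : (p / 2)^-1 + (p / (p - 2))^-1 = 1.
  by field; rewrite !gt_eqF.
apply: (le_trans (conjugate_powR (sqr_ge0 a) (powR_ge0 v (p - 2)) q1 q2 q12)).
rewrite -powR_mulrn// -!powRrM.
have -> : 2 * (p / 2) = p by field.
have -> : (p - 2) * (p / (p - 2)) = p by field; rewrite gt_eqF.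
rewrite le_eqVlt; apply/orP; left; apply/eqP.
by field; rewrite !gt_eqF.
Qed.

(** Equality holds for a nonzero norm; otherwise division by zero makes [hatv] a zero vector. *)
Lemma sum_absp_hatv s : \sum_(x <- hatv p s) absp p x <= (size s)%:R.
Proof.
rewrite big_map (eq_bigr (fun x => (powR (normp p s) p)^-1 * absp p x)); last first.
  move=> x _; rewrite mulrC abspM ger0_norm ?invr_ge0 ?normp_ge0//; congr (_ * _).
  by rewrite -powR_inv1 ?normp_ge0// -powRrM mulrC powRrM powR_inv1 ?powR_ge0.
rewrite -mulr_sumr -/(sabs s) normp_powR.
have [->|s0] := eqVneq (sabs s) 0; first by rewrite mulr0.
by rewrite invfM invrK -mulrA mulVf ?mulr1.
Qed.

Lemma ah_ge0 s : 0 <= ah s.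
Proof. by rewrite mulr_ge0 ?invr_ge0//; apply: sumr_ge0 => x _; exact: sqr_ge0. Qed.

(** Comparison of the quadratic and the p-th power means: [young] with v = 1, summed over the
    coordinates. *)
Lemma ah_le1 s : ah s <= 1.
Proof.
have [s0|s0] := posnP (size s); first by rewrite /ah /A2 size_hatv s0 invr0 mul0r.
have n0 : 0 < (size s)%:R :> R by rewrite ltr0n.
rewrite /ah /A2 size_hatv ler_pdivrMl// mulr1.
apply: (@le_trans _ _ (\sum_(x <- hatv p s) (2 / p * absp p x + (1 - 2 / p)))).
  apply: ler_sum => x _; have := young (normr_ge0 x) ler01.
  by rewrite !powR1 !mulr1 real_normK ?num_real.
rewrite big_split/= -mulr_sumr big_const_seq count_predT iter_addr_0 size_hatv -mulr_natr.
have H : 2 / p * \sum_(x <- hatv p s) absp p x <= 2 / p * (size s)%:R.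
  by rewrite ler_wpM2l ?sum_absp_hatv// divr_ge0// ltW.
lra.
Qed.

Lemma mh_le1 s : `|mh s| <= 1.
Proof.
have [s0|s0] := posnP (size s); first by rewrite /mh /magn size_hatv s0 invr0 mul0r normr0.
have n0 : 0 < (size s)%:R :> R by rewrite ltr0n.
have := ah_le1 s; rewrite /mh /ah /magn /A2 size_hatv normrM ger0_norm ?invr_ge0 ?(ltW n0)//.
rewrite !ler_pdivrMl// !mulr1 => A1.
apply: (le_trans (ler_norm_sum _ _ _)).
apply: (@le_trans _ _ (\sum_(x <- hatv p s) (2^-1 * x ^+ 2 + 2^-1))).
  apply: ler_sum => x _; rewrite -[x ^+ 2]real_normK ?num_real//.
  by have := sqr_ge0 (`|x| - 1); lra.
rewrite big_split/= -mulr_sumr big_const_seq count_predT iter_addr_0 size_hatv -mulr_natr.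
lra.
Qed.

Lemma mh2_le1 s : mh s ^+ 2 <= 1.
Proof. by rewrite -real_normK ?num_real// expr_le1 ?mh_le1. Qed.

Lemma Ham_eq s : Ham s = (size s)%:R / 2 * magn s ^+ 2 - A2 s / 2.
Proof.
rewrite /Ham /magn /A2.
have [s0|s0] := eqVneq (size s)%:R (0 : R); first by rewrite s0 invr0 !mul0r subrr.
pose x (i : 'I_(size s)) := s`_i.
have -> : \sum_(y <- s) y = \sum_i x i by rewrite (big_nth 0) big_mkord.
have -> : \sum_(y <- s) y ^+ 2 = \sum_i x i ^+ 2 by rewrite (big_nth 0) big_mkord.
set H := \sum_(i < _) _.
suff E : (\sum_i x i) ^+ 2 = 2 * H + \sum_i x i ^+ 2.
  by rewrite exprMn E; field; rewrite s0.
have Hsym : \sum_(i < size s) \sum_(j < size s | (j < i)%N) x i * x j = H.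
  rewrite /H (exchange_big_dep xpredT)//=; apply: eq_bigr => i _; apply: eq_bigr => j _.
  by rewrite mulrC.
rewrite expr2 big_distrl/= mulr2n mulrDl !mul1r -{2}Hsym /H -!big_split/=.
apply: eq_bigr => i _; rewrite big_distrr/= (bigID (fun j : 'I_(size s) => (i < j)%N))/=.
rewrite -addrA; congr (_ + _); rewrite (bigD1 i) ?ltnn//= addrC expr2; congr (_ + _).
by apply: eq_bigl => j; rewrite -leqNgt -val_eqE ltn_neqAle andbC.
Qed.

(* The Gibbs weight is [diag_weight * quad_weight]; the first factor stays between two constants. *)
Definition quad_weight (beta : R) (s : seq R) : R := expR (beta * (size s)%:R / 2 * mh s ^+ 2).
Definition diag_weight (beta : R) (s : seq R) : R := expR (- (beta / 2 * ah s)).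

Lemma expR_Ham beta s : expR (beta * Ham (hatv p s)) = diag_weight beta s * quad_weight beta s.
Proof.
by rewrite /diag_weight /quad_weight -expRD Ham_eq size_hatv -/(mh s) -/(ah s); congr expR; field.
Qed.

Lemma mseq_quad_weight beta : mseq (quad_weight beta).
Proof.
apply: (mseq_comp (g := expR)) => //; apply: mseqM.
  exact: (mseq_size (fun x => beta * x / 2)).
exact: (mseq_comp (g := fun y => y ^+ 2) _ mseq_mh).
Qed.

Lemma mseq_diag_weight beta : mseq (diag_weight beta).
Proof.
apply: (mseq_comp (g := fun y => expR (- (beta / 2 * y))) _ mseq_ah).
by apply: measurableT_comp => //; apply: measurableT_comp => //; exact: measurable_funM.
Qed.

Lemma homogeneous_quad_weight beta : homogeneous (quad_weight beta).
Proof. by move=> c s c0; rewrite /quad_weight mh_scale// size_map. Qed.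

Lemma diag_weight_le1 beta s : 0 <= beta -> diag_weight beta s <= 1.
Proof. by move=> b0; rewrite -expR0 ler_expR oppr_le0 mulr_ge0 ?ah_ge0 ?divr_ge0. Qed.

Lemma diag_weight_ge beta s : 0 <= beta -> expR (- (beta / 2)) <= diag_weight beta s.
Proof. by move=> b0; rewrite ler_expR lerN2 ler_piMr ?ah_le1// divr_ge0. Qed.

Lemma quad_weight_le beta s : 0 <= beta -> quad_weight beta s <= expR (beta * (size s)%:R / 2).
Proof. by move=> b0; rewrite ler_expR ler_piMr ?mh2_le1// !mulr_ge0. Qed.

Lemma iprod_hatv n beta (f : seq R -> R) M : 0 <= beta -> mseq (fun s => f (hatv p s)) ->
  (forall s, `|f s| <= M) ->
  iprod (rho p) n (fun s => (expR (beta * Ham (hatv p s)) * f (hatv p s))%:E) =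
  (\int[Pn n]_t (diag_weight beta t * quad_weight beta t * f (hatv p t))%:E)%E.
Proof.
move=> b0 mf fM.
rewrite (iprodE (rho_density hp) (M := expR (beta * n%:R / 2) * M)).
- by apply: eq_integral => t _; rewrite expR_Ham.
- apply/measurable_EFinP.
  have mW : mseq (fun s => diag_weight beta s * quad_weight beta s * f (hatv p s)).
    by apply: mseqM => //; apply: mseqM; [exact: mseq_diag_weight|exact: mseq_quad_weight].
  have := mW n.
  by under eq_fun do rewrite -expR_Ham.
- move=> s sn; rewrite lee_fin normrM ler_pM// expR_Ham ger0_norm ?mulr_ge0 ?expR_ge0//.
  by rewrite -[leRHS]mul1r ler_pM ?expR_ge0 ?diag_weight_le1// -sn quad_weight_le.
Qed.

Lemma ZpartE n beta : 0 <= beta ->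
  (Zpart p n beta)%:E = En n (fun s => diag_weight beta s * quad_weight beta s).
Proof.
move=> b0; have := @iprod_hatv n beta (fun=> 1) 1 b0 (mseq_cst 1).
under eq_fun do rewrite mulr1.
rewrite normr1 => /(_ (fun=> lexx _)) ZE.
rewrite /Zpart ZE; under eq_integral do rewrite mulr1.
rewrite -[X in fine X]/(En n (fun s => diag_weight beta s * quad_weight beta s)).
rewrite fineK// ge0_fin_numE; last by apply: En_ge0 => s; rewrite mulr_ge0 ?expR_ge0.
apply: (@le_lt_trans _ _ (En n (fun=> expR (beta * n%:R / 2)))).
  apply: En_le.
  - by apply: mseqM; [exact: mseq_diag_weight|exact: mseq_quad_weight].
  - exact: mseq_cst.
  - by move=> s; rewrite mulr_ge0 ?expR_ge0.
  - move=> s sn; rewrite -[leRHS]mul1r ler_pM ?expR_ge0 ?diag_weight_le1// -sn quad_weight_le//.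
by rewrite En_cst ?expR_ge0// ltry.
Qed.

(** The partition function with the diagonal terms put back; for beta >= 0, [Zpart] lies between
    exp(- beta / 2) times it and itself. *)
Definition Bn n beta : R := fine (En n (quad_weight beta)).

Lemma BnE n beta : 0 <= beta -> (Bn n beta)%:E = En n (quad_weight beta).
Proof.
move=> b0; rewrite fineK// ge0_fin_numE; last by apply: En_ge0 => s; exact: expR_ge0.
apply: (@le_lt_trans _ _ (En n (fun=> expR (beta * n%:R / 2)))).
  apply: En_le; [exact: mseq_quad_weight|exact: mseq_cst|by move=> s; exact: expR_ge0|].
  by move=> s sn; rewrite -sn quad_weight_le.
by rewrite En_cst ?expR_ge0// ltry.
Qed.

Lemma Bn_le n beta : 0 <= beta -> Bn n beta <= expR (beta * n%:R / 2).
Proof.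
move=> b0; rewrite -lee_fin BnE// -(En_cst hp n (expR_ge0 _)).
apply: En_le; [exact: mseq_quad_weight|exact: mseq_cst|by move=> s; exact: expR_ge0|].
by move=> s sn; rewrite -sn quad_weight_le.
Qed.

Lemma Bn_ge1 n beta : 0 <= beta -> 1 <= Bn n beta.
Proof.
move=> b0; rewrite -lee_fin BnE// -(En_cst hp n ler01).
apply: En_le; [exact: mseq_cst|exact: mseq_quad_weight|by []|].
by move=> s sn; rewrite -expR0 ler_expR mulr_ge0 ?sqr_ge0 ?divr_ge0 ?mulr_ge0.
Qed.

Lemma Zpart_leB n beta : 0 <= beta -> Zpart p n beta <= Bn n beta.
Proof.
move=> b0; rewrite -lee_fin BnE// ZpartE//; apply: En_le.
- by apply: mseqM; [exact: mseq_diag_weight|exact: mseq_quad_weight].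
- exact: mseq_quad_weight.
- by move=> s; rewrite mulr_ge0 ?expR_ge0.
- by move=> s _; rewrite ler_piMl ?expR_ge0 ?diag_weight_le1.
Qed.

Lemma Zpart_geB n beta : 0 <= beta -> expR (- (beta / 2)) * Bn n beta <= Zpart p n beta.
Proof.
move=> b0; rewrite -lee_fin EFinM BnE// ZpartE// -EnZ ?expR_ge0//; last 2 first.
- exact: mseq_quad_weight.
- by move=> s; exact: expR_ge0.
apply: En_le.
- by apply: mseqM; [exact: mseq_cst|exact: mseq_quad_weight].
- by apply: mseqM; [exact: mseq_diag_weight|exact: mseq_quad_weight].
- by move=> s; rewrite mulr_ge0 ?expR_ge0.
- by move=> s _; rewrite ler_wpM2r ?expR_ge0 ?diag_weight_ge.
Qed.

Lemma En_expR_sum n t : En n (fun s => expR (t * \sum_(x <- s) x)) = (expR (n%:R * psi p t))%:E.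
Proof.
transitivity (En n (fun s => \prod_(x <- s) expR (t * x))).
  by apply: eq_En => s _; rewrite mulr_sumr expR_sum.
rewrite En_prod; last by move=> x; exact: expR_ge0.
  by rewrite expR_psi expRM_natl EFin_expe.
by apply: measurableT_comp => //; exact: measurable_funM.
Qed.

(** The identity survives a vanishing norm, because all the entries are then zero. *)
Lemma sum_mh s : \sum_(x <- s) x = (size s)%:R * (mh s * normp p s).
Proof.
have [s0|s0] := eqVneq (size s)%:R (0 : R).
  by move: s0 => /eqP; rewrite pnatr_eq0 size_eq0 => /eqP ->; rewrite big_nil mul0r.
have [N0|N0] := eqVneq (normp p s) 0; last first.
  by rewrite mhE divfK// /magn mulrA mulfV// mul1r.
rewrite N0 mulr0 mulr0; have := normp_powR s; rewrite N0 powR0 ?gt_eqF// => /esym/eqP.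
rewrite mulf_eq0 invr_eq0 (negbTE s0)/= /sabs psumr_eq0; last by move=> x _; exact: absp_ge0.
move=> /allP S0; rewrite big_seq big1// => x xs; have := S0 x xs; rewrite /= /absp powR_eq0.
by rewrite normr_eq0 => /andP[/eqP].
Qed.

Lemma size_normp s : (size s)%:R * powR (normp p s) p = sabs s.
Proof.
have [s0|s0] := eqVneq (size s)%:R (0 : R); last by rewrite normp_powR mulrA mulfV// mul1r.
move: (s0) => /eqP; rewrite pnatr_eq0 size_eq0 => /eqP ->.
by rewrite mul0r /sabs big_nil.
Qed.

(* The exponent [t m N] (N the p-norm) is split by AM-GM and Young into a multiple of [m ^+ 2],
   a multiple of [N `^ p] that tilts the density, and a constant. *)
Lemma F2_lower n beta u v : 0 <= beta -> 0 <= u -> u < 1 -> 0 <= v ->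
  expR (n%:R * F2 p beta u v) <= Bn n beta.
Proof.
move=> b0 u0 u1 v0.
pose t := Num.sqrt (beta * u ^+ 2 * powR v (p - 2)).
pose k := (p - 2) / (2 * p) * powR v p.
have up1 : powR u p < 1.
  suff : powR u p < powR 1 p by rewrite powR1.
  by apply: gt0_ltr_powR; rewrite ?nnegrE.
(* With this r, 1 - 1/r = u^p is the weight of [sabs] in the Young bound, and the price r^(n/p) of
   the tilt becomes the logarithm in [F2]. *)
pose r := (1 - powR u p)^-1.
have r0 : 0 < r by rewrite invr_gt0 subr_gt0.
have ru : 1 - r^-1 = powR u p by rewrite invrK subKr.
have mE : mseq (fun s => expR ((1 - r^-1) * sabs s / p)).
  apply: (mseq_comp (g := fun y => expR ((1 - r^-1) * y / p))); last exact: mseq_sabs.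
  by apply: measurableT_comp => //; apply: measurable_funM => //; exact: measurable_funM.
have mG : mseq (fun s => quad_weight beta s * 1 * expR ((1 - r^-1) * sabs s / p)).
  by apply: mseqM => //; apply: mseqM; [exact: mseq_quad_weight|exact: mseq_cst].
have G0 s : 0 <= quad_weight beta s * 1 * expR ((1 - r^-1) * sabs s / p).
  by rewrite !mulr_ge0 ?expR_ge0.
have key : (expR (n%:R * psi p t) <= expR (n%:R * k) * (powR r (n%:R / p) * Bn n beta)).
  rewrite -lee_fin -En_expR_sum 2!EFinM BnE//.
  have := En_tilt hp n r0 (mseq_quad_weight beta) (fun s => expR_ge0 _) (homogeneous_quad_weight beta)
    (measurable_cst (1 : R)) (fun=> ler01).
  rewrite (@eq_En _ _ _ _ (fun s => quad_weight beta s * 1) (quad_weight beta)); last by move=> s _; rewrite mulr1.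
  move=> <-; rewrite -EnZ ?expR_ge0//.
  apply: En_le; last 1 first.
  - move=> s sn; rewrite mulr1 /quad_weight -!expRD ler_expR ru sum_mh sn.
    rewrite -(size_normp s) sn.
    set m := mh s; set N := normp p s.
    have N0 : 0 <= N by exact: normp_ge0.
    have -> : n%:R * k + (beta * n%:R / 2 * m ^+ 2 + powR u p * (n%:R * powR N p) / p) =
      n%:R * (k + (beta / 2 * m ^+ 2 + powR (u * N) p / p)).
      by rewrite powRM//; field; rewrite gt_eqF.
    rewrite mulrCA ler_wpM2l//.
    have y := young (mulr_ge0 u0 N0) v0.
    have t2 : t ^+ 2 = beta * u ^+ 2 * powR v (p - 2).
      by rewrite /t sqr_sqrtr// !mulr_ge0 ?powR_ge0 ?sqr_ge0.
    (* The square behind this bound is (sqrt beta m - u v^((p - 2) / 2) N)^2. *)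
    have amgm : t * (m * N) <= beta / 2 * m ^+ 2 + (u * N) ^+ 2 * powR v (p - 2) / 2.
      pose w := Num.sqrt (powR v (p - 2)); pose sb := Num.sqrt beta.
      have w2 : w ^+ 2 = powR v (p - 2) by rewrite sqr_sqrtr ?powR_ge0.
      have sb2 : sb ^+ 2 = beta by rewrite sqr_sqrtr.
      have -> : t = sb * (u * w).
        rewrite /t -mulrA sqrtrM//; congr (_ * _); rewrite sqrtrM ?sqr_ge0//.
        by rewrite sqrtr_sqr ger0_norm.
      rewrite -w2 -sb2; have := sqr_ge0 (sb * m - u * w * N); lra.
    have -> : k = (1 - 2 / p) / 2 * powR v p by rewrite /k; field; rewrite gt_eqF.
    have -> : powR (u * N) p / p = 2 / p / 2 * powR (u * N) p by field; rewrite gt_eqF.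
    lra.
  - apply: (mseq_comp (g := fun y => expR (t * y))); last exact: mseq_sum.
    by apply: measurableT_comp => //; exact: measurable_funM.
  - by apply: mseqM => //; exact: mseq_cst.
  - by move=> s; exact: expR_ge0.
have -> : expR (n%:R * F2 p beta u v) =
    expR (n%:R * psi p t) * (expR (n%:R * k) * powR r (n%:R / p))^-1.
  have -> : powR r (n%:R / p) = expR (n%:R / p * ln r) by rewrite /powR gt_eqF.
  rewrite /F2 -/t -/k -expRD -expRN -expRD /r lnV ?posrE ?subr_gt0//.
  by congr expR; field; rewrite gt_eqF.
by rewrite ler_pdivrMr ?mulr_gt0 ?expR_gt0 ?powR_gt0//; apply: le_trans key _; rewrite mulrA mulrC.
Qed.

End model.

(** * Concentration of the norm and the upper bound *)

Section concentration.
Context (R : realType) (p : R).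
Hypothesis hp : 2 <= p.
Local Notation En := (En hp).
Local Notation sabs := (sabs p).
Local Notation mh := (mh p).

Let p0 : 0 < p. Proof. by apply: lt_le_trans hp. Qed.

Definition near1 (e x : R) : R := \1_(`[- e, e]%classic : set R) (x - 1).
Definition near_sphere (e : R) (s : seq R) : R := near1 e ((size s)%:R^-1 * sabs s).
(* Chernoff's base for the tails of [n^-1 * sabs], whose cumulant is that of a Gamma law. *)
Definition chernoff (r : R) : R := powR (r * expR (1 - r)) p^-1.
Definition conc_err (e : R) (n : nat) : R := chernoff (1 + e) ^+ n + chernoff (1 - e) ^+ n.

Lemma near1_ge0 e x : 0 <= near1 e x.
Proof. by rewrite /near1 indicE. Qed.

Lemma near1_le1 e x : near1 e x <= 1.
Proof. by rewrite /near1 indicE; case: (_ \in _). Qed.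

Lemma measurable_near1 e : measurable_fun setT (near1 e).
Proof.
apply: (measurableT_comp (f := (\1_(`[- e, e]%classic : set R) : R -> R))).
  by apply: measurable_indic; exact: measurable_itv.
exact: measurable_funB.
Qed.

Lemma near1P e x : reflect (1 - e <= x <= 1 + e) (near1 e x == 1).
Proof.
rewrite /near1 indicE; apply: (iffP idP) => [|/andP[x1 x2]].
  case: (boolP (_ \in _)) => [|_]; last by rewrite eq_sym oner_eq0.
  by rewrite inE/= in_itv/= lerBlDr lerBrDr => /andP[x1 x2] _; apply/andP; split; lra.
by rewrite mem_set//= in_itv/=; apply/andP; split; lra.
Qed.

Lemma near1_eq0 e x : near1 e x != 1 -> near1 e x = 0.
Proof. by rewrite /near1 indicE; case: (_ \in _) => //; rewrite eqxx. Qed.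

Lemma mseq_near_sphere e : mseq (near_sphere e).
Proof.
apply: (mseq_comp (measurable_near1 e) (F := fun s => (size s)%:R^-1 * sabs s)).
by apply: mseqM; [exact: (mseq_size (fun x => x^-1))|exact: mseq_sabs].
Qed.

Lemma near_sphere_ge0 e s : 0 <= near_sphere e s. Proof. exact: near1_ge0. Qed.
Lemma near_sphere_le1 e s : near_sphere e s <= 1. Proof. exact: near1_le1. Qed.

Lemma chernoff_bounds r : 0 < r -> r != 1 -> 0 <= chernoff r < 1.
Proof.
move=> r0 r1; rewrite powR_ge0/=.
have x0 : 0 < r * expR (1 - r) by rewrite mulr_gt0 ?expR_gt0.
suff x1 : r * expR (1 - r) < 1.
  suff : chernoff r < powR 1 p^-1 by rewrite powR1.
  by apply: gt0_ltr_powR; rewrite ?nnegrE ?invr_gt0 ?ltW.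
rewrite -ltr_pdivlMr ?expR_gt0// div1r -expRN opprB.
have := @expR_gt1Dx R (r - 1); rewrite subr_eq0 => /(_ r1).
by rewrite addrCA subrr addr0.
Qed.

Lemma conc_err_cvg e : 0 < e < 1 -> conc_err e @ \oo --> (0 : R).
Proof.
move=> /andP[e0 e1]; rewrite -[X in _ --> X]addr0.
have B r : 0 < r -> r != 1 -> (fun n => chernoff r ^+ n) @ \oo --> (0 : R).
  by move=> r0 r1; apply: cvg_expr; have /andP[q0 q1] := chernoff_bounds r0 r1; rewrite ger0_norm.
by apply: cvgD; apply: B; try lra; apply/eqP; lra.
Qed.

(** The factor 1 - 1/r has the sign of r - 1, so one formula is at least 1 both on S >= r n when r >
    1 and on S <= r n when 0 < r < 1. *)
Definition tl (r : R) (s : seq R) : R := expR ((1 - r^-1) * (sabs s - r * (size s)%:R) / p).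

Lemma mseq_tl r : mseq (tl r).
Proof.
apply: (mseq_comp (g := fun y => expR ((1 - r^-1) * y / p)) (F := fun s => sabs s - r * (size s)%:R)).
  by apply: measurableT_comp => //; apply: measurable_funM => //; exact: measurable_funM.
by apply: mseqD; [exact: mseq_sabs|exact: (mseq_size (fun x => - (r * x)))].
Qed.

(** Every homogeneous F factors out exactly: this is the independence of the direction and of
    [sabs]. *)
Lemma En_tl n r F : 0 < r -> mseq F -> (forall s, 0 <= F s) -> homogeneous F ->
  (En n (fun s => F s * tl r s)%R = (chernoff r ^+ n)%:E * En n F)%E.
Proof.
move=> r0 mF F0 hF.
have mE : mseq (fun s => expR ((1 - r^-1) * sabs s / p)).
  apply: (mseq_comp (g := fun y => expR ((1 - r^-1) * y / p))); last exact: mseq_sabs.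
  by apply: measurableT_comp => //; apply: measurable_funM => //; exact: measurable_funM.
transitivity (En n (fun s => expR ((1 - r) * n%:R / p) * (F s * 1 * expR ((1 - r^-1) * sabs s / p)))).
  apply: eq_En => s sn; rewrite mulr1 mulrCA -expRD /tl sn; congr (_ * expR _).
  by field; rewrite !gt_eqF.
rewrite EnZ ?expR_ge0//; last 2 first.
- by apply: mseqM => //; apply: mseqM => //; exact: mseq_cst.
- by move=> s; rewrite !mulr_ge0 ?expR_ge0.
rewrite (En_tilt hp n r0 mF F0 hF (measurable_cst (1 : R)) (fun=> ler01)).
rewrite muleA -EFinM; congr (_ * _)%E; last by apply: eq_En => s _; rewrite mulr1.
congr (_%:E); rewrite /chernoff -powR_mulrn ?powR_ge0// -powRrM powRM ?expR_ge0 ?ltW//.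
rewrite mulrC (mulrC p^-1); congr (_ * _).
by rewrite -expRM; congr expR; ring.
Qed.

(** Chernoff's bound on both sides of 1, under the weight F instead of the probability itself. *)
Lemma En_conc n e F : 0 < e < 1 -> mseq F -> (forall s, 0 <= F s) -> homogeneous F ->
  (En n F <= En n (fun s => F s * near_sphere e s)%R + (conc_err e n)%:E * En n F)%E.
Proof.
move=> /andP[e0 e1] mF F0 hF.
have r1 : 0 < 1 + e by lra. have r2 : 0 < 1 - e by lra.
have mT r : mseq (fun s => F s * tl r s) by apply: mseqM => //; exact: mseq_tl.
have mG : mseq (fun s => F s * near_sphere e s) by apply: mseqM => //; exact: mseq_near_sphere.
have T0 r s : 0 <= F s * tl r s by rewrite mulr_ge0 ?expR_ge0.
have G0 s : 0 <= F s * near_sphere e s by rewrite mulr_ge0 ?near_sphere_ge0.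
pose H s := 1 * (F s * tl (1 + e) s) + 1 * (F s * tl (1 - e) s).
have mH : mseq H by apply: mseqD; apply: mseqM => //; exact: mseq_cst.
have H0 s : 0 <= H s by rewrite addr_ge0 ?mulr_ge0 ?expR_ge0.
have -> : ((conc_err e n)%:E * En n F = En n H)%E.
  rewrite /H En_comb// !mul1e !En_tl// /conc_err EFinD ge0_muleDl ?lee_fin ?exprn_ge0 ?powR_ge0//.
rewrite -[leRHS]addr0 -[in X in (X + _)%E](mul1e (En n _)) -[X in (_ + X + _)%E](mul1e (En n H)).
rewrite adde0 -(En_comb hp n mG mH)//; apply: En_le => //.
  by apply: mseqD; apply: mseqM => //; exact: mseq_cst.
move=> s sn; rewrite /H !mul1r -!mulrDr ler_peMr//.
have [g1|g0] := eqVneq (near_sphere e s) 1; first by rewrite g1 lerDl addr_ge0 ?expR_ge0.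
have -> : near_sphere e s = 0 by exact: near1_eq0 g0.
rewrite add0r.
(* The empty sequence misses the window, as its mean is 0 by convention, but [tl] equals exp 0 = 1
   there. *)
have [n0|n0] := posnP (size s).
  have -> : s = [::] by apply/eqP; rewrite -size_eq0 n0.
  by rewrite /tl /sabs !big_nil !mulr0 subr0 mulr0 mul0r expR0 lerDl.
have n0' : 0 < (size s)%:R :> R by rewrite ltr0n.
have [a1|a1] := leP ((1 + e) * (size s)%:R) (sabs s).
  rewrite ler_wpDr ?expR_ge0// -[leLHS]expR0 ler_expR divr_ge0 ?(ltW p0)// mulr_ge0 ?subr_ge0//.
  by rewrite invf_le1//; lra.
have a2 : sabs s < (1 - e) * (size s)%:R.
  rewrite ltNge; apply: contra g0 => a2; apply/near1P.
  by rewrite ler_pdivlMl// ler_pdivrMl// ![_%:R * _]mulrC a2 ltW.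
rewrite ler_wpDl ?expR_ge0// -[leLHS]expR0 ler_expR divr_ge0 ?(ltW p0)// mulr_le0 ?subr_le0 ?(ltW a2)//.
by rewrite invf_ge1//; lra.
Qed.

Lemma le_ch (x y : R) : `|x| <= `|y| -> ch x <= ch y.
Proof.
have chE (z : R) : ch z = ch `|z|.
  by have [z0|z0] := leP 0 z; [rewrite ger0_norm|rewrite ltr0_norm// chN].
rewrite chE (chE y); move: `|x| `|y| (normr_ge0 x) => {}x {}y x0 xy.
rewrite /ch ler_wpM2r ?invr_ge0// -subr_ge0.
have -> : expR y + expR (- y) - (expR x + expR (- x)) =
    (expR y - expR x) * (1 - expR (- (x + y))).
  have -> : expR (- (x + y)) = (expR x)^-1 * (expR y)^-1 by rewrite opprD expRD !expRN.
  rewrite !expRN.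
  by field; rewrite !gt_eqF ?expR_gt0.
rewrite mulr_ge0// subr_ge0 ?ler_expR// -expR0 ler_expR; lra.
Qed.

Lemma psiN t : psi p (- t) = psi p t.
Proof.
apply: expR_inj; apply: EFin_inj.
apply: (etrans (esym (integral_ch hp (- t)))); apply: etrans (integral_ch hp t).
by apply: eq_integral => x _; rewrite mulNr chN.
Qed.

Lemma En_ch_sum n t : En n (fun s => ch (t * \sum_(x <- s) x)) = (expR (n%:R * psi p t))%:E.
Proof.
have mE t' : mseq (fun s => expR (t' * \sum_(x <- s) x)).
  apply: (mseq_comp (g := fun y => expR (t' * y))); last exact: mseq_sum.
  by apply: measurableT_comp => //; exact: measurable_funM.
transitivity (En n (fun s => 2^-1 * expR (t * \sum_(x <- s) x) + 2^-1 * expR (- t * \sum_(x <- s) x))).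
  by apply: eq_En => s _; rewrite /ch mulNr; field.
rewrite En_comb//; try by move=> s; exact: expR_ge0.
rewrite !En_expR_sum psiN -!EFinM -EFinD; congr (_%:E); by field.
Qed.

Lemma mseq_ch a : mseq (fun s => ch (a * (size s)%:R * mh s)).
Proof.
apply: (mseq_comp (@measurable_ch R) (F := fun s => a * (size s)%:R * mh s)).
by apply: mseqM; [exact: (mseq_size (fun x => a * x))|exact: mseq_mh].
Qed.

Lemma homogeneous_ch a : homogeneous (fun s => ch (a * (size s)%:R * mh s)).
Proof. by move=> c s c0; rewrite mh_scale// size_map. Qed.

(** Boundedness makes the expectation finite, so that the error term of [En_conc] can be moved to
    the left. *)
Lemma En_conc_le n e F M : 0 < e < 1 -> mseq F -> (forall s, 0 <= F s) -> homogeneous F ->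
  (forall s, size s = n -> F s <= M) ->
  ((1 - conc_err e n)%:E * En n F <= En n (fun s => F s * near_sphere e s)%R)%E.
Proof.
move=> e01 mF F0 hF FM; have M0 : 0 <= M by apply: le_trans (FM (nseq n 0) (size_nseq _ _)).
have := En_conc n e01 mF F0 hF; have := @En_ge0 _ _ hp n F F0.
have : (En n F <= M%:E)%E.
  by rewrite -(En_cst hp n M0); exact: (En_le hp mF (@mseq_cst R M) F0 FM).
have : (0 <= En n (fun s => F s * near_sphere e s)%R)%E.
  by apply: En_ge0 => s; rewrite mulr_ge0 ?near_sphere_ge0.
case: (En n F) => [x| |]//=; case: (En n _) => [y| |]//=; last by rewrite !leey.
move=> _ _ _.
by rewrite -!EFinM -EFinD !lee_fin; lra.
Qed.

(** In [F2_lower] Young's inequality is sharp where u N = v. The tilt moves N^p to r = 1 + lam, and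
    this choice gives u^p r = lam = v^p. *)
Lemma F2_param beta lam : 0 <= beta -> 0 <= lam ->
  F2 p beta (powR (lam / (1 + lam)) p^-1) (powR lam p^-1) =
  psi p (Num.sqrt (beta * lam) * powR (1 + lam) (- p^-1)) - p^-1 * ln (1 + lam)
    - (p - 2) / (2 * p) * lam.
Proof.
move=> b0 l0; set u := powR (lam / _) _; set v := powR lam _; set r := 1 + lam.
have r0 : 0 < r by rewrite /r; lra.
set w := powR r _; have w0 : 0 < w by exact: powR_gt0.
have up : powR u p = lam / r.
  by rewrite /u -powRrM mulVf ?gt_eqF// powRr1// divr_ge0// ltW.
have vp : powR v p = lam by rewrite /v -powRrM mulVf ?gt_eqF// powRr1.
have tE : Num.sqrt (beta * u ^+ 2 * powR v (p - 2)) = Num.sqrt (beta * lam) * w.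
  rewrite -[w in RHS]gtr0_norm// -sqrtr_sqr -sqrtrM ?mulr_ge0//; congr Num.sqrt.
  rewrite -[LHS]mulrA -[RHS]mulrA; congr (_ * _); rewrite /u /v.
  have [->|l0'] := eqVneq lam 0.
    by rewrite !mul0r powR0 ?gt_eqF ?invr_gt0// expr0n mul0r.
  rewrite powRM ?invr_ge0 ?(ltW r0)// exprMn.
  have -> : powR r^-1 p^-1 = w by rewrite -[r^-1]powR_inv1 ?(ltW r0)// -powRrM mulN1r.
  rewrite mulrAC; congr (_ * _).
  rewrite -powR_mulrn ?powR_ge0// -!powRrM -powRD ?l0' ?implybT//.
  have -> : p^-1 * 2 + p^-1 * (p - 2) = 1 by field; rewrite gt_eqF.
  exact: powRr1.
rewrite /F2 tE up vp.
have -> : 1 - lam / r = r^-1 by rewrite /r; field; rewrite gt_eqF.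
by rewrite lnV ?posrE// mulrN.
Qed.

(* Here [lam] is a squared tilt parameter: [r = 1 + lam] makes Young's inequality in [F2_lower] an equality. *)
Lemma F2_upper n beta lam e : 0 <= beta -> 0 <= lam -> 0 < e < 1 -> (0 < n)%N ->
  ((1 - conc_err e n)%:E * En n (fun s => ch (Num.sqrt (beta * lam) * (1 - e) * (size s)%:R * mh s)) <=
   (expR (n%:R * (F2 p beta (powR (lam / (1 + lam)) p^-1) (powR lam p^-1) + lam / 2 + e * lam / p)))%:E)%E.
Proof.
move=> b0 l0 e01 n0; set u := powR (lam / _) _; set v := powR lam _; have /andP[e0 e1] := e01.
pose r := 1 + lam; have r0 : 0 < r by rewrite /r; lra.
have n0' : 0 < n%:R :> R by rewrite ltr0n.
have pi0 : 0 < p^-1 by rewrite invr_gt0.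
pose w := powR r (- p^-1); have w0 : 0 < w by exact: powR_gt0.
pose t := Num.sqrt (beta * lam) * w.
pose a := Num.sqrt (beta * lam) * (1 - e).
have sq0 : 0 <= Num.sqrt (beta * lam) by exact: sqrtr_ge0.
have a0 : 0 <= a by rewrite mulr_ge0//; lra.
pose F s := ch (a * (size s)%:R * mh s).
have mF : mseq F by exact: mseq_ch.
have F0 s : 0 <= F s by exact: ch_ge0.
have hF : homogeneous F by exact: homogeneous_ch.
have FM s : size s = n -> F s <= ch (a * n%:R).
  move=> sn; apply: le_ch; rewrite sn normrM ler_piMr ?mh_le1//.
apply: (le_trans (En_conc_le e01 mF F0 hF FM)).
(* [h] is evaluated at r S under the original law and at S under the tilted one: the tilt moves the
   window for S / n from 1 to r. *)
pose h (y : R) := near1 e (n%:R^-1 * (r^-1 * y)).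
have mh' : measurable_fun setT h.
  by apply: (measurableT_comp (measurable_near1 e)); apply: measurable_funM => //; exact: measurable_funM.
have E1 : En n (fun s => F s * near_sphere e s) = En n (fun s => F s * h (r * sabs s)).
  by apply: eq_En => s sn; rewrite /near_sphere /h sn mulKf ?gt_eqF.
have T := En_tilt hp n r0 mF F0 hF mh' (fun y => near1_ge0 _ _).
have Rn0 : 0 < powR r (n%:R / p) by exact: powR_gt0.
have [X XE] : exists X, X = expR (n%:R * psi p t) by exists (expR (n%:R * psi p t)).
have XE' : (X%:E = En n (fun s => ch (t * \sum_(x <- s) x)))%E by rewrite XE; exact/esym/En_ch_sum.
have -> : (expR (n%:R * (F2 p beta u v + lam / 2 + e * lam / p)))%:E =
    ((powR r (n%:R / p))^-1%:E * (expR (n%:R * lam * (1 + e) / p) * X)%:E)%E.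
  rewrite -EFinM XE; congr (_%:E).
  have -> : (powR r (n%:R / p))^-1 = expR (- (n%:R / p * ln r)) by rewrite /powR gt_eqF// expRN.
  rewrite (F2_param b0 l0) -/r -/w -/t.
  rewrite -!expRD; congr expR; field; rewrite gt_eqF//.
have -> : (En n (fun s => F s * near_sphere e s)%R = ((powR r (n%:R / p))^-1)%:E *
    En n (fun s => F s * h (sabs s) * expR ((1 - r^-1) * sabs s / p))%R)%E.
  by rewrite T E1 muleA -EFinM mulVf ?mul1e// gt_eqF.
rewrite lee_wpmul2l ?lee_fin ?invr_ge0 ?(ltW Rn0)//.
rewrite EFinM XE' -EnZ ?expR_ge0//; last 2 first.
- apply: (mseq_comp (g := fun y => ch (t * y))); last exact: mseq_sum.
  by apply: (measurableT_comp (@measurable_ch R)); exact: measurable_funM.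
- by move=> s; exact: ch_ge0.
apply: En_le.
- apply: mseqM; first by apply: mseqM => //; exact: (mseq_comp mh' (@mseq_sabs R p)).
  apply: (mseq_comp (g := fun y => expR ((1 - r^-1) * y / p))); last exact: mseq_sabs.
  by apply: measurableT_comp => //; apply: measurable_funM => //; exact: measurable_funM.
- apply: mseqM; first exact: mseq_cst.
  apply: (mseq_comp (g := fun y => ch (t * y))); last exact: mseq_sum.
  by apply: (measurableT_comp (@measurable_ch R)); exact: measurable_funM.
- by move=> s; rewrite !mulr_ge0 ?expR_ge0 ?near1_ge0.
move=> s sn.
have [g1|g0] := eqVneq (h (sabs s)) 1; last first.
  by rewrite /h (near1_eq0 g0) mulr0 mul0r mulr_ge0 ?expR_ge0 ?ch_ge0.
have /near1P/andP[g1l g1r] : near1 e (n%:R^-1 * (r^-1 * sabs s)) == 1 by apply/eqP.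
rewrite g1 mulr1 mulrC ler_pM ?expR_ge0 ?ch_ge0//.
  have : sabs s <= n%:R * r * (1 + e).
    by move: g1r; rewrite ler_pdivrMl// ler_pdivrMl// mulrA (mulrC r).
  move=> H; rewrite ler_expR ler_pM2r// -subr_ge0.
  have -> : n%:R * lam * (1 + e) - (1 - r^-1) * sabs s =
      lam / r * (n%:R * r * (1 + e) - sabs s) by rewrite /r; field; rewrite gt_eqF.
  by rewrite mulr_ge0 ?subr_ge0// divr_ge0// ltW.
apply: le_ch; rewrite (sum_mh hp) sn.
set m := mh s; set N := normp p s.
have N0 : 0 <= N by exact: normp_ge0.
(* In the window N^p >= r (1 - e), and (1 - e)^p <= 1 - e since p >= 1; hence N >= (1 - e) r^(1/p),
   which is why [a] carries the factor 1 - e. *)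
have aN : a <= t * N.
  rewrite /a /t -mulrA ler_wpM2l//.
  have -> : w = (powR r p^-1)^-1 by rewrite /w powRN.
  rewrite ler_pdivlMl ?powR_gt0// -(ler_powRl p0) ?mulr_ge0 ?powR_ge0//; last lra.
  rewrite powRM ?powR_ge0//; last lra.
  rewrite -powRrM mulVf ?gt_eqF// powRr1 ?(ltW r0)// /N normp_powR// sn.
  apply: (@le_trans _ _ (r * (1 - e))).
    have e01' : 0 < 1 - e <= 1 by apply/andP; split; lra.
    have p1 : 1 <= p by apply: le_trans hp; lra.
    by rewrite ler_wpM2l ?(ltW r0)// ge1r_powR.
  by rewrite -ler_pdivlMl// mulrCA.
have -> : a * n%:R * m = a * (n%:R * m) by ring.
have -> : t * (n%:R * (m * N)) = (t * N) * (n%:R * m) by ring.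
by rewrite normrM [leRHS]normrM ler_wpM2r// !ger0_norm// !mulr_ge0// ltW.
Qed.

End concentration.

(** * The free energy *)

Section rates.
Context (R : realType).
Implicit Types (a : nat -> R) (l : R).

Lemma near_nat_ge (x : R) : \forall n \near \oo, x <= n%:R.
Proof. exact: nbhs_infty_ger. Qed.

Lemma ln_rate_cvg a l :
  (forall e, 0 < e -> exists2 C, 0 < C & \forall n \near \oo, a n <= C * expR (n%:R * (l + e))) ->
  (forall e, 0 < e -> exists2 c, 0 < c & forall n, c * expR (n%:R * (l - e)) <= a n) ->
  (fun n : nat => n%:R^-1 * ln (a n)) @ \oo --> l.
Proof.
move=> U L; apply/cvgrPdist_le => e e0.
have e2 : 0 < e / 2 by rewrite divr_gt0.
have [C C0 HU] := U _ e2; have [c c0 HL] := L _ e2.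
near=> n.
have n0 : 0 < n%:R :> R by rewrite ltr0n; near: n; exact: nbhs_infty_gt.
have an0 : 0 < a n by apply: lt_le_trans (HL n); rewrite mulr_gt0 ?expR_gt0.
have h1 : n%:R^-1 * ln (a n) <= l + e.
  rewrite ler_pdivrMl//; apply: (@le_trans _ _ (ln (C * expR (n%:R * (l + e / 2))))).
    by rewrite ler_ln ?posrE ?mulr_gt0 ?expR_gt0//; near: n.
  rewrite lnM ?posrE ?expR_gt0// expRK.
  have : ln C <= n%:R * (e / 2).
    by rewrite -ler_pdivrMr//; near: n; exact: near_nat_ge.
  lra.
have h2 : l - e <= n%:R^-1 * ln (a n).
  rewrite ler_pdivlMl//; apply: (@le_trans _ _ (ln (c * expR (n%:R * (l - e / 2))))); last first.
    by rewrite ler_ln ?posrE ?mulr_gt0 ?expR_gt0.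
  rewrite lnM ?posrE ?expR_gt0// expRK.
  have : - ln c <= n%:R * (e / 2).
    by rewrite -ler_pdivrMr//; near: n; exact: near_nat_ge.
  lra.
by rewrite ler_norml; apply/andP; split; lra.
Unshelve. all: by end_near. Qed.

Lemma expR_decay_cvg (C d : R) : 0 < d -> (fun n : nat => C * expR (- (n%:R * d))) @ \oo --> (0 : R).
Proof.
move=> d0; rewrite -(mulr0 C); apply: cvgM; first exact: cvg_cst.
have -> : (fun n : nat => expR (- (n%:R * d))) = (fun n => expR (- d) ^+ n).
  by apply/funext => n; rewrite -mulrN expRM_natl.
by apply: cvg_expr; rewrite ger0_norm ?expR_ge0// expR_lt1 oppr_lt0.
Qed.

Lemma ln1D_ge (x : R) : 0 <= x -> x / (1 + x) <= ln (1 + x).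
Proof.
move=> x0; have x1 : 0 < 1 + x by lra.
have := @le_ln1Dx R (- (x / (1 + x))).
have -> : 1 + - (x / (1 + x)) = (1 + x)^-1 by field; rewrite gt_eqF.
rewrite lnV ?posrE// lerN2; apply.
by rewrite ltrN2 ltr_pdivrMr// mul1r; lra.
Qed.

Lemma expR_le_ch (y : R) : expR y <= 2 * ch y.
Proof. by rewrite /ch mulrCA divff ?pnatr_eq0// mulr1 lerDl expR_ge0. Qed.

Lemma chE_norm (y : R) : ch y = ch `|y|.
Proof. by apply: le_anti; rewrite !le_ch// normr_id. Qed.

End rates.

Section free_energy.
Context (R : realType) (p : R).
Hypothesis hp : 2 <= p.
Local Notation En := (En hp).
Local Notation Bn := (Bn hp).
Local Notation mh := (mh p).
Local Notation M := (mom p 1).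

Let p0 : 0 < p. Proof. by apply: lt_le_trans hp. Qed.

Definition F2_set (beta : R) : set R :=
  [set y | exists u v : R, [/\ 0 <= u, u < 1, 0 <= v & y = F2 p beta u v]].

(** The lower bound for n = 1 against the trivial bound on [Bn]: it makes the supremum finite with
    no analysis of [F2]. *)
Lemma F2_le beta u v : 0 <= beta -> 0 <= u -> u < 1 -> 0 <= v -> F2 p beta u v <= beta / 2.
Proof.
move=> b0 u0 u1 v0; rewrite -ler_expR -[F2 _ _ _ _]mul1r.
apply: (le_trans (F2_lower hp 1 b0 u0 u1 v0)); apply: (le_trans (Bn_le hp 1 b0)).
by rewrite mulr1.
Qed.

Lemma F2_set_sup beta : 0 <= beta -> has_sup (F2_set beta).
Proof.
move=> b0; split; first by exists (F2 p beta 0 0), 0, 0; split.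
by exists (beta / 2) => y [u [v [u0 u1 v0 ->]]]; exact: F2_le.
Qed.

Definition free_energy (beta : R) : R := sup (F2_set beta).

Lemma F2_free_energy beta u v : 0 <= beta -> 0 <= u -> u < 1 -> 0 <= v ->
  F2 p beta u v <= free_energy beta.
Proof.
move=> b0 u0 u1 v0; apply: (sup_upper_bound (F2_set_sup b0)).
by exists u, v.
Qed.

Lemma ereal_sup_F2 beta : 0 <= beta ->
  ereal_sup [set y : \bar R | exists u v : R,
                      [/\ 0 <= u, u < 1, 0 <= v & y = (F2 p beta u v)%:E]]
  = (free_energy beta)%:E.
Proof.
move=> b0; have [ne ub] := F2_set_sup b0; rewrite -ereal_sup_EFin//.
congr ereal_sup; apply/seteqP; split=> y /=.
  by move=> [u [v [u0 u1 v0 ->]]]; exists (F2 p beta u v) => //; exists u, v.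
by move=> [_ [u [v [u0 u1 v0 ->]]] <-]; exists u, v.
Qed.

(** The two variational problems correspond through u = z / (1 + z^p)^(1/p) and v^(p - 2) = w^2;
    then 1 - u^p = 1 / (1 + z^p). *)
Lemma F1_F2 beta z w : 2 < p -> 0 <= beta -> 0 <= z -> 0 <= w ->
  F1 p beta z w = F2 p beta (z / powR (1 + powR z p) p^-1) (powR w (2 / (p - 2))).
Proof.
move=> p2 b0 z0 w0; have p2' : 0 < p - 2 by rewrite subr_gt0.
set c := 1 + powR z p; have c0 : 0 < c by rewrite ltr_pwDl ?powR_ge0.
have q0 : 0 < powR c p^-1 by exact: powR_gt0.
have vp : powR (powR w (2 / (p - 2))) p = powR w (2 * p / (p - 2)).
  by rewrite -powRrM; congr powR; field; rewrite gt_eqF.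
have vp2 : powR (powR w (2 / (p - 2))) (p - 2) = w ^+ 2.
  rewrite -powRrM -powR_mulrn//; congr powR; field; rewrite gt_eqF//.
have up : powR (z / powR c p^-1) p = powR z p / c.
  rewrite powRM ?invr_ge0 ?(ltW q0)//; congr (_ * _).
  rewrite -[(powR c _)^-1]powR_inv1 ?(ltW q0)// -!powRrM.
  have -> : p^-1 * (-1 * p) = -1 by field; rewrite gt_eqF.
  by rewrite powR_inv1// ltW.
rewrite /F1 /F2 vp up vp2.
have -> : 1 - powR z p / c = c^-1 by rewrite /c; field; rewrite gt_eqF.
have -> : Num.sqrt (beta * (z / powR c p^-1) ^+ 2 * w ^+ 2) =
    Num.sqrt beta * (z * w / powR c p^-1).
  rewrite -mulrA -exprMn sqrtrM// sqrtr_sqr ger0_norm ?mulr_ge0 ?invr_ge0 ?(ltW q0)//.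
  by congr (_ * _); rewrite mulrAC.
by rewrite lnV ?posrE// mulrN.
Qed.

Lemma ereal_sup_F1 beta : 2 < p -> 0 <= beta ->
  ereal_sup [set y : \bar R | exists z w : R, [/\ 0 <= z, 0 <= w & y = (F1 p beta z w)%:E]]
  = (free_energy beta)%:E.
Proof.
move=> p2 b0; rewrite -ereal_sup_F2//; have p2' : 0 < p - 2 by rewrite subr_gt0.
congr ereal_sup; apply/seteqP; split=> y /=.
  move=> [z [w [z0 w0 ->]]]; rewrite F1_F2//.
  have c0 : 0 < 1 + powR z p by rewrite ltr_pwDl ?powR_ge0.
  exists (z / powR (1 + powR z p) p^-1), (powR w (2 / (p - 2))); split => //.
  - by rewrite divr_ge0// powR_ge0.
  - rewrite ltr_pdivrMr ?powR_gt0// mul1r.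
    have {1}-> : z = powR (powR z p) p^-1 by rewrite -powRrM mulfV ?gt_eqF// powRr1.
    by apply: gt0_ltr_powR; rewrite ?nnegrE ?invr_gt0 ?powR_ge0 ?(ltW c0)// ltrDr.
  - exact: powR_ge0.
move=> [u [v [u0 u1 v0 ->]]].
have up1 : powR u p < 1.
  suff : powR u p < powR 1 p by rewrite powR1.
  by apply: gt0_ltr_powR; rewrite ?nnegrE.
pose d := 1 - powR u p; have d0 : 0 < d by rewrite subr_gt0.
have q0 : 0 < powR d p^-1 by exact: powR_gt0.
(* The inverse of the map from z to u, defined on [0, 1). *)
pose z := u / powR d p^-1; have z0 : 0 <= z by rewrite divr_ge0// ltW.
have zp : 1 + powR z p = d^-1.
  rewrite /z powRM ?invr_ge0 ?(ltW q0)// -[(powR d _)^-1]powR_inv1 ?(ltW q0)// -!powRrM.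
  have -> : p^-1 * (-1 * p) = -1 by field; rewrite gt_eqF.
  by rewrite powR_inv1 ?(ltW d0)// /d; field; rewrite gt_eqF.
exists z, (powR v ((p - 2) / 2)); split => //; first exact: powR_ge0.
rewrite F1_F2 ?powR_ge0// zp.
have -> : z / powR d^-1 p^-1 = u.
  by rewrite -[d^-1]powR_inv1 ?(ltW d0)// -powRrM mulN1r powRN invrK /z divfK// gt_eqF.
rewrite -powRrM; have -> : (p - 2) / 2 * (2 / (p - 2)) = 1 by field; rewrite gt_eqF.
by rewrite powRr1.
Qed.

Lemma mseq_bigsum (I : Type) (r : seq I) (F : I -> seq R -> R) :
  (forall i, mseq (F i)) -> mseq (fun s => \sum_(i <- r) F i s).
Proof. by move=> mF n; apply: measurable_sum => i; exact: mF. Qed.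

(** With x = sqrt beta |m| and s_j the grid point below x, the parabola x^2 / 2 exceeds its tangent
    at s_j by (x - s_j)^2 / 2 <= d^2 / 2. The number of tangents does not depend on n, so summing
    over them costs only a constant factor. *)
Lemma Bn_upper beta eta : 0 <= beta -> 0 < eta ->
  exists2 C, 0 < C & \forall n \near \oo, Bn n beta <= C * expR (n%:R * (free_energy beta + eta)).
Proof.
move=> b0 eta0; set l := free_energy beta.
(* The mesh is below 1 and at most eta, so d^2 <= eta and the tangent error stays below eta / 2. *)
pose d := eta / (1 + eta); have e1 : 0 < 1 + eta by lra.
have d0 : 0 < d by rewrite divr_gt0.
have d1 : d < 1 by rewrite ltr_pdivrMr//; lra.
have de : d <= eta by rewrite ler_pdivrMr// ler_peMr ?(ltW eta0)//; lra.
(* The width of the window is small against beta: the factor 1 - e in [F2_upper] costs at most e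
   beta in the exponent per coordinate. *)
pose e := d / (4 * (1 + beta)).
have b1 : 0 < 4 * (1 + beta) by rewrite mulr_gt0//; lra.
have e0 : 0 < e by rewrite divr_gt0.
have e1' : e < 1 by rewrite ltr_pdivrMr//; lra.
have eb : e * beta <= eta / 4.
  have -> : e * beta = d * (beta / (1 + beta)) / 4 by rewrite /e; field; rewrite gt_eqF//; lra.
  rewrite ler_wpM2r ?invr_ge0//; apply: le_trans de; rewrite ler_piMr ?(ltW d0)//.
  by rewrite ler_pdivrMr; lra.
have ebp : e * beta / p <= eta / 8.
  rewrite ler_pdivrMr//; apply: (le_trans eb).
  have : eta / 8 * 2 <= eta / 8 * p by rewrite ler_wpM2l//; lra.
  lra.
have d2 : d ^+ 2 / 2 <= eta / 2.
  rewrite ler_wpM2r ?invr_ge0//; apply: le_trans de.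
  by rewrite expr2 ler_piMr ?(ltW d0) ?(ltW d1).
pose sb := Num.sqrt beta.
have sb0 : 0 <= sb by exact: sqrtr_ge0.
have sb2 : sb ^+ 2 = beta by rewrite sqr_sqrtr.
(* Grid points up to sqrt beta suffice because |m| <= 1. *)
pose J := (truncn (sb / d)).+1.
pose sj (j : nat) : R := j%:R * d.
have sj0 j : 0 <= sj j by rewrite mulr_ge0// ltW.
have sjb (j : nat) : (j < J)%N -> sj j <= sb.
  rewrite ltnS => jJ; rewrite /sj -ler_pdivlMr//.
  apply: (@le_trans _ _ (truncn (sb / d))%:R); first by rewrite ler_nat.
  by rewrite truncn_le// divr_ge0// ltW.
pose ct j (s : seq R) := ch (Num.sqrt (beta * sj j ^+ 2) * (1 - e) * (size s)%:R * mh s).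
have cE j : Num.sqrt (beta * sj j ^+ 2) = sb * sj j.
  by rewrite sqrtrM// sqrtr_sqr ger0_norm.
pose G n j s := expR (n%:R * (d ^+ 2 / 2 + e * beta)) * (2 * expR (- (n%:R * (sj j ^+ 2 / 2)))) * ct j s.
have mct j : mseq (ct j) by exact: mseq_ch.
have mG n j : mseq (G n j) by apply: mseqM => //; exact: mseq_cst.
have G0 n j s : 0 <= G n j s by rewrite !mulr_ge0 ?expR_ge0 ?ch_ge0.
have pw n s : size s = n -> quad_weight p beta s <= \sum_(j < J) G n j s.
  move=> sn; pose x := sb * `|mh s|.
  have x0 : 0 <= x by rewrite mulr_ge0.
  have xsb : x <= sb by rewrite ler_piMr// mh_le1.
  have xd0 : 0 <= x / d by rewrite divr_ge0// ltW.
  have jJ : (truncn (x / d) < J)%N.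
    by rewrite ltnS; apply: le_truncn; rewrite ler_pM2r ?invr_gt0.
  rewrite (bigD1 (Ordinal jJ))//=.
  apply: ler_wpDr; first by apply: sumr_ge0 => j _; exact: G0.
  rewrite /G /ct; set j := truncn _.
  have js : sj j <= x by rewrite /sj -ler_pdivlMr// truncn_le.
  have js2 : x <= sj j + d.
    rewrite /sj -[d in _ + d]mul1r -mulrDl natr1 -ler_pdivrMr//; apply/ltW.
    exact: truncnS_gt.
  rewrite -2!mulrA mulrCA [X in _ <= X](_ : _ = expR (n%:R * (d ^+ 2 / 2 + e * beta)) *
    expR (- (n%:R * (sj j ^+ 2 / 2))) * (2 * ch (Num.sqrt (beta * sj j ^+ 2) * (1 - e) * n%:R * mh s))); last first.
    by rewrite sn; ring.
  rewrite chE_norm.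
  apply: le_trans (ler_wpM2l _ (expR_le_ch _)); last by rewrite mulr_ge0 ?expR_ge0.
  rewrite -!expRD ler_expR sn cE.
  have -> : `|sb * sj j * (1 - e) * n%:R * mh s| = n%:R * ((1 - e) * sj j * x).
    have -> : sb * sj j * (1 - e) * n%:R * mh s = (n%:R * ((1 - e) * sj j * sb)) * mh s by ring.
    rewrite normrM (ger0_norm (_ : 0 <= n%:R * ((1 - e) * sj j * sb))).
      by rewrite /x; ring.
    rewrite mulr_ge0// mulr_ge0// mulr_ge0//; lra.
  have -> : beta * n%:R / 2 * mh s ^+ 2 = n%:R * (x ^+ 2 / 2).
    have -> : x ^+ 2 = beta * mh s ^+ 2.
      by rewrite -sb2 -[mh s ^+ 2]real_normK ?num_real// -exprMn.
    ring.
  rewrite -mulrN -!mulrDr ler_wpM2l//.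
  have h1 : (x - sj j) ^+ 2 <= d ^+ 2 by rewrite lerXn2r ?nnegrE ?subr_ge0 ?(ltW d0)//; lra.
  have h2 : e * (sj j * x) <= e * beta.
    by rewrite ler_wpM2l ?(ltW e0)// -sb2 expr2 ler_pM// (le_trans js).
  move: h1 h2; rewrite sqrrB; lra.
have dl : \forall n \near \oo, conc_err p e n < 1 / 2.
  have e01 : 0 < e < 1 by rewrite e0.
  have := conc_err_cvg hp e01; move/cvgrPdist_lt => /(_ (1 / 2)); rewrite divr_gt0// => /(_ isT).
  apply: filterS => n; rewrite sub0r normrN ger0_norm//.
  by rewrite addr_ge0 ?exprn_ge0 ?powR_ge0.
exists (4 * J%:R); first by rewrite mulr_gt0.
near=> n.
have n0 : (0 < n)%N by near: n; exact: nbhs_infty_gt.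
have dn : conc_err p e n < 1 / 2 by near: n.
rewrite -lee_fin BnE//.
apply: (@le_trans _ _ (En n (fun s => \sum_(j < J) G n j s)%R)).
  by apply: En_le; [exact: mseq_quad_weight|exact: mseq_bigsum|by move=> s; exact: expR_ge0|exact: pw].
rewrite (En_sum hp n J (mG n) (G0 n)).
have bound (j : 'I_J) : (En n (G n j) <= (4 * expR (n%:R * (l + eta)))%:E)%E.
  rewrite /G EnZ ?mulr_ge0 ?expR_ge0//; last by move=> s; exact: ch_ge0.
  have e01 : 0 < e < 1 by rewrite e0.
  have := F2_upper hp b0 (sqr_ge0 (sj j)) e01 n0.
  rewrite -[X in En n X]/(ct j).
  have : (0 <= En n (ct j))%E by apply: En_ge0 => s; exact: ch_ge0.
  have l1 : 0 < 1 + sj j ^+ 2 by rewrite ltr_pwDl ?sqr_ge0.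
  have F2l : F2 p beta (powR (sj j ^+ 2 / (1 + sj j ^+ 2)) p^-1) (powR (sj j ^+ 2) p^-1) <= l.
    apply: F2_free_energy; rewrite ?powR_ge0//.
    suff : powR (sj j ^+ 2 / (1 + sj j ^+ 2)) p^-1 < powR 1 p^-1 by rewrite powR1.
    apply: gt0_ltr_powR; rewrite ?nnegrE ?invr_gt0 ?divr_ge0 ?sqr_ge0 ?(ltW l1)//.
    by rewrite ltr_pdivrMr// mul1r ltrDr.
  have sjb2 : sj j ^+ 2 <= beta by rewrite -sb2 lerXn2r ?nnegrE ?sjb.
  case: (En n (ct j)) => [x| |]//=; last first.
    by rewrite gt0_muley ?lte_fin//; lra.
  rewrite -!EFinM !lee_fin => x0 H.
  set W := expR (n%:R * (F2 _ _ _ _ + _ + _)) in H.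
  have xW : x <= 2 * W.
    have : 1 / 2 * x <= (1 - conc_err p e n) * x by rewrite ler_wpM2r//; lra.
    lra.
  apply: (@le_trans _ _ (expR (n%:R * (d ^+ 2 / 2 + e * beta)) * (2 * expR (- (n%:R * (sj j ^+ 2 / 2)))) * (2 * W))).
    by rewrite ler_wpM2l ?mulr_ge0 ?expR_ge0.
  have -> : expR (n%:R * (d ^+ 2 / 2 + e * beta)) * (2 * expR (- (n%:R * (sj j ^+ 2 / 2)))) * (2 * W)
     = 4 * (expR (n%:R * (d ^+ 2 / 2 + e * beta)) * expR (- (n%:R * (sj j ^+ 2 / 2))) * W) by ring.
  (* The constant - s_j^2 / 2 of the tangent cancels the term lam / 2 of [F2_upper], where lam =
     s_j^2; the errors eta / 2 + eta / 4 + eta / 8 stay below eta. *)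
  rewrite ler_wpM2l// /W -!expRD ler_expR -mulrN -!mulrDr ler_wpM2l//.
  have : e * sj j ^+ 2 / p <= e * beta / p.
    by rewrite ler_wpM2r ?invr_ge0 ?(ltW p0)// ler_wpM2l// ltW.
  lra.
apply: (@le_trans _ _ (\sum_(j < J) (4 * expR (n%:R * (l + eta)))%:E)%E).
  by apply: lee_sum => j _; exact: bound.
rewrite sumEFin lee_fin sumr_const card_ord -mulr_natr le_eqVlt; apply/orP; left; apply/eqP.
by ring.
Unshelve. all: by end_near. Qed.

Lemma Bn_lower beta eta : 0 <= beta -> 0 < eta ->
  forall n, expR (n%:R * (free_energy beta - eta)) <= Bn n beta.
Proof.
move=> b0 eta0 n; have [_ [u [v [u0 u1 v0 ->]]] H] := sup_adherent eta0 (F2_set_sup b0).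
by apply: le_trans (F2_lower hp n b0 u0 u1 v0); rewrite ler_expR ler_wpM2l// ltW.
Qed.

Lemma Zpart_lower beta eta : 0 <= beta -> 0 < eta ->
  forall n, expR (- (beta / 2)) * expR (n%:R * (free_energy beta - eta)) <= Zpart p n beta.
Proof.
move=> b0 eta0 n; apply: le_trans (Zpart_geB hp n b0).
by rewrite ler_wpM2l ?expR_ge0// Bn_lower.
Qed.

Lemma free_energy_cvg beta : 0 <= beta ->
  (fun n : nat => n%:R^-1 * ln (Zpart p n beta)) @ \oo --> free_energy beta.
Proof.
move=> b0; apply: ln_rate_cvg => e e0.
  have [C C0 H] := Bn_upper b0 e0; exists C => //.
  by near=> n; apply: (le_trans (Zpart_leB hp n b0)); near: n.
by exists (expR (- (beta / 2))); [exact: expR_gt0|exact: Zpart_lower].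
Unshelve. all: by end_near. Qed.

Lemma gibbsE_eq n beta (f : seq R -> R) C : 0 <= beta -> mseq (fun s => f (hatv p s)) ->
  (forall s, `|f s| <= C) ->
  gibbsE p n beta f = fine (\int[tuple_prob (density_prob (rho_density hp)) n]_t
    (diag_weight p beta t * quad_weight p beta t * f (hatv p t))%:E)%E / Zpart p n beta.
Proof. by move=> b0 mf fC; rewrite /gibbsE (iprod_hatv hp n b0 mf fC). Qed.

Lemma magn_prob_le n beta A B : 0 <= beta -> measurable A -> 0 <= B ->
  (En n (fun s => quad_weight p beta s * \1_A (mh s))%R <= B%:E)%E ->
  0 <= magn_prob p n beta A <= B / Zpart p n beta.
Proof.
move=> b0 mA B0 H.
have Z0 : 0 < Zpart p n beta.
  by apply: lt_le_trans (Zpart_lower b0 ltr01 n); rewrite mulr_gt0 ?expR_gt0.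
have mI : mseq (fun s => \1_A (mh s) : R).
  by apply: (mseq_comp (g := \1_A : R -> R)); [exact: measurable_indic|exact: mseq_mh].
rewrite /magn_prob (gibbsE_eq n (C := 1) b0 mI); last first.
  by move=> s; rewrite indicE; case: (_ \in _); rewrite ?normr1 ?normr0.
set I := (\int[_]_t _)%E.
have I0 : (0 <= I)%E.
  by apply: integral_ge0 => t _; rewrite lee_fin !mulr_ge0 ?expR_ge0// indicE.
have IB : (I <= B%:E)%E.
  rewrite -[I]/(En n (fun s => diag_weight p beta s * quad_weight p beta s * \1_A (mh s))).
  apply: le_trans H; apply: En_le.
  - by apply: mseqM => //; apply: mseqM; [exact: mseq_diag_weight|exact: mseq_quad_weight].
  - by apply: mseqM => //; exact: mseq_quad_weight.
  - by move=> s; rewrite !mulr_ge0 ?expR_ge0// indicE.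
  - move=> s _; rewrite -mulrA ler_piMl ?diag_weight_le1//.
    by rewrite mulr_ge0 ?expR_ge0// indicE.
apply/andP; split; first by apply: divr_ge0; [exact: fine_ge0|exact: ltW].
rewrite ler_wpM2r ?invr_ge0 ?(ltW Z0)// -lee_fin fineK// ge0_fin_numE//.
exact: le_lt_trans IB (ltry _).
Qed.

Lemma free_energy_gt0 beta : betac p < beta -> 0 < free_energy beta.
Proof.
move=> bc; have bc0 := betac_gt0 hp; have b0 : 0 < beta by exact: lt_trans bc.
pose k := beta * M.
have k1 : 1 < k by rewrite /k mom1// ltr_pdivlMr// mul1r.
have k2 : 0 < 2 + k by lra.
(* The gain ln (1 + x) >= x / (1 + x) exceeds the cost lam / 2 as soon as lam (2 + k) < 2 (k - 1);
   half of that bound is taken. *)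
have [lam l0 lk] : exists2 lam, 0 < lam & lam * (2 + k) = k - 1.
  exists ((k - 1) / (2 + k)); first by rewrite divr_gt0//; lra.
  by rewrite divfK// gt_eqF.
have r0 : 0 < 1 + lam by lra.
have l1 : lam / (1 + lam) < 1 by rewrite ltr_pdivrMr//; lra.
have u1 : powR (lam / (1 + lam)) p^-1 < 1.
  suff : powR (lam / (1 + lam)) p^-1 < powR 1 p^-1 by rewrite powR1.
  have q0 : 0 <= lam / (1 + lam) by apply: divr_ge0; exact: ltW.
  by apply: gt0_ltr_powR; rewrite ?nnegrE ?invr_gt0.
apply: lt_le_trans (F2_free_energy (ltW b0) (powR_ge0 _ _) u1 (powR_ge0 lam p^-1)).
rewrite F2_param ?(ltW b0) ?(ltW l0)//; set t := Num.sqrt _ * _.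
(* Since 2 / p <= 1, (1 + lam)^(- 2 / p) is at least 1 / (1 + lam). *)
have t2 : beta * lam / (1 + lam) <= t ^+ 2.
  rewrite /t exprMn sqr_sqrtr ?mulr_ge0 ?(ltW b0) ?(ltW l0)//.
  rewrite ler_wpM2l ?mulr_ge0 ?(ltW b0) ?(ltW l0)//.
  rewrite -powR_mulrn ?powR_ge0// -powRrM mulNr powRN lef_pV2 ?posrE ?powR_gt0//.
  rewrite -[leRHS]powRr1 ?(ltW r0)//; apply: ler_powR; first lra.
  by rewrite mulrC ler_pdivrMr// mul1r.
have M0 := mom_gt0 hp 1.
pose x := k * lam / (2 * (1 + lam)).
have x0 : 0 <= x by rewrite divr_ge0 ?mulr_ge0//; lra.
have psix : ln (1 + x) <= psi p t.
  rewrite -ler_expR lnK ?posrE; last by lra.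
  apply: le_trans (expR_psi_ge hp t); rewrite lerD2l.
  have -> : x = beta * lam / (1 + lam) * M / 2 by rewrite /x /k; field; rewrite gt_eqF.
  by rewrite ler_wpM2r ?invr_ge0// ler_wpM2r// ltW.
have lnl : p^-1 * ln (1 + lam) <= p^-1 * lam.
  by rewrite ler_wpM2l ?invr_ge0 ?(ltW p0)// le_ln1Dx//; lra.
have xl : lam / 2 < x / (1 + x).
  have kl : 0 < k * lam by rewrite mulr_gt0//; lra.
  have D0 : 0 < 2 * (1 + lam) + k * lam by lra.
  have -> : x / (1 + x) = k * lam / (2 * (1 + lam) + k * lam).
    by rewrite /x; field; rewrite (gt_eqF D0) (gt_eqF r0).
  rewrite ltr_pdivlMr//.
  have -> : lam / 2 * (2 * (1 + lam) + k * lam) = lam * (1 + (lam * (2 + k)) / 2) by field.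
  by rewrite lk [ltRHS]mulrC ltr_pM2l//; lra.
have : (p - 2) / (2 * p) * lam = lam / 2 - p^-1 * lam by field; rewrite gt_eqF.
have := ln1D_ge x0; lra.
Qed.

Lemma magn_prob_low_temperature beta : betac p < beta ->
  exists K : set R, [/\ closed K, K `<=` `]0, 1]%classic &
    forall U : set R, open U -> K `|` [set - x | x in K] `<=` U ->
      (fun n : nat => magn_prob p n beta (~` U)) @ \oo --> 0].
Proof.
move=> bc; have l0 := free_energy_gt0 bc.
have bc0 := betac_gt0 hp; have b0 : 0 < beta by exact: lt_trans bc.
set l := free_energy beta in l0.
(* As d <= 1, d^2 <= d <= l / (2 beta): values |m| < d carry a weight of at most exp(n l / 4),
   against a partition function of at least exp(3 n l / 4) up to a constant. *)
pose d := Num.min 1 (l / (2 * beta)).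
have q0 : 0 < l / (2 * beta) by rewrite divr_gt0// mulr_gt0.
have d0 : 0 < d by rewrite lt_min ltr01.
have d1 : d <= 1 by rewrite ge_min lexx.
have dl : beta * d ^+ 2 / 2 <= l / 4.
  have h : d <= l / (2 * beta) by rewrite ge_min lexx orbT.
  have : d ^+ 2 <= l / (2 * beta) by rewrite expr2 -[leRHS]mulr1 ler_pM// ltW.
  rewrite -(ler_pM2l b0).
  have -> : beta * (l / (2 * beta)) = l / 2 by field; rewrite gt_eqF.
  lra.
exists `[d, 1]%classic; split.
- exact: itv_closed.
- by move=> x /=; rewrite !in_itv/= => /andP[dx ->]; rewrite (lt_le_trans d0).
move=> U oU KU.
have mU : measurable (~` U) by apply: measurableC; exact: open_measurable.
have l4 : 0 < l / 4 by rewrite divr_gt0.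
have bnd n := @magn_prob_le n beta (~` U) (expR (n%:R * (l / 4))) (ltW b0) mU (expR_ge0 _).
have H n : 0 <= magn_prob p n beta (~` U) <= expR (beta / 2) * expR (- (n%:R * (l / 2))).
  have /andP[-> h]/= : 0 <= magn_prob p n beta (~` U) <= expR (n%:R * (l / 4)) / Zpart p n beta.
    apply: bnd; rewrite -(En_cst hp n (expR_ge0 _)); apply: En_le.
    - apply: mseqM; first exact: mseq_quad_weight.
      by apply: (mseq_comp (g := \1_(~` U) : R -> R)); [exact: measurable_indic|exact: mseq_mh].
    - exact: mseq_cst.
    - by move=> s; rewrite mulr_ge0 ?expR_ge0// indicE.
    - move=> s sn; rewrite indicE; case: (boolP (_ \in _)) => [|_]; last by rewrite mulr0 expR_ge0.
      rewrite inE/= => nU; rewrite mulr1 /quad_weight sn ler_expR.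
      have mld : `|mh s| < d.
        rewrite ltNge; apply/negP => dm; apply: nU; apply: KU.
        have [m0|m0] := leP 0 (mh s).
          by left; rewrite /= in_itv/= -{2}(ger0_norm m0) mh_le1// andbT -[leRHS]ger0_norm.
        right; exists (- mh s); last by rewrite opprK.
        by rewrite /= in_itv/= -(ltr0_norm m0) dm mh_le1.
      have : mh s ^+ 2 <= d ^+ 2.
        by rewrite -[leLHS]real_normK ?num_real// lerXn2r ?nnegrE// ltW.
      move=> h; have -> : beta * n%:R / 2 * mh s ^+ 2 = n%:R * (beta * mh s ^+ 2 / 2) by ring.
      rewrite ler_wpM2l//; apply: le_trans dl.
      by rewrite ler_wpM2r ?invr_ge0// ler_wpM2l// ltW.
  apply: (le_trans h); have Zl := Zpart_lower (ltW b0) l4 n.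
  have Z0 : 0 < expR (- (beta / 2)) * expR (n%:R * (l - l / 4)) by rewrite mulr_gt0 ?expR_gt0.
  apply: (@le_trans _ _ (expR (n%:R * (l / 4)) / (expR (- (beta / 2)) * expR (n%:R * (l - l / 4))))).
    rewrite ler_wpM2l ?expR_ge0// lef_pV2 ?posrE//.
    exact: lt_le_trans Zl.
  by rewrite -!expRD -expRN -expRD ler_expR; lra.
apply: (@squeeze_cvgr _ _ _ _ (fun=> 0) (fun n => expR (beta / 2) * expR (- (n%:R * (l / 2))))).
- by apply: nearW => n; exact: H.
- exact: cvg_cst.
- by apply: expR_decay_cvg; rewrite divr_gt0.
Qed.

End free_energy.

(** * Below the critical temperature parameter *)

Section gaussian.
Context (R : realType).
Local Notation leb := (@lebesgue_measure R).

Lemma measurable_quad (a : R) : measurable_fun setT (fun x : R => expR (a * x ^+ 2)).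
Proof. by apply: measurableT_comp => //; apply: measurable_funM => //; apply: measurable_funX. Qed.

Lemma normal_pdf_shift (a x : R) :
  expR (a * x) * normal_pdf 0 1 x = expR (a ^+ 2 / 2) * normal_pdf a 1 x.
Proof.
rewrite !normal_pdfE ?oner_eq0//= /normal_fun mulrCA [RHS]mulrCA -!expRD.
by congr (_ * expR _); rewrite expr1n subr0 mulr2n; field.
Qed.

Lemma normal_mgf (a : R) :
  (\int[leb]_x (expR (a * x) * normal_pdf 0 1 x)%:E = (expR (a ^+ 2 / 2))%:E)%E.
Proof.
under eq_integral do rewrite normal_pdf_shift EFinM.
rewrite ge0_integralZl//.
- by rewrite integral_normal_pdf mule1.
- by apply/measurable_EFinP; exact: measurable_normal_pdf.
- by move=> x _; rewrite lee_fin normal_pdf_ge0.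
Qed.

(** The factor exp(c x^2 / 2) lowers the inverse variance by c. Starting from [betac], this produces
    the inverse variance [betac - beta] of the limit law. *)
Lemma normal_pdf_tilt (s t c x : R) : s != 0 -> t != 0 -> (t ^+ 2)^-1 = (s ^+ 2)^-1 - c ->
  expR (c / 2 * x ^+ 2) * normal_pdf 0 s x = normal_peak s / normal_peak t * normal_pdf 0 t x.
Proof.
move=> s0 t0 H; have P0 : normal_peak t != 0 by rewrite gt_eqF// normal_peak_gt0.
rewrite !normal_pdfE//= [RHS]mulrA divfK// mulrCA; congr (_ * _).
rewrite /normal_fun -expRD; congr expR; rewrite !subr0.
have -> : c = (s ^+ 2)^-1 - (t ^+ 2)^-1 by rewrite H; ring.
rewrite ![_ ^+ 2 *+ 2]mulr2n; field.
by rewrite -[s ^+ 2 + _]mulr2n -[t ^+ 2 + _]mulr2n !mulrn_eq0 !expf_eq0 (negbTE s0) (negbTE t0).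
Qed.

Lemma normal_quad (c : R) : c < 1 ->
  exists2 K : R, 0 < K & (\int[leb]_x (expR (c / 2 * x ^+ 2) * normal_pdf 0 1 x)%:E = K%:E)%E.
Proof.
move=> c1; pose t := (Num.sqrt (1 - c))^-1 : R.
have t0 : 0 < t by rewrite invr_gt0 sqrtr_gt0 subr_gt0.
have H : (t ^+ 2)^-1 = (1 ^+ 2)^-1 - c.
  by rewrite /t exprVn invrK sqr_sqrtr ?subr_ge0 ?(ltW c1)// expr1n invr1.
have K0 : 0 < normal_peak (1 : R) / normal_peak t.
  by rewrite divr_gt0// normal_peak_gt0 ?oner_eq0 ?gt_eqF.
exists (normal_peak 1 / normal_peak t) => //.
under eq_integral do rewrite (normal_pdf_tilt _ (oner_neq0 _) (lt0r_neq0 t0) H) EFinM.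
rewrite ge0_integralZl//.
- by rewrite integral_normal_pdf mule1.
- by apply/measurable_EFinP; exact: measurable_normal_pdf.
- by move=> x _; rewrite lee_fin normal_pdf_ge0.
- by rewrite lee_fin ltW.
Qed.

End gaussian.

(** * Bounded partition functions at high temperature *)

Section high_temperature.
Context (R : realType) (p : R).
Hypothesis hp : 2 <= p.
Local Notation leb := (@lebesgue_measure R).
Local Notation P := (density_prob (rho_density hp)).
Local Notation Pn n := (tuple_prob P n).
Local Notation En := (En hp).
Local Notation Bn := (Bn hp).
Local Notation mh := (mh p).
Local Notation M := (mom p 1).

Let p0 : 0 < p. Proof. by apply: lt_le_trans hp. Qed.

(* A Gaussian average linearizes the square of the sum. *)
Lemma En_quad_bounded (th : R) : 0 <= th -> th * M < 1 ->
  exists2 K, 0 < K & forall n, (0 < n)%N ->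
    (En n (fun s => expR (th / (2 * n%:R) * (\sum_(x <- s) x) ^+ 2)) <= K%:E)%E.
Proof.
move=> th0 thM; have [K K0 HK] := normal_quad thM; exists K => // n n0.
have n0' : 0 < n%:R :> R by rewrite ltr0n.
pose a := Num.sqrt (th / n%:R).
have a2 : a ^+ 2 = th / n%:R by rewrite sqr_sqrtr// divr_ge0.
pose f (tg : n.-tuple (measurableTypeR R) * R) : R :=
  expR (a * (\sum_(x <- tg.1) x) * tg.2) * normal_pdf 0 1 tg.2.
have mS : measurable_fun setT (fun t : n.-tuple (measurableTypeR R) => \sum_(x <- t) x).
  exact: (@mseq_sum R id _ n).
have mf : measurable_fun setT (EFin \o f).
  apply/measurable_EFinP; apply: measurable_funM.
    apply: measurableT_comp => //; apply: measurable_funM => //.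
    by apply: measurable_funM => //; exact: (measurableT_comp mS).
  by apply: (measurableT_comp (measurable_normal_pdf 0 1)).
have f0 tg : (0 <= (EFin \o f) tg)%E.
  by rewrite lee_fin mulr_ge0 ?expR_ge0 ?normal_pdf_ge0.
have -> : (En n (fun s => expR (th / (2 * n%:R) * (\sum_(x <- s) x) ^+ 2)) =
    \int[Pn n]_t \int[leb]_g (EFin \o f) (t, g))%E.
  apply: eq_integral => t _; rewrite /f/= normal_mgf exprMn a2; congr (expR _)%:E.
  by field; rewrite gt_eqF.
rewrite fubini_tonelli//.
rewrite -HK; apply: ge0_le_integral => //.
- by move=> g _; exact: integral_ge0.
- exact: measurable_fun_fubini_tonelli_G.
- apply/measurable_EFinP; apply: measurable_funM; last exact: measurable_normal_pdf.
  exact: measurable_quad.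
move=> g _; rewrite /f/=.
have -> : (\int[Pn n]_t (expR (a * (\sum_(x <- t) x) * g) * normal_pdf 0 1 g)%:E =
   En n (fun s => normal_pdf 0 1 g * expR (a * g * \sum_(x <- s) x))%R)%E.
  by apply: eq_integral => t _; congr EFin; rewrite mulrC [a * g * _]mulrAC.
have mE : mseq (fun s => expR (a * g * \sum_(x <- s) x)).
  have mg : measurable_fun setT (fun y : R => expR (a * g * y)).
    by apply: measurableT_comp => //; exact: measurable_funM.
  by apply: (mseq_comp mg (F := fun s => \sum_(x <- s) x)); exact: (@mseq_sum R id).
rewrite (EnZ hp n mE (fun s => expR_ge0 _) (normal_pdf_ge0 _ _ _)).
rewrite En_expR_sum -EFinM lee_fin mulrC ler_wpM2r ?normal_pdf_ge0// ler_expR.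
(* [psi_le] bounds the average by exp(th M g^2 / 2) for every n; this is integrable against the
   standard Gaussian because th M < 1. *)
apply: (@le_trans _ _ (n%:R * ((a * g) ^+ 2 * M / 2))); first by rewrite ler_wpM2l// psi_le.
rewrite exprMn a2 le_eqVlt; apply/orP; left; apply/eqP.
by field; rewrite gt_eqF.
Qed.

(** In the window the sum is n m N with N^2 >= 1 - e, so the self-normalized weight at beta is at
    most the weight of the plain sum at th = beta / (1 - e). *)
Lemma Bn_bounded beta : 0 <= beta -> beta < betac p ->
  exists2 C, 0 < C & \forall n \near \oo, Bn n beta <= C.
Proof.
move=> b0 bc; have c0 := betac_gt0 hp.
(* Then [betac * (1 - e)] is the midpoint of beta and [betac], which keeps th below [betac]. *)
pose e := (betac p - beta) / (2 * betac p).
have c2 : 0 < 2 * betac p by rewrite mulr_gt0.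
have e0 : 0 < e by rewrite divr_gt0 ?subr_gt0.
have e1 : e < 1.
  by rewrite /e ltr_pdivrMr//; move: b0 bc c0; lra.
have e01 : 0 < e < 1 by rewrite e0 e1.
have e1' : 0 < 1 - e by rewrite subr_gt0.
pose th := beta / (1 - e).
have th0 : 0 <= th by rewrite divr_ge0// ltW.
have thb : th * (1 - e) = beta by rewrite divfK// gt_eqF.
have thM : th * M < 1.
  rewrite mom1// ltr_pdivrMr// mul1r ltr_pdivrMr//.
  have -> : betac p * (1 - e) = (betac p + beta) / 2 by rewrite /e; field; rewrite gt_eqF.
  lra.
have [K K0 HK] := En_quad_bounded th0 thM.
exists (2 * K); first by rewrite mulr_gt0.
have dl : \forall n \near \oo, conc_err p e n < 1 / 2.
  have := conc_err_cvg hp e01; move/cvgrPdist_lt => /(_ (1 / 2)); rewrite divr_gt0// => /(_ isT).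
  apply: filterS => n; rewrite sub0r normrN ger0_norm//.
  by rewrite addr_ge0 ?exprn_ge0 ?powR_ge0.
near=> n.
have n0 : (0 < n)%N by near: n; exact: nbhs_infty_gt.
have n0' : 0 < n%:R :> R by rewrite ltr0n.
have dn : conc_err p e n < 1 / 2 by near: n.
have : ((1 - conc_err p e n)%:E * En n (quad_weight p beta) <= K%:E)%E.
  apply: le_trans (HK n n0).
  have qM s : size s = n -> quad_weight p beta s <= expR (beta * n%:R / 2) by move=> <-; exact: quad_weight_le.
  apply: (le_trans (En_conc_le hp e01 (mseq_quad_weight p beta) (fun s => expR_ge0 _)
    (homogeneous_quad_weight hp beta) qM)).
  apply: En_le.
  - by apply: mseqM; [exact: mseq_quad_weight|exact: mseq_near_sphere].
  - apply: (mseq_comp (measurable_quad (th / (2 * n%:R))) (F := fun s => \sum_(x <- s) x)).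
    exact: (@mseq_sum R id).
  - by move=> s; rewrite mulr_ge0 ?expR_ge0 ?near_sphere_ge0.
  move=> s sn; have [g1|g0] := eqVneq (near_sphere p e s) 1; last first.
    have -> : near_sphere p e s = 0 by exact: near1_eq0 g0.
    by rewrite mulr0 expR_ge0.
  have /near1P/andP[g1l _] : near1 e ((size s)%:R^-1 * sabs p s) == 1 by apply/eqP.
  rewrite g1 mulr1 (sum_mh hp) ler_expR sn.
  set m := mh s; set N := normp p s.
  have N0 : 0 <= N by exact: normp_ge0.
  have Np : 1 - e <= powR N p by rewrite /N normp_powR.
  (* For N < 1 this uses N^p <= N^2, which is where p >= 2 enters. *)
  have N2 : 1 - e <= N ^+ 2.
    have [N1|N1] := leP 1 N.
      by apply: (@le_trans _ _ 1); [lra|rewrite exprn_ege1].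
    have Npos : 0 < N.
      rewrite lt0r N0 andbT; apply/eqP => NE; move: Np; rewrite NE powR0 ?gt_eqF//; lra.
    apply: (le_trans Np); rewrite -powR_mulrn//; apply: ger_powR => //.
    by rewrite Npos ltW.
  have -> : th / (2 * n%:R) * (n%:R * (m * N)) ^+ 2 = n%:R / 2 * m ^+ 2 * (th * N ^+ 2).
    by field; rewrite gt_eqF.
  have -> : beta * n%:R / 2 * m ^+ 2 = n%:R / 2 * m ^+ 2 * (th * (1 - e)) by rewrite thb; ring.
  have nm0 : 0 <= n%:R / 2 * m ^+ 2 by rewrite mulr_ge0 ?sqr_ge0 ?divr_ge0.
  by apply: (ler_wpM2l nm0); apply: (ler_wpM2l th0).
rewrite -BnE// -EFinM lee_fin => H.
have B0 : 0 <= Bn n beta by apply: le_trans (Bn_ge1 hp n b0).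
have : 1 / 2 * Bn n beta <= (1 - conc_err p e n) * Bn n beta by rewrite ler_wpM2r//; lra.
lra.
Unshelve. all: by end_near. Qed.

Lemma Bn_uniformly_bounded beta : 0 <= beta -> beta < betac p ->
  exists2 C, 0 <= C & forall n, Bn n beta <= C.
Proof.
move=> b0 bc; have [C C0 [N _ HN]] := Bn_bounded b0 bc.
exists (C + expR (beta * N%:R / 2)) => [|n]; first by rewrite addr_ge0 ?expR_ge0// ltW.
have [Nn|nN] := leqP N n; first by apply: (le_trans (HN n Nn)); rewrite lerDl expR_ge0.
apply: (le_trans (Bn_le hp n b0)); apply: ler_wpDl; first exact: ltW.
by rewrite ler_expR ler_wpM2r ?invr_ge0// ler_wpM2l// ler_nat ltnW.
Qed.

Lemma Zpart_bounded beta : 0 <= beta -> beta < betac p ->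
  exists C : R, forall n : nat, Zpart p n beta <= C.
Proof.
move=> b0 bc; have [C _ H] := Bn_uniformly_bounded b0 bc.
by exists C => n; exact: le_trans (Zpart_leB hp n b0) (H n).
Qed.

Lemma Zpart_ge n beta : 0 <= beta -> expR (- (beta / 2)) <= Zpart p n beta.
Proof.
move=> b0; apply: le_trans (Zpart_geB hp n b0).
by rewrite ler_peMr ?expR_ge0 ?Bn_ge1.
Qed.

Lemma Zpart_rate0 beta : 0 <= beta -> beta < betac p ->
  (fun n : nat => n%:R^-1 * ln (Zpart p n beta)) @ \oo --> (0 : R).
Proof.
move=> b0 bc; have [C C0 H] := Bn_bounded b0 bc; apply: ln_rate_cvg => e e0.
  exists C => //; near=> n; apply: (le_trans (Zpart_leB hp n b0)).
  apply: (@le_trans _ _ C); first by near: n.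
  by rewrite ler_peMr ?(ltW C0)// -expR0 ler_expR add0r mulr_ge0// ltW.
exists (expR (- (beta / 2))) => [|n]; first exact: expR_gt0.
apply: le_trans (Zpart_ge n b0); rewrite ler_piMr ?expR_ge0// -expR0 ler_expR.
by rewrite sub0r mulr_ge0_le0// oppr_le0 ltW.
Unshelve. all: by end_near. Qed.

(* Exponential Chebyshev against the bounded partition function at an intermediate temperature. *)
Lemma magn_prob_high_temperature beta : 0 <= beta -> beta < betac p ->
  forall eps : R, 0 < eps ->
    (fun n : nat => magn_prob p n beta [set x | eps <= `|x|]) @ \oo --> (0 : R).
Proof.
move=> b0 bc eps eps0; pose b' := (beta + betac p) / 2.
have bb' : beta < b' by rewrite /b'; lra.
have b'c : b' < betac p by rewrite /b'; lra.
have b'0 : 0 <= b' by exact: le_trans (ltW bb').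
have [C C0 HC] := Bn_bounded b'0 b'c.
pose A : set R := [set x | eps <= `|x|].
have mA : measurable A.
  have -> : A = ~` `](- eps)%R, eps[%classic.
    apply/seteqP; split=> x /=; rewrite /A/= in_itv/= -ltr_norml.
      by move=> h; apply/negP; rewrite -leNgt.
    by move=> /negP; rewrite -leNgt.
  by apply: measurableC; exact: measurable_itv.
pose d := (b' - beta) * eps ^+ 2 / 2.
have d0 : 0 < d by rewrite divr_gt0// mulr_gt0 ?subr_gt0 ?exprn_gt0.
have bnd : \forall n \near \oo, 0 <= magn_prob p n beta A <= (expR (beta / 2) * C) * expR (- (n%:R * d)).
  near=> n; have HCn : Bn n b' <= C by near: n.
  have CE0 : 0 <= expR (- (n%:R * d)) * C by rewrite mulr_ge0 ?expR_ge0 ?ltW.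
  have /andP[-> h]/= : 0 <= magn_prob p n beta A <= (expR (- (n%:R * d)) * C) / Zpart p n beta.
    apply: (magn_prob_le (hp := hp) b0 mA CE0).
    apply: (@le_trans _ _ (En n (fun s => expR (- (n%:R * d)) * quad_weight p b' s))); last first.
      rewrite EnZ ?expR_ge0//; [|exact: mseq_quad_weight|by move=> s; exact: expR_ge0].
      by rewrite -BnE// -EFinM lee_fin ler_wpM2l ?expR_ge0.
    apply: En_le.
    - apply: mseqM; first exact: mseq_quad_weight.
      by apply: (mseq_comp (g := \1_A : R -> R)); [exact: measurable_indic|exact: mseq_mh].
    - by apply: mseqM; [exact: mseq_cst|exact: mseq_quad_weight].
    - by move=> s; rewrite mulr_ge0 ?expR_ge0// indicE.
    - move=> s sn; rewrite indicE; case: (boolP (_ \in _)) => [|_]; last first.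
        by rewrite mulr0 mulr_ge0 ?expR_ge0.
      rewrite inE/= => em; rewrite mulr1 /quad_weight sn -expRD ler_expR.
      have m2 : eps ^+ 2 <= mh s ^+ 2.
        by rewrite -[leRHS]real_normK ?num_real// lerXn2r ?nnegrE// ltW.
      rewrite -subr_ge0.
      have -> : - (n%:R * d) + b' * n%:R / 2 * mh s ^+ 2 - beta * n%:R / 2 * mh s ^+ 2 =
        n%:R * ((b' - beta) / 2 * (mh s ^+ 2 - eps ^+ 2)) by rewrite /d; ring.
      by rewrite !mulr_ge0 ?subr_ge0 ?divr_ge0 ?subr_ge0 ?(ltW bb').
  apply: (le_trans h); have Zl := Zpart_ge n b0.
  have Z0 : 0 < Zpart p n beta by apply: lt_le_trans Zl; exact: expR_gt0.
  rewrite ler_pdivrMr// -[leLHS]mulr1.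
  have -> : expR (beta / 2) * C * expR (- (n%:R * d)) * Zpart p n beta =
    expR (- (n%:R * d)) * C * (expR (beta / 2) * Zpart p n beta) by ring.
  rewrite ler_wpM2l// -(ler_pM2l (expR_gt0 (- (beta / 2)))) mulr1 mulrA -expRD.
  by rewrite addNr expR0 mul1r.
apply: (@squeeze_cvgr _ _ _ _ (fun=> 0) (fun n => (expR (beta / 2) * C) * expR (- (n%:R * d)))) => //.
- exact: cvg_cst.
- exact: expR_decay_cvg.
Unshelve. all: by end_near. Qed.

End high_temperature.

(** * Trigonometric approximation *)

Section trigonometric_bounds.
Context (R : realType).

Lemma norm_sin_le (x : R) : `|sin x| <= `|x|.
Proof.
have H (y : R) : 0 < y -> `|sin y| <= y.
  move=> y0; have Hc : {within `[0, y], continuous (@sin R)}.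
    by apply: continuous_subspaceT => z; exact: continuous_sin.
  have [c _] := MVT y0 (fun z _ => is_derive_sin z) Hc; rewrite sin0 !subr0 => ->.
  by rewrite normrM [X in _ * X]gtr0_norm// ler_piMl ?cos_max// ltW.
have [x0|x0|->] := ltgtP x 0; last by rewrite sin0 normr0.
  by rewrite -normrN -sinN (le_trans (H _ _)) ?oppr_gt0// ltr0_norm.
by rewrite (le_trans (H _ x0))// ler_norm.
Qed.

Lemma sub_cos_le (x : R) : `|1 - cos x| <= x ^+ 2 / 2.
Proof.
have -> : 1 - cos x = 2 * sin (x / 2) ^+ 2.
  have {1}-> : x = x / 2 *+ 2 by rewrite mulr2n; field.
  by rewrite cos_mulr2n cos2sin2 mulr2n; ring.
have : sin (x / 2) ^+ 2 <= (x / 2) ^+ 2.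
  by rewrite -[leLHS]real_normK ?num_real// -[leRHS]real_normK ?num_real// lerXn2r ?nnegrE// norm_sin_le.
have s0 := sqr_ge0 (sin (x / 2)).
rewrite ger0_norm; last by rewrite mulr_ge0.
have -> : (x / 2) ^+ 2 = x ^+ 2 / 4 by field.
lra.
Qed.

Lemma norm_sub_sin_le (x : R) : `|x - sin x| <= `|x| ^+ 3 / 2.
Proof.
have H (y : R) : 0 < y -> `|y - sin y| <= y ^+ 3 / 2.
  move=> y0; have Hc : {within `[0, y], continuous (fun z : R => z - sin z)}.
    by apply: continuous_subspaceT => z; apply: cvgB; [exact: cvg_id|exact: continuous_sin].
  have Hd z : z \in `]0, y[ -> is_derive z 1 (fun z : R => z - sin z) (1 - cos z).
    by move=> zi; apply: is_deriveB.
  have [c] := MVT y0 Hd Hc; rewrite in_itv/= => /andP[c0 cy]; rewrite sin0 !subr0 => ->.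
  rewrite normrM [X in _ * X]gtr0_norm//.
  have -> : y ^+ 3 / 2 = y ^+ 2 / 2 * y by ring.
  rewrite (ler_pM2r y0); apply: (le_trans (sub_cos_le c)).
  by rewrite ler_pM2r ?invr_gt0// lerXn2r ?nnegrE// ltW.
have [x0|x0|->] := ltgtP x 0; last by rewrite sin0 subr0 normr0 expr0n mul0r.
  by have := H (- x); rewrite sinN -opprD normrN (ltr0_norm x0) oppr_gt0 => /(_ x0).
by have := H x x0; rewrite (gtr0_norm x0).
Qed.

(** By the half-angle formula the quantity is 2 (h - sin h) (h + sin h) with h = x / 2, so the cubic
    bound on h - sin h suffices. *)
Lemma cos_taylor (x : R) : `|cos x - 1 + x ^+ 2 / 2| <= x ^+ 4 / 8.
Proof.
pose h := x / 2; pose s := sin h.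
have -> : cos x - 1 + x ^+ 2 / 2 = 2 * (h - s) * (h + s).
  have {1}-> : x = h *+ 2 by rewrite mulr2n /h; field.
  by rewrite cos_mulr2n cos2sin2 -/s mulr2n /h; field.
have -> : x ^+ 4 / 8 = 2 * (`|h| ^+ 3 / 2) * (2 * `|h|).
  have -> : x ^+ 4 = (x ^+ 2) ^+ 2 by rewrite -exprM.
  have -> : 2 * (`|h| ^+ 3 / 2) * (2 * `|h|) = 2 * (`|h| ^+ 2) ^+ 2 by field.
  by rewrite real_normK ?num_real// /h; field.
rewrite normrM [`|2 * _|]normrM ger0_norm//; apply: ler_pM => //.
  by rewrite ler_pM2l//; exact: norm_sub_sin_le.
by apply: (le_trans (ler_normD _ _)); have := norm_sin_le h; rewrite -/s; lra.
Qed.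

Lemma expRN_taylor (x : R) : 0 <= x -> `|expR (- x) - 1 + x| <= x ^+ 2.
Proof.
move=> x0; have e1 := expR_ge1Dx (- x); have e2 := expR_ge1Dx x.
have e12 : expR (- x) * expR x = 1 by rewrite -expRD addNr expR0.
have ex : expR (- x) <= 1 - x + x ^+ 2.
  have h0 : 0 <= 1 - x + x ^+ 2 by have := sqr_ge0 (x - 1 / 2); lra.
  rewrite -(ler_pM2r (expR_gt0 x)) e12.
  apply: (@le_trans _ _ ((1 - x + x ^+ 2) * (1 + x))); last by rewrite ler_wpM2l.
  have -> : (1 - x + x ^+ 2) * (1 + x) = 1 + x ^+ 3 by ring.
  by rewrite lerDl exprn_ge0.
by rewrite ger0_norm; lra.
Qed.

(** The remainder is global: for a = t x and b = k x^2 it is a multiple of x^4, hence integrable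
    under [rho]. *)
Lemma cos_expRN_taylor (a b : R) : 0 <= b ->
  `|cos a * expR (- b) - 1 + a ^+ 2 / 2 + b| <= 2 * (b ^+ 2 + a ^+ 4).
Proof.
move=> b0; have H1 := expRN_taylor b0; have H2 := cos_taylor a; have H3 := sub_cos_le a.
have -> : cos a * expR (- b) - 1 + a ^+ 2 / 2 + b =
  cos a * (expR (- b) - 1 + b) + (cos a - 1 + a ^+ 2 / 2) + b * (1 - cos a) by ring.
have K1 : `|cos a * (expR (- b) - 1 + b)| <= b ^+ 2.
  by rewrite normrM (le_trans _ H1)// ler_piMl ?cos_max.
have K3 : `|b * (1 - cos a)| <= b * (a ^+ 2 / 2) by rewrite normrM (ger0_norm b0) ler_wpM2l.
have a4 : a ^+ 4 = (a ^+ 2) ^+ 2 by rewrite -exprM.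
apply: (le_trans (ler_normD _ _)); apply: (le_trans (lerD (ler_normD _ _) K3)).
have A0 := sqr_ge0 a; have B0 := sqr_ge0 b; have A4 := sqr_ge0 (a ^+ 2).
have AB := sqr_ge0 (b - a ^+ 2 / 2).
apply: (le_trans (lerD (lerD K1 H2) (lexx _))); rewrite a4; lra.
Qed.

End trigonometric_bounds.

Section approximation.
Context (R : realType).

Lemma uniform_continuity (f : R -> R) (A e : R) : continuous f -> 0 < e ->
  exists2 d : R, 0 < d & forall x y, - A <= x <= A -> `|x - y| < d -> `|f x - f y| < e.
Proof.
move=> cf e0; pose P (d x : R) := forall y, `|x - y| < d -> `|f x - f y| < e.
have : \forall d \near 0^'+, (`[- A, A]%classic : set R) `<=` P d.
  have /compact_near_coveringP := @segment_compact R (- A) A; apply => x _.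
  have e2 : 0 < e / 2 by rewrite divr_gt0.
  have /cvgrPdist_lt/(_ _ e2) /nbhs_ballP[r /= r0 Hr] := cf x.
  have r2 : 0 < r / 2 by rewrite divr_gt0.
  exists (ball x (r / 2), [set d | d < r / 2]); first split => /=.
  - exact: nbhsx_ballx.
  - exact: nbhs_right_lt.
  move=> [x' d] /= [xx' dr] y yd.
  have h1 : `|f x - f x'| < e / 2.
    by apply: Hr; apply: le_ball xx'; lra.
  have h2 : `|f x - f y| < e / 2.
    apply: Hr; rewrite /ball/=.
    have -> : x - y = (x - x') + (x' - y) by ring.
    rewrite (le_lt_trans (ler_normD _ _))// (splitr r) ltrD//.
    exact: lt_trans yd dr.
  have -> : f x' - f y = - (f x - f x') + (f x - f y) by ring.
  by rewrite (le_lt_trans (ler_normD _ _))// normrN (splitr e) ltrD.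
case=> d /= d0 Hd; exists (d / 2); first by rewrite divr_gt0.
move=> x y xA; apply: (Hd (d / 2)) => /=; last by rewrite in_itv.
- by rewrite sub0r normrN gtr0_norm ?divr_gt0// ltr_pdivrMr// ltr_pMr// ltrDl.
- by rewrite divr_gt0.
Qed.

(* [bern N phi y] is the expectation of [phi] at a binomial variable of parameters [N] and [y],
   so that [fun y => bern N (fun k => h (k / N)) y] is the Bernstein polynomial of [h]. *)
Fixpoint bern N (phi : nat -> R) (y : R) : R :=
  if N is N'.+1 then (1 - y) * bern N' phi y + y * bern N' (phi \o S) y else phi 0%N.

Lemma bern_le N phi psi y : 0 <= y <= 1 -> (forall k, (k <= N)%N -> phi k <= psi k) ->
  bern N phi y <= bern N psi y.
Proof.
move=> /andP[y0 y1]; elim: N phi psi => [|N IH] phi psi H/=; first exact: H.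
apply: lerD; apply: ler_wpM2l; rewrite ?subr_ge0//; apply: IH => k kN /=.
- by apply: H; exact: leqW.
- exact: H.
Qed.

(** The mean N y and the variance N y (1 - y) of a binomial variable, obtained from the
    recursion. *)
Lemma bern_quad N (a c d y : R) :
  bern N (fun k => a + c * (k%:R - d) ^+ 2) y =
  a + c * (N%:R * y * (1 - y) + (N%:R * y - d) ^+ 2).
Proof.
elim: N d => [|N IH] d/=; first by ring.
have -> : (fun k => a + c * (k%:R - d) ^+ 2) \o S = fun k => a + c * (k%:R - (d - 1)) ^+ 2.
  by apply/funext => k /=; rewrite -natr1; ring.
by rewrite !IH -natr1; ring.
Qed.

Lemma bernstein (h : R -> R) (e : R) : continuous h -> 0 < e ->
  exists N, forall y, 0 <= y <= 1 -> `|h y - bern N (fun k => h (k%:R / N%:R)) y| <= e.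
Proof.
move=> ch e0; have e2 : 0 < e / 2 by rewrite divr_gt0.
have [d d0 Hd] := uniform_continuity 1 ch e2.
have [B B0 HB] : exists2 B : R, 0 <= B & forall y, 0 <= y <= 1 -> `|h y| <= B.
  have cn : {within `[0, 1], continuous (fun y => `|h y|)}.
    by apply: continuous_subspaceT => z; apply: cvg_norm; exact: ch.
  have [c _ Hc] := EVT_max ler01 cn.
  by exists `|h c| => // y y01; apply: Hc; rewrite in_itv.
(* When |y - z| >= d, the trivial bound 2 B is at most c (y - z)^2: one quadratic in k majorizes the
   oscillation everywhere, and [bern_quad] evaluates it. *)
pose c := 2 * B / d ^+ 2.
have c0 : 0 <= c by rewrite divr_ge0 ?sqr_ge0 ?mulr_ge0.
pose N := (truncn (2 * c / e)).+1.
have N0 : 0 < N%:R :> R by rewrite ltr0n.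
have Nc : c / N%:R <= e / 2.
  rewrite ler_pdivrMr// mulrC -ler_pdivrMr ?divr_gt0//.
  have -> : c / (e / 2) = 2 * c / e by field; rewrite gt_eqF.
  by apply/ltW; rewrite /N -natr1; apply: lt_le_trans (truncnS_gt _) _.
exists N => y y01; have /andP[y0 y1] := y01.
have key k : (k <= N)%N -> `|h y - h (k%:R / N%:R)| <= e / 2 + c / N%:R ^+ 2 * (k%:R - N%:R * y) ^+ 2.
  move=> kN; set z := k%:R / N%:R.
  have -> : c / N%:R ^+ 2 * (k%:R - N%:R * y) ^+ 2 = c * (y - z) ^+ 2.
    by rewrite /z; field; rewrite gt_eqF.
  have z01 : 0 <= z <= 1 by rewrite divr_ge0//= ler_pdivrMr// mul1r ler_nat.
  have [yz|yz] := ltP `|y - z| d.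
    apply: (@le_trans _ _ (e / 2)); last by rewrite lerDl mulr_ge0 ?sqr_ge0.
    apply/ltW/Hd => //; apply/andP; split => //; lra.
  apply: (@le_trans _ _ (2 * B)).
    by apply: (le_trans (ler_normB _ _)); have := HB _ y01; have := HB _ z01; lra.
  apply: (@le_trans _ _ (c * (y - z) ^+ 2)); last by rewrite lerDr ltW.
  have -> : 2 * B = c * d ^+ 2 by rewrite /c divfK// expf_neq0// gt_eqF.
  rewrite ler_wpM2l// -[leRHS]real_normK ?num_real// lerXn2r ?nnegrE//; exact: ltW.
have tot : e / 2 + c / N%:R ^+ 2 * (N%:R * y * (1 - y) + (N%:R * y - N%:R * y) ^+ 2) <= e.
  have -> : e / 2 + c / N%:R ^+ 2 * (N%:R * y * (1 - y) + (N%:R * y - N%:R * y) ^+ 2) =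
    e / 2 + c / N%:R * (y * (1 - y)) by field; rewrite gt_eqF.
  have yy : y * (1 - y) <= 1.
    by rewrite -[leRHS]mul1r ler_pM ?subr_ge0//; lra.
  have : c / N%:R * (y * (1 - y)) <= c / N%:R by rewrite ler_piMr// divr_ge0// ltW.
  lra.
rewrite ler_distlC; apply/andP; split.
  have := @bern_le N (fun k => h y - e / 2 + (- (c / N%:R ^+ 2)) * (k%:R - N%:R * y) ^+ 2)
    (fun k => h (k%:R / N%:R)) y y01.
  rewrite bern_quad => H; apply: le_trans (H _); first by lra.
  by move=> k kN; have := ler_norm (h y - h (k%:R / N%:R)); have := key k kN; lra.
have := @bern_le N (fun k => h (k%:R / N%:R))
  (fun k => h y + e / 2 + c / N%:R ^+ 2 * (k%:R - N%:R * y) ^+ 2) y y01.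
rewrite bern_quad => H; apply: le_trans (H _) _; last by lra.
by move=> k kN; have := ler_norm (- (h y - h (k%:R / N%:R))); rewrite normrN; have := key k kN; lra.
Qed.

(** The phase lets cosines stand for sines, and product-to-sum formulas keep the class stable under
    multiplication by a sine. Linear functionals then need testing only on single cosines. *)
Inductive trigp : (R -> R) -> Prop :=
| trigp_cos s a : trigp (fun x => cos (s * x + a))
| trigp_comb a b f g : trigp f -> trigp g -> trigp (fun x => a * f x + b * g x).

Lemma trigp_cst c : trigp (fun=> c).
Proof.
have -> : (fun=> c) = fun x => c * cos (0 * x + 0) + 0 * cos (0 * x + 0) :> R.
  by apply/funext => x; rewrite !mul0r !addr0 cos0 mulr1.
by apply: trigp_comb; exact: trigp_cos.
Qed.

Lemma trigp_sinM u f : trigp f -> trigp (fun x => sin (u * x) * f x).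
Proof.
elim=> [s a|a b g h _ IHg _ IHh].
  have -> : (fun x => sin (u * x) * cos (s * x + a)) = fun x =>
      2^-1 * cos ((u + s) * x + (a - pi / 2)) + 2^-1 * cos ((u - s) * x + (- a - pi / 2)).
    apply/funext => x.
    have -> : (u + s) * x + (a - pi / 2) = (u * x + (s * x + a)) - pi / 2 by ring.
    have -> : (u - s) * x + (- a - pi / 2) = (u * x - (s * x + a)) - pi / 2 by ring.
    by rewrite !cosBpihalf sinD sinB; field.
  by apply: trigp_comb; exact: trigp_cos.
have -> : (fun x => sin (u * x) * (a * g x + b * h x)) =
    fun x => a * (sin (u * x) * g x) + b * (sin (u * x) * h x).
  by apply/funext => x; ring.
exact: trigp_comb.
Qed.

(** The recursion of [bern] multiplies by y and 1 - y; with y = (1 + sin (u x)) / 2 each step is a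
    multiplication by a sine. *)
Lemma trigp_bern N phi u : trigp (fun x => bern N phi ((1 + sin (u * x)) / 2)).
Proof.
elim: N phi => [|N IH] phi /=; first exact: trigp_cst.
pose f x := bern N phi ((1 + sin (u * x)) / 2).
pose g x := bern N (phi \o S) ((1 + sin (u * x)) / 2).
have -> : (fun x => (1 - (1 + sin (u * x)) / 2) * bern N phi ((1 + sin (u * x)) / 2) +
    (1 + sin (u * x)) / 2 * bern N (phi \o S) ((1 + sin (u * x)) / 2)) =
  fun x => 1 * (2^-1 * f x + 2^-1 * g x) +
    2^-1 * (1 * (sin (u * x) * g x) + (- 1) * (sin (u * x) * f x)).
  by apply/funext => x; rewrite /f /g; field.
have tf : trigp f by exact: IH. have tg : trigp g by exact: IH.
by apply: trigp_comb; apply: trigp_comb => //; exact: trigp_sinM.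
Qed.

(* [f] is replaced by [x |-> f (L sin (x / L))], which agrees with [f] on compact sets up to a small
   error when [L] is large, and whose argument never exceeds [x]. *)
Lemma trigp_approx (f : R -> R) (C b c e : R) : continuous f -> 0 <= b -> b < c ->
  (forall x, `|f x| <= C * expR (b / 2 * x ^+ 2)) -> 0 < e ->
  exists2 T, trigp T & forall x, `|f x - T x| <= e * expR (c / 2 * x ^+ 2).
Proof.
move=> cf b0 bc fC e0.
have C0 : 0 <= C by have := le_trans (normr_ge0 _) (fC 0); rewrite expr0n mulr0 expR0 mulr1.
have e4 : 0 < e / 4 by rewrite divr_gt0.
have cb : 0 < c - b by rewrite subr_gt0.
(* Beyond A the ratio exp((c - b) x^2 / 2) >= (c - b) A / 2 of the two weights is at least 4 C / e,
   so the target weight absorbs both f and its substitute. *)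
pose A := 1 + 8 * C / (e * (c - b)).
have k0 : 0 <= 8 * C / (e * (c - b)) by rewrite divr_ge0 ?mulr_ge0// ltW.
have A1 : 1 <= A by rewrite lerDl.
have A0 : 0 < A by exact: lt_le_trans A1.
have tail x : A < `|x| -> 2 * C * expR (b / 2 * x ^+ 2) <= e / 2 * expR (c / 2 * x ^+ 2).
  move=> Ax; have -> : c / 2 * x ^+ 2 = b / 2 * x ^+ 2 + (c - b) / 2 * x ^+ 2 by ring.
  rewrite expRD mulrA -subr_ge0.
  have -> : e / 2 * expR (b / 2 * x ^+ 2) * expR ((c - b) / 2 * x ^+ 2) - 2 * C * expR (b / 2 * x ^+ 2)
    = expR (b / 2 * x ^+ 2) * (e / 2 * expR ((c - b) / 2 * x ^+ 2) - 2 * C) by ring.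
  rewrite mulr_ge0 ?expR_ge0// subr_ge0.
  have x2 : A <= x ^+ 2.
    rewrite -[leRHS]real_normK ?num_real//; apply: (le_trans (ltW Ax)).
    rewrite expr2 ler_peMr//; exact: le_trans A1 (ltW Ax).
  apply: (@le_trans _ _ (e / 2 * ((c - b) / 2 * A))); last first.
    rewrite ler_pM2l ?divr_gt0//; apply: le_trans (expR_ge1Dx _).
    by apply: ler_wpDl => //; rewrite ler_pM2l ?divr_gt0.
  have -> : e / 2 * ((c - b) / 2 * A) = e / 2 * ((c - b) / 2) + 2 * C.
    by rewrite /A; field; rewrite !gt_eqF.
  by rewrite lerDr ltW// mulr_gt0 ?divr_gt0.
have [d d0 Hd] := uniform_continuity A cf e4.
(* On [- A, A], |x - g x| <= |x|^3 / (2 L^2), and L >= 1 with d L > A^3 makes this less than d. *)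
pose L := 1 + A ^+ 3 / d.
have L1 : 1 <= L by rewrite lerDl divr_ge0 ?exprn_ge0// ltW.
have L0 : 0 < L by exact: lt_le_trans L1.
pose g x := L * sin (L^-1 * x).
have gx x : `|g x| <= `|x|.
  rewrite /g normrM (gtr0_norm L0) -ler_pdivlMl//; apply: (le_trans (norm_sin_le _)).
  by rewrite normrM gtr0_norm ?invr_gt0.
have gd x : - A <= x <= A -> `|x - g x| < d.
  move=> xA; have xA' : `|x| <= A by rewrite ler_norml.
  have -> : x - g x = L * (L^-1 * x - sin (L^-1 * x)).
    by rewrite /g mulrBr mulVKf// gt_eqF.
  rewrite normrM (gtr0_norm L0).
  apply: (@le_lt_trans _ _ (L * (`|L^-1 * x| ^+ 3 / 2))).
    by rewrite ler_pM2l// norm_sub_sin_le.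
  have -> : L * (`|L^-1 * x| ^+ 3 / 2) = `|x| ^+ 3 / (2 * L ^+ 2).
    by rewrite normrM gtr0_norm ?invr_gt0//; field; rewrite gt_eqF.
  have A3 : `|x| ^+ 3 <= A ^+ 3 by rewrite lerXn2r ?nnegrE// ltW.
  have dL : A ^+ 3 < d * L.
    by rewrite /L mulrDr mulr1 mulrC divfK ?gt_eqF// ltrDr.
  have L2 : d * L <= d * L ^+ 2 by rewrite ler_pM2l// expr2 ler_peMr// ltW.
  have dL0 : 0 < d * L ^+ 2 by rewrite mulr_gt0 ?exprn_gt0.
  rewrite ltr_pdivrMr ?mulr_gt0 ?exprn_gt0//; lra.
have ch : continuous (fun y : R => f (L * (2 * y - 1))).
  move=> y; apply: (@continuous_comp _ _ _ (fun y : R => L * (2 * y - 1)) f); last exact: cf.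
  apply: cvgM; first exact: cvg_cst.
  by apply: cvgB; [apply: cvgM; [exact: cvg_cst|exact: cvg_id]|exact: cvg_cst].
have [N HN] := bernstein ch e4.
pose T x := bern N (fun k => f (L * (2 * (k%:R / N%:R) - 1))) ((1 + sin (L^-1 * x)) / 2).
exists T => [|x]; first exact: trigp_bern.
have fgT : `|f (g x) - T x| <= e / 4.
  have -> : f (g x) = f (L * (2 * ((1 + sin (L^-1 * x)) / 2) - 1)).
    by congr f; rewrite /g; field.
  apply: HN; have := sin_geN1 (L^-1 * x); have := sin_le1 (L^-1 * x) => s1 s2.
  by apply/andP; split; lra.
have ec1 : 1 <= expR (c / 2 * x ^+ 2).
  by rewrite -[leLHS]expR0 ler_expR mulr_ge0 ?sqr_ge0 ?divr_ge0// ltW// (le_lt_trans b0).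
have ee : e <= e * expR (c / 2 * x ^+ 2) by rewrite ler_peMr// ltW.
have split3 : `|f x - T x| <= `|f x - f (g x)| + `|f (g x) - T x|.
  have -> : f x - T x = (f x - f (g x)) + (f (g x) - T x) by ring.
  exact: ler_normD.
have [xA|xA] := leP `|x| A.
  have xA' : - A <= x <= A by rewrite -ler_norml.
  by have := Hd x (g x) xA' (gd x xA'); lra.
have h1 := fC x; have h2 := fC (g x); have h3 := tail x xA.
have h4 : C * expR (b / 2 * g x ^+ 2) <= C * expR (b / 2 * x ^+ 2).
  rewrite ler_wpM2l// ler_expR ler_wpM2l ?divr_ge0//.
  by rewrite -[leLHS]real_normK ?num_real// -[leRHS]real_normK ?num_real// lerXn2r ?nnegrE.
have := ler_normB (f x) (f (g x)); lra.
Qed.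

End approximation.

(** * Convergence of functionals under Gaussian domination *)

Section gaussian_dominated_functionals.
Context (R : realType) (c : R).

Definition gdom (f : R -> R) :=
  measurable_fun setT f /\ exists C, forall x, `|f x| <= C * expR (c / 2 * x ^+ 2).

(** A linear functional bounded by K in the norm sup |f(x)| exp(- c x^2 / 2), expressed through
    differences so that no norm has to be formed. *)
Definition gfun (K : R) (L : (R -> R) -> R) :=
  (forall a b f g, gdom f -> gdom g ->
     L (fun x => a * f x + b * g x) = a * L f + b * L g) /\
  (forall f g e, gdom f -> gdom g -> 0 <= e ->
     (forall x, `|f x - g x| <= e * expR (c / 2 * x ^+ 2)) -> `|L f - L g| <= e * K).

Lemma gfun_le K K' L : K <= K' -> gfun K L -> gfun K' L.
Proof.
move=> KK' [Llin Lbnd]; split=> // f g e df dg e0 fg.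
by apply: (le_trans (Lbnd f g e df dg e0 fg)); rewrite ler_wpM2l.
Qed.

Lemma gdom_comb a b f g : gdom f -> gdom g -> gdom (fun x => a * f x + b * g x).
Proof.
move=> [mf [A fA]] [mg [B gB]]; split.
  by apply: measurable_funD; apply: measurable_funM.
exists (`|a| * A + `|b| * B) => x; rewrite (le_trans (ler_normD _ _))// !normrM mulrDl.
by apply: lerD; rewrite -[leRHS]mulrA ler_wpM2l.
Qed.

Lemma gdom_trigp T : 0 <= c -> trigp T -> gdom T.
Proof.
move=> c0; elim=> [s a|a b f g _ gf _ gg]; last exact: gdom_comb.
split.
  apply: continuous_measurable_fun => x.
  apply: (@continuous_comp _ _ _ (fun x : R => s * x + a) cos); last exact: continuous_cos.
  by apply: cvgD; [apply: cvgM; [exact: cvg_cst|exact: cvg_id]|exact: cvg_cst].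
exists 1 => x; rewrite mul1r (le_trans (cos_max _))// -[leLHS]expR0 ler_expR.
by rewrite mulr_ge0 ?sqr_ge0 ?divr_ge0.
Qed.

(** Functionals with a common bound that converge on a dense class converge on its closure; the
    strict gap b < c puts unbounded f in the closure of the trigonometric polynomials. *)
Lemma gfun_cvg (K : R) (L : nat -> (R -> R) -> R) (L0 : (R -> R) -> R) (f : R -> R) (C b : R) :
  0 <= K -> (forall n, gfun K (L n)) -> gfun K L0 ->
  (forall s a, (fun n => L n (fun x => cos (s * x + a))) @ \oo --> L0 (fun x => cos (s * x + a))) ->
  continuous f -> 0 <= b -> b < c -> (forall x, `|f x| <= C * expR (b / 2 * x ^+ 2)) ->
  (fun n => L n f) @ \oo --> L0 f.
Proof.
move=> K0 HL HL0 Hcos cf b0 bc fC.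
have c0 : 0 <= c by exact: le_trans b0 (ltW bc).
have HT T : trigp T -> (fun n => L n T) @ \oo --> L0 T.
  elim=> [s a|a1 a2 g h tg cg th ch]; first exact: Hcos.
  have dg := gdom_trigp c0 tg; have dh := gdom_trigp c0 th.
  have -> : L0 (fun x => a1 * g x + a2 * h x) = a1 * L0 g + a2 * L0 h by exact: HL0.1.
  have -> : (fun n => L n (fun x => a1 * g x + a2 * h x)) = fun n => a1 * L n g + a2 * L n h.
    by apply/funext => n; exact: (HL n).1.
  by apply: cvgD; apply: cvgM => //; exact: cvg_cst.
have df : gdom f.
  split; first exact: continuous_measurable_fun.
  exists C => x; apply: (le_trans (fC x)).
  have C0 : 0 <= C by have := le_trans (normr_ge0 _) (fC 0); rewrite expr0n mulr0 expR0 mulr1.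
  by rewrite ler_wpM2l// ler_expR ler_wpM2r ?sqr_ge0// ler_wpM2r ?invr_ge0// ltW.
apply/cvgrPdist_le => e e0; pose d := e / (3 * (K + 1)).
have K1 : 0 < 3 * (K + 1) by rewrite mulr_gt0// ltr_wpDl.
have d0 : 0 < d by rewrite divr_gt0.
have dK : d * K <= e / 3.
  have -> : e / 3 = d * (K + 1) by rewrite /d; field; rewrite gt_eqF// ltr_wpDl.
  by rewrite ler_pM2l// lerDl.
have [T tT HfT] := trigp_approx cf b0 bc fC d0.
have dT := gdom_trigp c0 tT.
have e3 : 0 < e / 3 by rewrite divr_gt0.
have /cvgrPdist_le/(_ _ e3) nT := HT T tT.
near=> n.
have h1 : `|L0 T - L n T| <= e / 3 by near: n.
have h2 := HL0.2 f T d df dT (ltW d0) HfT.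
have h3 := (HL n).2 f T d df dT (ltW d0) HfT.
have -> : L0 f - L n f = (L0 f - L0 T) + (L0 T - L n T) - (L n f - L n T) by ring.
apply: (le_trans (ler_normB _ _)); apply: (le_trans (lerD (ler_normD _ _) (lexx _))); lra.
Unshelve. all: by end_near. Qed.

(** One criterion for both sides of the limit: the model of size n, with a normalized magnetization
    for Y, and the Gaussian integral, with the identity. *)
Lemma wint_gfun d (T : measurableType d) (mu : {measure set T -> \bar R}) (w Y : T -> R) (K : R) :
  measurable_fun setT w -> measurable_fun setT Y -> (forall t, 0 <= w t) ->
  (\int[mu]_t (w t * expR (c / 2 * Y t ^+ 2))%:E <= K%:E)%E ->
  gfun K (fun g => \int[mu]_t (w t * g (Y t))).
Proof.
move=> mw mY w0 HK; pose E t := w t * expR (c / 2 * Y t ^+ 2).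
have E0 t : 0 <= E t by rewrite mulr_ge0 ?expR_ge0.
have mE : measurable_fun setT E.
  by apply: measurable_funM => //; exact: (measurableT_comp (measurable_quad (c / 2)) mY).
have iE : mu.-integrable setT (EFin \o E).
  apply/integrableP; split; first exact/measurable_EFinP.
  under eq_integral do rewrite gee0_abs ?lee_fin//.
  by rewrite (le_lt_trans HK)// ltry.
have EK : \int[mu]_t E t <= K.
  rewrite -lee_fin /Rintegral fineK//; exact: integrable_fin_num.
have iw g : gdom g -> mu.-integrable setT (EFin \o (fun t => w t * g (Y t))).
  move=> [mg [C gC]].
  apply: (@le_integrable _ _ _ _ _ measurableT _ (fun t => C%:E * (E t)%:E)%E).
  - by apply/measurable_EFinP; apply: measurable_funM => //; exact: (measurableT_comp mg mY).
  - move=> t _ /=; rewrite lee_fin normrM (ger0_norm (w0 t)) normrM (ger0_norm (E0 t)).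
    rewrite /E mulrCA ler_wpM2l// (le_trans (gC _))// ler_wpM2r ?expR_ge0// ler_norm//.
  - exact: integrableZl.
split=> [a b f g df dg|f g e df dg e0 fg].
  rewrite -!RintegralZl//; [|exact: iw|exact: iw].
  rewrite -RintegralD//; last 2 first.
  - exact: (integrableZl measurableT a (iw f df)).
  - exact: (integrableZl measurableT b (iw g dg)).
  by apply: eq_Rintegral => t _; ring.
rewrite -RintegralB//; [|exact: iw|exact: iw].
have ifg := integrableB measurableT (iw _ df) (iw _ dg).
apply: (le_trans (le_normr_Rintegral measurableT ifg)).
apply: (@le_trans _ _ (\int[mu]_t (e * E t))); last first.
  by rewrite RintegralZl// ler_wpM2l.
apply: le_Rintegral => //.
- exact: (integrable_abse ifg).
- exact: (integrableZl measurableT e iE).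
- move=> t _; rewrite -mulrBr normrM (ger0_norm (w0 t)) /E mulrCA ler_wpM2l//.
Qed.

End gaussian_dominated_functionals.

(** * The self-normalized central limit theorem *)

Section elementary.
Context (R : realType).

Lemma norm_subX_le n (x y : R) : `|x| <= 1 -> `|y| <= 1 -> `|x ^+ n - y ^+ n| <= n%:R * `|x - y|.
Proof.
move=> x1 y1; elim: n => [|n IH]; first by rewrite !expr0 subrr normr0 mul0r.
have -> : x ^+ n.+1 - y ^+ n.+1 = x * (x ^+ n - y ^+ n) + (x - y) * y ^+ n by rewrite !exprS; ring.
apply: (le_trans (ler_normD _ _)); rewrite !normrM.
have -> : n.+1%:R * `|x - y| = n%:R * `|x - y| + `|x - y| by rewrite -natr1; ring.
apply: lerD.
  by apply: le_trans IH; rewrite ler_piMl.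
by rewrite ler_piMr// normrX exprn_ile1.
Qed.

(** On [-1, 1] taking n-th powers multiplies distances by at most n, so an error of order n^-2
    against exp(- c / n) leaves one of order n^-1. *)
Lemma exp_limit (a : nat -> R) (c D : R) : 0 <= c -> (forall n, `|a n| <= 1) ->
  (forall n, (0 < n)%N -> `|a n - (1 - c / n%:R)| <= D / n%:R ^+ 2) ->
  (fun n => a n ^+ n) @ \oo --> expR (- c).
Proof.
move=> c0 a1 H.
have bnd n : (0 < n)%N -> `|expR (- c) - a n ^+ n| <= (D + c ^+ 2) * n%:R^-1.
  move=> n0; have n0' : 0 < n%:R :> R by rewrite ltr0n.
  have cn : 0 <= c / n%:R by rewrite divr_ge0.
  have -> : expR (- c) = expR (- (c / n%:R)) ^+ n.
    by rewrite -expRM_natl; congr expR; field; rewrite gt_eqF.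
  have e1 : `|expR (- (c / n%:R))| <= 1.
    by rewrite ger0_norm ?expR_ge0// -[leRHS]expR0 ler_expR oppr_le0.
  apply: (le_trans (norm_subX_le n e1 (a1 n))).
  have h1 := expRN_taylor cn; have h2 := H n n0.
  have -> : (D + c ^+ 2) * n%:R^-1 = n%:R * (D / n%:R ^+ 2 + (c / n%:R) ^+ 2).
    by field; rewrite gt_eqF.
  rewrite ler_pM2l//.
  have -> : expR (- (c / n%:R)) - a n =
    (expR (- (c / n%:R)) - 1 + c / n%:R) - (a n - (1 - c / n%:R)) by ring.
  by apply: (le_trans (ler_normB _ _)); lra.
apply/cvgrPdist_le => e e0.
near=> n; have n0 : (0 < n)%N by near: n; exact: nbhs_infty_gt.
apply: (le_trans (bnd n n0)); rewrite ler_pdivrMr ?ltr0n// mulrC -ler_pdivrMr//.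
by near: n; exact: near_nat_ge.
Unshelve. all: by end_near. Qed.

Lemma norm_expRN_sub (a b : R) : 0 <= a -> 0 <= b -> `|expR (- a) - expR (- b)| <= `|a - b|.
Proof.
move=> a0 b0; wlog ab : a b a0 b0 / a <= b.
  by move=> W; have [/W|/ltW/W] := leP a b; [exact|rewrite distrC (distrC a); exact].
have e1 := expR_ge1Dx (a - b).
have e2 : expR (- b) = expR (- a) * expR (a - b) by rewrite -expRD; congr expR; ring.
have ea : expR (- a) <= 1 by rewrite -[leRHS]expR0 ler_expR oppr_le0.
have eab : expR (a - b) <= 1 by rewrite -[leRHS]expR0 ler_expR subr_le0.
have -> : `|a - b| = b - a by rewrite distrC ger0_norm// subr_ge0.
have -> : expR (- a) - expR (- b) = expR (- a) * (1 - expR (a - b)) by rewrite e2; ring.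
rewrite ger0_norm ?mulr_ge0 ?expR_ge0 ?subr_ge0//.
apply: (@le_trans _ _ (1 - expR (a - b))); last by lra.
by rewrite ler_piMl// subr_ge0.
Qed.

Lemma norm_cos_sub (x y : R) : `|cos x - cos y| <= `|x - y|.
Proof.
pose u := (x + y) / 2; pose v := (x - y) / 2.
have -> : cos x - cos y = - 2 * (sin u * sin v).
  have -> : x = u + v by rewrite /u /v; field.
  have -> : y = u - v by rewrite /u /v; field.
  by rewrite cosD cosB; ring.
have -> : `|x - y| = 2 * `|v| by rewrite /v normrM [`|2^-1|]gtr0_norm// mulrC divfK.
rewrite normrM normrN (@ger0_norm _ 2)// ler_pM2l// normrM.
by apply: le_trans (norm_sin_le v); rewrite ler_piMl ?sin_max.
Qed.

Lemma near1_inv (p N e : R) : 1 <= p -> 0 <= N -> 0 < e -> e <= 1 / 2 ->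
  1 - e <= powR N p <= 1 + e -> 0 < N /\ `|N^-1 - 1| <= 2 * e.
Proof.
move=> p1 N0 e0 e2 /andP[l u].
have p0 : 0 < p by exact: lt_le_trans p1.
have Npos : 0 < N.
  rewrite lt0r N0 andbT; apply/eqP => NE; move: l; rewrite NE powR0 ?gt_eqF//; lra.
have lo : 1 - e <= N.
  have [N1|N1] := leP 1 N; first by lra.
  apply: (le_trans l); rewrite -[leRHS](powRr1 N0); apply: ger_powR => //.
  by rewrite Npos ltW.
have up : N <= 1 + e.
  have [N1|N1] := leP N 1; first by lra.
  by apply: le_trans u; rewrite -[leLHS](powRr1 N0); apply: ler_powR => //; exact: ltW.
split=> //.
have -> : N^-1 - 1 = (1 - N) / N by field; rewrite gt_eqF.
rewrite normrM (@gtr0_norm _ N^-1) ?invr_gt0// ler_pdivrMr//.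
have h : `|1 - N| <= e by rewrite ler_norml; apply/andP; split; lra.
apply: (le_trans h); rewrite -[leLHS]mulr1 mulrAC -subr_ge0.
have -> : 2 * N * e - e * 1 = e * (2 * N - 1) by ring.
by rewrite mulr_ge0// ?(ltW e0)//; lra.
Qed.

End elementary.

(** * Damped characteristic functions of independent coordinates *)

Section trigonometric_moments.
Context (R : realType) (p : R).
Hypothesis hp : 2 <= p.
Local Notation P := (density_prob (rho_density hp)).
Local Notation En := (En hp).
Local Notation M := (mom p 1).

Let p0 : 0 < p. Proof. by apply: lt_le_trans hp. Qed.

Lemma bounded_RI (g : R -> R) (C : R) : measurable_fun setT g -> (forall x, `|g x| <= C) ->
  P.-integrable setT (EFin \o g).
Proof.
by move=> mg gC; apply: (bounded_integrable P (M := C)) => [|x]; [exact/measurable_EFinP|rewrite lee_fin; exact: gC].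
Qed.

Lemma Rintegral_odd (g : R -> R) : measurable_fun setT g -> (forall x, g (- x) = - g x) ->
  P.-integrable setT (EFin \o g) -> \int[P]_x g x = 0.
Proof.
move=> mg gN ig.
have mg' : measurable_fun setT (EFin \o g) by exact/measurable_EFinP.
have E : \int[P]_x g (- x) = \int[P]_x g x.
  have Ep := integral_opp hp (measurable_funepos mg') (fun x => funepos_ge0 (EFin \o g) x).
  have En := integral_opp hp (measurable_funeneg mg') (fun x => funeneg_ge0 (EFin \o g) x).
  rewrite /Rintegral; congr fine; rewrite [LHS]integralE [RHS]integralE -Ep -En.
  by congr (_ - _)%E; apply: eq_integral => x _; rewrite ?funeposE ?funenegE.
have E2 : \int[P]_x g (- x) = - \int[P]_x g x.
  rewrite -mulN1r -RintegralZl//; apply: eq_Rintegral => x _; by rewrite gN mulN1r.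
by move: E2; rewrite E; move: (\int[P]_x g x) => I; lra.
Qed.

(** With k = beta / (2 n), the damping is the share of one coordinate in the diagonal factor before
    normalization. *)
Definition tmom (k t : R) : R := \int[P]_x (expR (- (k * x ^+ 2)) * cos (t * x)).

Lemma measurable_damp k : measurable_fun setT (fun x : R => expR (- (k * x ^+ 2))).
Proof. by under eq_fun do rewrite -mulNr; exact: measurable_quad. Qed.

Lemma measurable_cosD t a : measurable_fun setT (fun x : R => cos (t * x + a)).
Proof.
apply: continuous_measurable_fun => x.
apply: (@continuous_comp _ _ _ (fun x : R => t * x + a) cos); last exact: continuous_cos.
by apply: cvgD; [apply: cvgM; [exact: cvg_cst|exact: cvg_id]|exact: cvg_cst].
Qed.

Lemma damp_le1 k (x : R) : 0 <= k -> expR (- (k * x ^+ 2)) <= 1.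
Proof. by move=> k0; rewrite -[leRHS]expR0 ler_expR oppr_le0 mulr_ge0 ?sqr_ge0. Qed.

Lemma damp_bounded k (g : R -> R) x : 0 <= k -> (forall x, `|g x| <= 1) ->
  `|expR (- (k * x ^+ 2)) * g x| <= 1.
Proof.
by move=> k0 g1; rewrite normrM ger0_norm ?expR_ge0// mulr_ile1 ?expR_ge0 ?damp_le1.
Qed.

Lemma measurable_sinM t : measurable_fun setT (fun x : R => sin (t * x)).
Proof.
apply: continuous_measurable_fun => x.
apply: (@continuous_comp _ _ _ (fun x : R => t * x) sin); last exact: continuous_sin.
by apply: cvgM; [exact: cvg_cst|exact: cvg_id].
Qed.

Lemma measurable_cosM t : measurable_fun setT (fun x : R => cos (t * x)).
Proof. by have := measurable_cosD t 0; under eq_fun do rewrite addr0. Qed.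

(** [rho] is even, so the sine part of the shifted cosine integrates to zero. *)
Lemma tmom_phase k t a : 0 <= k ->
  \int[P]_x (expR (- (k * x ^+ 2)) * cos (t * x + a)) = cos a * tmom k t.
Proof.
move=> k0; pose C x := expR (- (k * x ^+ 2)) * cos (t * x).
pose S x := expR (- (k * x ^+ 2)) * sin (t * x).
have mC : measurable_fun setT C.
  by apply: measurable_funM; [exact: measurable_damp|exact: measurable_cosM].
have mS : measurable_fun setT S.
  by apply: measurable_funM; [exact: measurable_damp|exact: measurable_sinM].
have iC : P.-integrable setT (EFin \o C).
  by apply: (bounded_RI (C := 1)) => // x; apply: (damp_bounded (g := fun x => cos (t * x))) => // y; exact: cos_max.
have iS : P.-integrable setT (EFin \o S).
  by apply: (bounded_RI (C := 1)) => // x; apply: (damp_bounded (g := fun x => sin (t * x))) => // y; exact: sin_max.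
have S0 : \int[P]_x S x = 0.
  by apply: Rintegral_odd => // x; rewrite /S sqrrN mulrN sinN mulrN.
transitivity (\int[P]_x (cos a * C x - sin a * S x)).
  by apply: eq_Rintegral => x _; rewrite cosD /C /S; ring.
rewrite RintegralB//; last 2 first.
- exact: (integrableZl measurableT (cos a) iC).
- exact: (integrableZl measurableT (sin a) iS).
by rewrite RintegralZl// RintegralZl// S0 mulr0 subr0.
Qed.

Lemma tmom_le1 k t : 0 <= k -> `|tmom k t| <= 1.
Proof.
move=> k0; pose C x := expR (- (k * x ^+ 2)) * cos (t * x).
have mC : measurable_fun setT C.
  by apply: measurable_funM; [exact: measurable_damp|exact: measurable_cosM].
have C1 x : `|C x| <= 1 by apply: (damp_bounded (g := fun x => cos (t * x))) => // y; exact: cos_max.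
have iC : P.-integrable setT (EFin \o C) by exact: (bounded_RI (C := 1)).
apply: (le_trans (le_normr_Rintegral measurableT iC)).
apply: (@le_trans _ _ (\int[P]_x 1)); last first.
  by rewrite Rintegral_cst//= probability_setT mulr1.
apply: le_Rintegral => //; first exact: (integrable_abse iC).
by apply: (bounded_RI (C := 1)) => // x; rewrite normr1.
Qed.

Lemma integrable_even k : P.-integrable setT (EFin \o (fun x : R => x ^+ k.*2)).
Proof.
apply/integrableP; split; first by apply/measurable_EFinP; exact: measurable_funX.
under eq_integral do rewrite gee0_abs ?lee_fin ?exprn_double_ge0//.
by rewrite integral_even ltry.
Qed.

Lemma tmom_taylor k t : 0 <= k ->
  `|tmom k t - (1 - (t ^+ 2 / 2 + k) * M)| <= 2 * (k ^+ 2 + t ^+ 4) * mom p 2.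
Proof.
move=> k0; pose C x := expR (- (k * x ^+ 2)) * cos (t * x).
have mC : measurable_fun setT C.
  by apply: measurable_funM; [exact: measurable_damp|exact: measurable_cosM].
have iC : P.-integrable setT (EFin \o C).
  by apply: (bounded_RI (C := 1)) => // x; apply: (damp_bounded (g := fun x => cos (t * x))) => // y; exact: cos_max.
have i1 : P.-integrable setT (EFin \o (fun=> 1 : R)).
  by apply: (bounded_RI (C := 1)) => // x; rewrite normr1.
pose g := t ^+ 2 / 2 + k.
have i2 : P.-integrable setT (EFin \o (fun x => g * x ^+ 1.*2)).
  exact: (integrableZl measurableT g (integrable_even 1)).
have i4 : P.-integrable setT (EFin \o (fun x => 2 * (k ^+ 2 + t ^+ 4) * x ^+ 2.*2)).
  exact: (integrableZl measurableT _ (integrable_even 2)).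
have iC1 := integrableB measurableT iC i1.
have iD : P.-integrable setT (EFin \o (fun x => C x - 1 + g * x ^+ 1.*2)).
  exact: (integrableD measurableT iC1 i2).
have E (j : nat) : \int[P]_x (x ^+ j.*2) = mom p j by rewrite /Rintegral integral_even.
have -> : tmom k t - (1 - g * M) = \int[P]_x (C x - 1 + g * x ^+ 1.*2).
  rewrite RintegralD// RintegralB// RintegralZl//; last exact: integrable_even.
  rewrite E Rintegral_cst//= probability_setT /tmom/=; ring.
apply: (le_trans (le_normr_Rintegral measurableT iD)).
rewrite -E -RintegralZl//; last exact: integrable_even.
apply: le_Rintegral => //; first exact: (integrable_abse iD).
move=> x _; have kx : 0 <= k * x ^+ 2 by rewrite mulr_ge0 ?sqr_ge0.
have := cos_expRN_taylor (t * x) kx.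
have -> : cos (t * x) * expR (- (k * x ^+ 2)) - 1 + (t * x) ^+ 2 / 2 + k * x ^+ 2 =
  C x - 1 + g * x ^+ 1.*2.
  have -> : x ^+ 1.*2 = x ^+ 2 by [].
  by rewrite /C /g exprMn; ring.
have -> : 2 * ((k * x ^+ 2) ^+ 2 + (t * x) ^+ 4) = 2 * (k ^+ 2 + t ^+ 4) * x ^+ 4 by ring.
by [].
Qed.

(* [1 + cos] keeps the integrand nonnegative, so that Tonelli applies to one coordinate at a time. *)
Lemma En_trig n k t a : 0 <= k ->
  En n (fun s => expR (- (k * \sum_(x <- s) x ^+ 2)) * (1 + cos (t * (\sum_(x <- s) x) + a))) =
  (tmom k 0 ^+ n + cos a * tmom k t ^+ n)%:E.
Proof.
move=> k0; pose F a s := expR (- (k * \sum_(x <- s) x ^+ 2)) * (1 + cos (t * (\sum_(x <- s) x) + a)).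
have mF b : mseq (F b).
  have m1 : mseq (fun s : seq R => \sum_(x <- s) x ^+ 2) by apply: mseq_sum; exact: measurable_funX.
  have m2 : mseq (fun s : seq R => \sum_(x <- s) x) by exact: (@mseq_sum R id).
  apply: mseqM.
    apply: (mseq_comp (g := fun y => expR (- (k * y)))) m1.
    by apply: measurableT_comp => //; apply: measurableT_comp => //; exact: measurable_funM.
  apply: (mseq_comp (g := fun y => 1 + cos (t * y + b))) m2.
  by apply: measurable_funD => //; exact: measurable_cosD.
have F0 b s : 0 <= F b s.
  by rewrite mulr_ge0 ?expR_ge0//; have := cos_geN1 (t * (\sum_(x <- s) x) + b); lra.
rewrite -/(F a); elim: n a => [|n IH] a.
  by rewrite En0// /F !big_nil !mulr0 oppr0 expR0 mul1r add0r !expr0 mulr1.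
rewrite EnS//.
pose G x := expR (- (k * x ^+ 2)) * (tmom k 0 ^+ n) + tmom k t ^+ n * (expR (- (k * x ^+ 2)) * cos (t * x + a)).
transitivity (\int[P]_x (G x)%:E)%E.
  apply: eq_integral => x _.
  have -> : En n (fun s => F a (x :: s)) = En n (fun s => expR (- (k * x ^+ 2)) * F (t * x + a) s).
    apply: eq_En => s _; rewrite /F !big_cons mulrA -expRD; congr (expR _ * (1 + cos _)); ring.
  rewrite EnZ ?expR_ge0// IH -EFinM /G; congr EFin; ring.
have mD := measurable_damp k.
have i1 : P.-integrable setT (EFin \o (fun x => expR (- (k * x ^+ 2)))).
  by apply: (bounded_RI (C := 1)) => // x; rewrite ger0_norm ?expR_ge0 ?damp_le1.
have i2 : P.-integrable setT (EFin \o (fun x => expR (- (k * x ^+ 2)) * cos (t * x + a))).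
  apply: (bounded_RI (C := 1)); first by apply: measurable_funM => //; exact: measurable_cosD.
  move=> x; rewrite normrM ger0_norm ?expR_ge0// mulr_ile1 ?expR_ge0 ?damp_le1 ?cos_max//.
have j1 := integrableZr measurableT (tmom k 0 ^+ n) i1.
have j2 := integrableZl measurableT (tmom k t ^+ n) i2.
have iG : P.-integrable setT (EFin \o G) by exact: (integrableD measurableT j1 j2).
rewrite -[LHS]fineK; last exact: (integrable_fin_num measurableT iG).
congr EFin; rewrite -/(Rintegral P setT G) /G RintegralD// RintegralZr// RintegralZl//.
rewrite tmom_phase// !exprS.
have -> : \int[P]_x expR (- (k * x ^+ 2)) = tmom k 0.
  by apply: eq_Rintegral => x _; rewrite mul0r cos0 mulr1.
ring.
Qed.

(** At scale k / n the damping tends to the constant exp(- k M), a law of large numbers for the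
    squares, and so factors out of the Gaussian limit. *)
Lemma trig_cvg (k t a : R) : 0 <= k ->
  (fun n : nat => tmom (k / n%:R) 0 ^+ n + cos a * tmom (k / n%:R) (t / Num.sqrt n%:R) ^+ n) @ \oo -->
  expR (- (k * M)) * (1 + cos a * expR (- (t ^+ 2 * M / 2))).
Proof.
move=> k0; have M0 := ltW (mom_gt0 hp 1).
have H s : (fun n : nat => tmom (k / n%:R) (s / Num.sqrt n%:R) ^+ n) @ \oo -->
    expR (- ((s ^+ 2 / 2 + k) * M)).
  apply: (@exp_limit _ _ _ (2 * (k ^+ 2 + s ^+ 4) * mom p 2)).
  - by rewrite mulr_ge0// addr_ge0// divr_ge0 ?sqr_ge0.
  - by move=> n; rewrite tmom_le1// divr_ge0.
  - move=> n n0; have n0' : 0 < n%:R :> R by rewrite ltr0n.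
    have kn : 0 <= k / n%:R by rewrite divr_ge0.
    have s2 : (s / Num.sqrt n%:R) ^+ 2 = s ^+ 2 / n%:R by rewrite exprMn exprVn sqr_sqrtr// ltW.
    have := tmom_taylor (s / Num.sqrt n%:R) kn.
    have -> : (s / Num.sqrt n%:R) ^+ 4 = s ^+ 4 / n%:R ^+ 2.
      by rewrite (exprM _ 2 2) s2 exprMn exprVn -exprM.
    rewrite s2.
    have -> : (s ^+ 2 / n%:R / 2 + k / n%:R) * M = (s ^+ 2 / 2 + k) * M / n%:R.
      by field; rewrite gt_eqF.
    have -> // : 2 * ((k / n%:R) ^+ 2 + s ^+ 4 / n%:R ^+ 2) * mom p 2 =
      2 * (k ^+ 2 + s ^+ 4) * mom p 2 / n%:R ^+ 2.
    by field; rewrite gt_eqF.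
have -> : expR (- (k * M)) * (1 + cos a * expR (- (t ^+ 2 * M / 2))) =
    expR (- ((0 ^+ 2 / 2 + k) * M)) + cos a * expR (- ((t ^+ 2 / 2 + k) * M)).
  have -> : (t ^+ 2 / 2 + k) * M = k * M + t ^+ 2 * M / 2 by field.
  by rewrite expr0n mul0r add0r opprD expRD; ring.
apply: cvgD; last by apply: cvgM; [exact: cvg_cst|exact: H].
by have := H 0; under eq_fun do rewrite mul0r.
Qed.

End trigonometric_moments.

(** * Passage from independent to normalized coordinates *)

Section self_normalized_clt.
Context (R : realType) (p : R).
Hypothesis hp : 2 <= p.
Local Notation P := (density_prob (rho_density hp)).
Local Notation Pn n := (tuple_prob P n).
Local Notation En := (En hp).
Local Notation M := (mom p 1).
Local Notation mh := (mh p).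

Let p0 : 0 < p. Proof. by apply: lt_le_trans hp. Qed.

Definition hat_trig (beta : R) (n : nat) (t a : R) (s : seq R) : R :=
  diag_weight p beta s * (1 + cos (t * (Num.sqrt n%:R * mh s) + a)).

(** The statistic [hat_trig] with the norm replaced by its typical value 1, so that independence of
    the coordinates can be used. *)
Definition raw_trig (beta : R) (n : nat) (t a : R) (s : seq R) : R :=
  expR (- (beta / 2 / n%:R * \sum_(x <- s) x ^+ 2)) *
  (1 + cos (t / Num.sqrt n%:R * (\sum_(x <- s) x) + a)).

Lemma cos1_bounds (x : R) : 0 <= 1 + cos x <= 2.
Proof. by have := cos_geN1 x; have := cos_le1 x => ? ?; apply/andP; split; lra. Qed.

Lemma mseq_cos1 (t a : R) (F : seq R -> R) : mseq F -> mseq (fun s => 1 + cos (t * F s + a)).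
Proof.
move=> mF; apply: (mseq_comp (g := fun y => 1 + cos (t * y + a))) mF.
by apply: measurable_funD => //; exact: measurable_cosD.
Qed.

Lemma mseq_hat_trig beta n t a : mseq (hat_trig beta n t a).
Proof.
apply: mseqM; first exact: mseq_diag_weight.
apply: (mseq_cos1 t a (F := fun s => Num.sqrt n%:R * mh s)).
by apply: mseqM; [exact: mseq_cst|exact: mseq_mh].
Qed.

Lemma mseq_raw_trig beta n t a : mseq (raw_trig beta n t a).
Proof.
apply: mseqM; last by apply: mseq_cos1; exact: (@mseq_sum R id).
apply: (mseq_comp (g := fun y => expR (- (beta / 2 / n%:R * y))) (F := fun s => \sum_(x <- s) x ^+ 2)).
  by apply: measurableT_comp => //; apply: measurableT_comp => //; exact: measurable_funM.
by apply: mseq_sum; exact: measurable_funX.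
Qed.

Lemma hat_trig_bounds beta n t a s : 0 <= beta -> 0 <= hat_trig beta n t a s <= 2.
Proof.
move=> b0; have /andP[c0 c2] := cos1_bounds (t * (Num.sqrt n%:R * mh s) + a).
rewrite mulr_ge0 ?expR_ge0//=; apply: le_trans c2; rewrite ler_piMl ?diag_weight_le1//.
Qed.

Lemma raw_trig_bounds beta n t a s : 0 <= beta -> 0 <= raw_trig beta n t a s <= 2.
Proof.
move=> b0; have /andP[c0 c2] := cos1_bounds (t / Num.sqrt n%:R * (\sum_(x <- s) x) + a).
rewrite mulr_ge0 ?expR_ge0//=; apply: le_trans c2; rewrite ler_piMl//.
rewrite -[leRHS]expR0 ler_expR oppr_le0 !mulr_ge0 ?invr_ge0//.
by apply: sumr_ge0 => x _; exact: sqr_ge0.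
Qed.

Definition std (n : nat) (s : seq R) : R := (Num.sqrt n%:R)^-1 * \sum_(x <- s) x.

(** In the window the norm is 1 + O(e), which changes the damping by O(beta e) and the cosine by O(e
    |t V|), V being the standardized sum. *)
Lemma trig_close beta n e t a s : 0 <= beta -> (0 < n)%N -> size s = n -> 0 < e -> e <= 1 / 2 ->
  near_sphere p e s = 1 ->
  `|hat_trig beta n t a s - raw_trig beta n t a s| <=
    e * (24 * beta + 2 * `|t| * (expR (std n s) + expR (- std n s))).
Proof.
move=> b0 n0 sn e0 e2 g1; have n0' : 0 < n%:R :> R by rewrite ltr0n.
pose N := normp p s; pose V := std n s; pose q := Num.sqrt n%:R : R.
have q0 : 0 < q by rewrite sqrtr_gt0.
have q2 : q ^+ 2 = n%:R by rewrite sqr_sqrtr// ltW.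
have /near1P : near1 e ((size s)%:R^-1 * sabs p s) == 1 by apply/eqP.
rewrite -normp_powR// -/N => NP.
have [Npos Ninv] := near1_inv (le_trans (ler1n _ 2) hp) (normp_ge0 p s) e0 e2 NP.
have Ni0 : 0 < N^-1 by rewrite invr_gt0.
have Ni2 : N^-1 <= 2.
  by have := ler_norm (N^-1 - 1); rewrite -/N in Ninv *; lra.
have Ni2' : `|N^-1 ^+ 2 - 1| <= 6 * e.
  have -> : N^-1 ^+ 2 - 1 = (N^-1 - 1) * (N^-1 + 1) by ring.
  rewrite normrM (@ger0_norm _ (N^-1 + 1)) ?addr_ge0 ?(ltW Ni0)//.
  apply: (@le_trans _ _ (2 * e * 3)); last by lra.
  by apply: ler_pM => //; [rewrite addr_ge0// ltW|lra].
have N4 : N ^+ 2 <= 4.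
  have Nle : N <= 2.
    have [N1|N1] := leP N 1; first by lra.
    have /andP[_ u] := NP.
    apply: (@le_trans _ _ (powR N p)); last by lra.
    by rewrite -[leLHS](powRr1 (ltW Npos)); apply: ler_powR; [exact: ltW|exact: le_trans (ler1n _ 2) hp].
  have -> : 4 = 2 ^+ 2 :> R by ring.
  by rewrite lerXn2r ?nnegrE// ltW.
have A4 : 0 <= A2 s <= 4.
  have a1 := ah_le1 hp s; have a0 := ah_ge0 p s.
  have AE : A2 s = ah p s * N ^+ 2.
    by rewrite ahE// divfK// expf_neq0// gt_eqF.
  rewrite AE mulr_ge0 ?sqr_ge0//=; apply: le_trans N4; rewrite ler_piMl ?sqr_ge0//.
have /andP[A0 A4'] := A4.
have SE : \sum_(x <- s) x = n%:R * (mh s * N) by rewrite (sum_mh hp) sn.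
have VE : V = q * mh s * N.
  by rewrite /V /std SE -/q -q2; field; rewrite gt_eqF.
have hatE : q * mh s = V * N^-1 by rewrite VE mulfK// gt_eqF.
pose c1 := cos (t * (V * N^-1) + a); pose c2 := cos (t * V + a).
pose w1 := expR (- (beta / 2 * (A2 s * N^-1 ^+ 2))); pose w2 := expR (- (beta / 2 * A2 s)).
have -> : hat_trig beta n t a s = w1 * (1 + c1).
  by rewrite /hat_trig -/q hatE /diag_weight ahE// /w1 exprVn.
have -> : raw_trig beta n t a s = w2 * (1 + c2).
  rewrite /raw_trig /w2 /c2 /V /std /A2 sn -/q.
  by congr (expR (- _) * (1 + cos (_ + _))); rewrite !mulrA.
have /andP[l1 u1] := cos1_bounds (t * (V * N^-1) + a); rewrite -/c1 in l1 u1.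
have w20 : 0 <= w2 by exact: expR_ge0.
have b2 : 0 <= beta / 2 by rewrite divr_ge0.
have w21 : w2 <= 1 by rewrite -[leRHS]expR0 ler_expR oppr_le0 mulr_ge0.
have dw : `|w1 - w2| <= 12 * beta * e.
  apply: (le_trans (norm_expRN_sub _ _)).
  - by apply: mulr_ge0 => //; apply: mulr_ge0 => //; exact: sqr_ge0.
  - by rewrite mulr_ge0.
  - have -> : beta / 2 * (A2 s * N^-1 ^+ 2) - beta / 2 * A2 s =
      beta / 2 * A2 s * (N^-1 ^+ 2 - 1) by ring.
    rewrite normrM (ger0_norm (mulr_ge0 b2 A0)).
    have -> : 12 * beta * e = beta / 2 * 4 * (6 * e) by field.
    by apply: ler_pM => //; [exact: mulr_ge0|exact: ler_wpM2l].
have dc : `|c1 - c2| <= 2 * e * `|t| * `|V|.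
  apply: (le_trans (norm_cos_sub _ _)).
  have -> : t * (V * N^-1) + a - (t * V + a) = t * V * (N^-1 - 1) by ring.
  rewrite normrM (normrM t V).
  have -> : 2 * e * `|t| * `|V| = `|t| * `|V| * (2 * e) by ring.
  by rewrite ler_wpM2l// mulr_ge0.
(* |V| is traded for exponentials, whose means are bounded in n by [psi_le]. *)
have Vle : `|V| <= expR V + expR (- V).
  have e1 := expR_ge1Dx V; have e2' := expR_ge1Dx (- V).
  have p1 := expR_ge0 V; have p2 := expR_ge0 (- V).
  by rewrite ler_norml; apply/andP; split; lra.
have -> : w1 * (1 + c1) - w2 * (1 + c2) = (w1 - w2) * (1 + c1) + w2 * (c1 - c2) by ring.
apply: (le_trans (ler_normD _ _)).
have h1 : `|(w1 - w2) * (1 + c1)| <= 12 * beta * e * 2.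
  by rewrite normrM (ger0_norm l1) ler_pM.
have h2 : `|w2 * (c1 - c2)| <= 2 * e * `|t| * `|V|.
  by rewrite normrM (ger0_norm w20) (le_trans _ dc)// ler_piMl.
have h3 : 2 * e * `|t| * `|V| <= 2 * e * `|t| * (expR V + expR (- V)).
  by rewrite ler_wpM2l// !mulr_ge0// ltW.
rewrite -/V.
have -> : e * (24 * beta + 2 * `|t| * (expR V + expR (- V))) =
  12 * beta * e * 2 + 2 * e * `|t| * (expR V + expR (- V)) by ring.
by apply: lerD => //; exact: le_trans h3.
Qed.

Lemma En_off_sphere n e : 0 < e < 1 -> (En n (fun s => 1 - near_sphere p e s)%R <= (conc_err p e n)%:E)%E.
Proof.
move=> e01; have m1 := mseq_cst (1 : R); have mg := mseq_near_sphere p e.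
have mG : mseq (fun s => 1 - near_sphere p e s).
  by move=> k; apply: measurable_funB; [exact: m1|exact: mg].
have G0 s : 0 <= 1 - near_sphere p e s by rewrite subr_ge0 near_sphere_le1.
have := En_conc hp n e01 m1 (fun=> ler01) (fun _ _ _ => erefl).
have E1 : En n (fun=> 1) = 1%:E by exact: En_cst.
have Eg : En n (fun s => 1 * near_sphere p e s) = En n (near_sphere p e) by apply: eq_En => s _; rewrite mul1r.
rewrite E1 Eg mule1.
have : (En n (fun s => 1 - near_sphere p e s)%R + En n (near_sphere p e) = 1)%E.
  have := En_comb hp n mG mg G0 (near_sphere_ge0 p e) ler01 ler01.
  rewrite !mul1e => <-; rewrite -[RHS]E1; apply: eq_En => s _; ring.
have := En_ge0 hp n G0; have := En_ge0 hp n (near_sphere_ge0 p e).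
case: (En n (fun s => 1 - near_sphere p e s)) => [x| |]//; case: (En n (near_sphere p e)) => [y| |]//.
move=> _ _; rewrite -EFinD => -[xy]; rewrite -EFinD !lee_fin; lra.
Qed.

Lemma En_std_le n : (0 < n)%N ->
  (En n (fun s => expR (std n s)) <= (expR (M / 2))%:E)%E /\
  (En n (fun s => expR (- std n s)) <= (expR (M / 2))%:E)%E.
Proof.
move=> n0; have n0' : 0 < n%:R :> R by rewrite ltr0n.
pose q := (Num.sqrt n%:R)^-1 : R.
have q2 : q ^+ 2 = n%:R^-1 by rewrite exprVn sqr_sqrtr// ltW.
split.
  rewrite (@eq_En _ _ _ _ _ (fun s => expR (q * \sum_(x <- s) x)))// En_expR_sum lee_fin ler_expR.
  apply: (@le_trans _ _ (n%:R * (q ^+ 2 * M / 2))); first by rewrite ler_wpM2l// psi_le.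
  by rewrite q2 le_eqVlt; apply/orP; left; apply/eqP; field; rewrite gt_eqF.
rewrite (@eq_En _ _ _ _ _ (fun s => expR (- q * \sum_(x <- s) x))); last first.
  by move=> s _; rewrite /std mulNr.
rewrite En_expR_sum lee_fin ler_expR.
apply: (@le_trans _ _ (n%:R * ((- q) ^+ 2 * M / 2))); first by rewrite ler_wpM2l// psi_le.
by rewrite sqrrN q2 le_eqVlt; apply/orP; left; apply/eqP; field; rewrite gt_eqF.
Qed.

(** Outside the window both statistics lie in [0, 2], which costs twice the bound [conc_err] on its
    probability. *)
Lemma En_trig_close beta n e t a : 0 <= beta -> (0 < n)%N -> 0 < e -> e <= 1 / 2 ->
  `|fine (En n (hat_trig beta n t a)) - fine (En n (raw_trig beta n t a))| <=
    e * (24 * beta + 4 * `|t| * expR (M / 2)) + 2 * conc_err p e n.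
Proof.
move=> b0 n0 e0 e2; have e01 : 0 < e < 1 by rewrite e0/=; lra.
pose X s := expR (std n s); pose Y s := expR (- std n s); pose G s := 1 - near_sphere p e s.
have mstd : mseq (std n) by apply: mseqM; [exact: mseq_cst|exact: (@mseq_sum R id)].
have mX : mseq X by exact: (mseq_comp (@measurable_expR R) mstd).
have mY : mseq Y.
  apply: (mseq_comp (g := fun y => expR (- y))) mstd.
  by apply: measurableT_comp => //; exact: measurable_oppr.
have mG : mseq G.
  by move=> k; apply: measurable_funB; [exact: mseq_cst|exact: mseq_near_sphere].
have X0 s : 0 <= X s by exact: expR_ge0. have Y0 s : 0 <= Y s by exact: expR_ge0.
have G0 s : 0 <= G s by rewrite subr_ge0 near_sphere_le1.
pose k1 := e * (24 * beta); pose k2 := 2 * e * `|t|.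
have k10 : 0 <= k1 by rewrite !mulr_ge0// ltW.
have k20 : 0 <= k2 by rewrite !mulr_ge0// ltW.
pose H1 s := k1 * 1 + 2 * G s; pose H2 s := k2 * X s + k2 * Y s.
pose H s := 1 * H1 s + 1 * H2 s.
have mH1 : mseq H1 by apply: mseqD; [exact: mseq_cst|apply: mseqM => //; exact: mseq_cst].
have mH2 : mseq H2 by apply: mseqD; apply: mseqM => //; exact: mseq_cst.
have mH : mseq H by apply: mseqD; apply: mseqM => //; exact: mseq_cst.
have H10 s : 0 <= H1 s by apply: addr_ge0; apply: mulr_ge0.
have H20 s : 0 <= H2 s by apply: addr_ge0; apply: mulr_ge0.
have H0 s : 0 <= H s by apply: addr_ge0; apply: mulr_ge0.
set B := e * _ + _.
have HB : (En n H <= B%:E)%E.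
  have [hx hy] := En_std_le n0; have hg := En_off_sphere n e01.
  have := En_comb hp n mH1 mH2 H10 H20 ler01 ler01; rewrite -/H => ->.
  have := En_comb hp n (mseq_cst 1) mG (fun=> ler01) G0 k10 (ler0n R 2); rewrite -/H1 => ->.
  have := En_comb hp n mX mY X0 Y0 k20 k20; rewrite -/H2 => ->.
  rewrite En_cst// !mul1e.
  have -> : B%:E = (k1%:E * 1%:E + 2%:E * (conc_err p e n)%:E +
     (k2%:E * (expR (M / 2))%:E + k2%:E * (expR (M / 2))%:E))%E.
    by rewrite -!EFinM -!EFinD; congr EFin; rewrite /B /k1 /k2; ring.
  by apply: leeD; apply: leeD => //; apply: lee_wpmul2l; rewrite ?lee_fin.
have close s : size s = n -> `|hat_trig beta n t a s - raw_trig beta n t a s| <= H s.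
  move=> sn; have [g1|g0] := eqVneq (near_sphere p e s) 1.
    apply: (le_trans (trig_close t a b0 n0 sn e0 e2 g1)).
    rewrite /H /H1 /H2 /G g1 subrr /k1 /k2 /X /Y.
    by rewrite le_eqVlt; apply/orP; left; apply/eqP; ring.
  have gE : near_sphere p e s = 0 by exact: near1_eq0 g0.
  have /andP[a1 a2] := hat_trig_bounds n t a s b0.
  have /andP[a3 a4] := raw_trig_bounds n t a s b0.
  have h2 := H20 s; rewrite /H /H1 /G gE ler_norml; apply/andP; split; lra.
have fin (F : seq R -> R) : mseq F -> (forall s, 0 <= F s <= 2) -> En n F = (fine (En n F))%:E.
  move=> mF F2; have F0 s : 0 <= F s by have /andP[] := F2 s.
  rewrite fineK// ge0_fin_numE ?En_ge0//; apply: (@le_lt_trans _ _ (En n (fun=> 2))).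
    by apply: En_le => // s _; have /andP[] := F2 s.
  by rewrite En_cst ?ltry.
have mh1 := mseq_hat_trig beta n t a; have mr1 := mseq_raw_trig beta n t a.
have fh := fin _ mh1 (fun s => hat_trig_bounds n t a s b0).
have fr := fin _ mr1 (fun s => raw_trig_bounds n t a s b0).
have h0 s : 0 <= hat_trig beta n t a s by have /andP[] := hat_trig_bounds n t a s b0.
have r0 s : 0 <= raw_trig beta n t a s by have /andP[] := raw_trig_bounds n t a s b0.
(* The difference is controlled by two one-sided comparisons of nonnegative integrals, which avoids
   subtracting extended reals. *)
have one (F K : seq R -> R) : mseq F -> mseq K -> (forall s, 0 <= F s) -> (forall s, 0 <= K s) ->
    (forall s, size s = n -> F s <= K s + H s) -> (En n F <= En n K + B%:E)%E.
  move=> mF mK F0 K0 FK; apply: (@le_trans _ _ (En n (fun s => 1 * K s + 1 * H s))).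
    apply: En_le => //; first by apply: mseqD; apply: mseqM => //; exact: mseq_cst.
    by move=> s sn; rewrite !mul1r; exact: FK.
  by rewrite (En_comb hp n mK mH K0 H0 ler01 ler01) !mul1e leeD2l.
have u1 := one _ _ mh1 mr1 h0 r0; have u2 := one _ _ mr1 mh1 r0 h0.
move: u1 u2; rewrite fh fr -!EFinD !lee_fin => u1 u2.
rewrite ler_norml; apply/andP; split.
  have := u2 _; move=> /(_ _) u2'; suff : fine (En n (raw_trig beta n t a)) <=
    fine (En n (hat_trig beta n t a)) + B by lra.
  by apply: u2 => s sn; have := close s sn; rewrite distrC; have := ler_norm (raw_trig beta n t a s - hat_trig beta n t a s); lra.
suff : fine (En n (hat_trig beta n t a)) <= fine (En n (raw_trig beta n t a)) + B by lra.
by apply: u1 => s sn; have := close s sn; have := ler_norm (hat_trig beta n t a s - raw_trig beta n t a s); lra.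
Qed.

Lemma hat_trig_cvg beta t a : 0 <= beta ->
  (fun n : nat => fine (En n (hat_trig beta n t a))) @ \oo -->
  expR (- (beta / 2 * M)) * (1 + cos a * expR (- (t ^+ 2 * M / 2))).
Proof.
move=> b0; have b2 : 0 <= beta / 2 by rewrite divr_ge0.
have raw := @trig_cvg _ _ hp _ t a b2; set l := expR _ * _ in raw *.
apply/cvgrPdist_le => eps eps0.
pose D := 24 * beta + 4 * `|t| * expR (M / 2).
have D0 : 0 <= D by rewrite addr_ge0 ?mulr_ge0 ?expR_ge0.
have D1 : 0 < 4 * (D + 1) by rewrite mulr_gt0// ltr_wpDl.
pose e := Num.min (1 / 2) (eps / (4 * (D + 1))).
have e0 : 0 < e by rewrite lt_min divr_gt0//= divr_gt0.
have e2 : e <= 1 / 2 by rewrite ge_min lexx.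
have e01 : 0 < e < 1 by rewrite e0/=; lra.
have eD : e * D <= eps / 4.
  apply: (@le_trans _ _ (eps / (4 * (D + 1)) * D)); first by rewrite ler_wpM2r// ge_min lexx orbT.
  have -> : eps / 4 = eps / (4 * (D + 1)) * (D + 1) by field; rewrite gt_eqF// ltr_wpDl.
  by rewrite ler_wpM2l ?lerDl// divr_ge0// ltW.
have eps4 : 0 < eps / 4 by rewrite divr_gt0.
have /cvgrPdist_le/(_ _ eps4) dl := conc_err_cvg hp e01.
have /cvgrPdist_le/(_ _ eps4) rw := raw.
near=> n; have n0 : (0 < n)%N by near: n; exact: nbhs_infty_gt.
have h1 : `|0 - conc_err p e n| <= eps / 4 by near: n.
have h2 := En_trig_close t a b0 n0 e0 e2; rewrite -/D in h2.
have bn : 0 <= beta / 2 / n%:R by rewrite divr_ge0.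
have rE : fine (En n (raw_trig beta n t a)) =
    tmom hp (beta / 2 / n%:R) 0 ^+ n + cos a * tmom hp (beta / 2 / n%:R) (t / Num.sqrt n%:R) ^+ n.
  by rewrite /raw_trig (En_trig hp n _ _ bn).
have h3 : `|l - fine (En n (raw_trig beta n t a))| <= eps / 4 by rewrite rE; near: n.
have h4 : conc_err p e n <= eps / 4.
  by apply: le_trans h1; rewrite sub0r normrN ler_norm.
move: h2 h3; set u := fine (En n (hat_trig beta n t a)); set v := fine _ => h2 h3.
have -> : l - u = (l - v) - (u - v) by ring.
by apply: (le_trans (ler_normB _ _)); lra.
Unshelve. all: by end_near. Qed.

Definition hat_functional (beta : R) (n : nat) (g : R -> R) : R :=
  \int[Pn n]_s (diag_weight p beta s * g (Num.sqrt n%:R * mh s)).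

(** The dominating weight exp(c (sqrt n m)^2 / 2) is [quad_weight] at c, so its integral is at most
    a partition function, bounded in n since c < [betac]. *)
Lemma hat_functional_gfun beta c : 0 <= beta -> 0 <= c -> c < betac p ->
  exists2 K, 0 <= K & forall n, gfun c K (hat_functional beta n).
Proof.
move=> b0 c0 cb; have [C C0 HC] := Bn_uniformly_bounded hp c0 cb; exists C => // n.
have mY : mseq (fun s => Num.sqrt n%:R * mh s) by apply: mseqM; [exact: mseq_cst|exact: mseq_mh].
apply: (@wint_gfun R c _ _ (Pn n) (fun s => diag_weight p beta s) (fun s => Num.sqrt n%:R * mh s)).
- exact: mseq_diag_weight.
- exact: mY.
- by move=> s; exact: expR_ge0.
- apply: (@le_trans _ _ (En n (quad_weight p c))); last by rewrite -BnE// lee_fin.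
  rewrite -[leLHS]/(En n (fun s => diag_weight p beta s * expR (c / 2 * (Num.sqrt n%:R * mh s) ^+ 2))).
  apply: En_le.
  + apply: mseqM; first exact: mseq_diag_weight.
    exact: (mseq_comp (measurable_quad (c / 2)) mY).
  + exact: mseq_quad_weight.
  + by move=> s; rewrite mulr_ge0 ?expR_ge0.
  + move=> s sn; rewrite exprMn sqr_sqrtr// /quad_weight sn.
    have -> : c / 2 * (n%:R * mh s ^+ 2) = c * n%:R / 2 * mh s ^+ 2 by field.
    by rewrite ler_piMl ?expR_ge0 ?diag_weight_le1.
Qed.

Lemma hat_functional_cos beta t a : 0 <= beta ->
  (fun n : nat => hat_functional beta n (fun x => cos (t * x + a))) @ \oo -->
  expR (- (beta / 2 * M)) * (cos a * expR (- (t ^+ 2 * M / 2))).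
Proof.
move=> b0; set k := expR (- (beta / 2 * M)).
(* The cosine is recovered from 1 + cos by subtracting half of the case t = a = 0, where 1 + cos is
   2. *)
have E n : hat_functional beta n (fun x => cos (t * x + a)) =
    fine (En n (hat_trig beta n t a)) - 2^-1 * fine (En n (hat_trig beta n 0 0)).
  have ib (F : seq R -> R) : mseq F -> (forall s, `|F s| <= 2) ->
      (Pn n).-integrable setT (EFin \o (fun s : n.-tuple (measurableTypeR R) => F s)).
    move=> mF F2; apply: (bounded_integrable (Pn n) (M := 2)) => [|s].
      by apply/measurable_EFinP; exact: mF.
    by rewrite lee_fin; exact: F2.
  have i1 := ib _ (mseq_hat_trig beta n t a).
  have i2 := ib _ (mseq_hat_trig beta n 0 0).
  have nb u b s : `|hat_trig beta n u b s| <= 2.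
    by have /andP[h1 h2] := hat_trig_bounds n u b s b0; rewrite ger0_norm.
  rewrite -[fine (En n (hat_trig beta n t a))]/(\int[Pn n]_s (hat_trig beta n t a s)).
  rewrite -[fine (En n (hat_trig beta n 0 0))]/(\int[Pn n]_s (hat_trig beta n 0 0 s)).
  rewrite -RintegralZl//; last exact: (i2 (nb 0 0)).
  rewrite -RintegralB//.
  - by apply: eq_Rintegral => s _; rewrite /hat_trig mul0r addr0 cos0; field.
  - exact: (i1 (nb t a)).
  - exact: (integrableZl measurableT 2^-1 (i2 (nb 0 0))).
under eq_fun do rewrite E.
have -> : k * (cos a * expR (- (t ^+ 2 * M / 2))) =
    k * (1 + cos a * expR (- (t ^+ 2 * M / 2))) -
    2^-1 * (k * (1 + cos 0 * expR (- (0 ^+ 2 * M / 2)))).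
  by rewrite cos0 expr0n !mul0r oppr0 expR0; field.
apply: cvgB; first exact: hat_trig_cvg.
by apply: cvgM; [exact: cvg_cst|exact: hat_trig_cvg].
Qed.

End self_normalized_clt.

(** * The Gaussian characteristic function, from the case p = 2 of [rho] *)

Section gaussian_characteristic_function.
Context (R : realType).
Local Notation leb := (@lebesgue_measure R).
Local Notation hp2 := (lexx (2 : R)).
Local Notation P2 := (density_prob (rho_density hp2)).

Lemma absp2 (x : R) : absp 2 x = x ^+ 2.
Proof. by rewrite /absp powR_mulrn// real_normK ?num_real. Qed.

(** As |x|^p = x^2 here, the integration by parts identity is itself a recursion between consecutive
    even moments. *)
Lemma mom2E k : mom (2 : R) k = k.*2`!%:R / (2 ^+ k * k`!%:R).
Proof.
elim: k => [|k IH].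
  by rewrite (mom0 hp2) (_ : 0.*2`!%:R = 1 :> R)// !expr0 !mul1r invr1.
have f0 : (k`!%:R : R) != 0 by rewrite pnatr_eq0 -lt0n fact_gt0.
have E : mom (2 : R) k.+1 = k.*2.+1%:R * mom 2 k.
  apply: EFin_inj; rewrite -(absp_mom hp2) -(mom_fin hp2).
  by apply: eq_integral => x _; rewrite absp2 -exprD.
have e2 : k.*2.+2%:R = 2 * k.+1%:R :> R by rewrite -natrM mul2n.
rewrite E IH doubleS !factS 3!natrM !exprS e2.
by field; rewrite f0 expf_neq0// ?[1 + _]nat1r pnatr_eq0.
Qed.

(** The Gaussian moments turn the cosine series in t x, term by term, into the exponential series at
    - t^2 / 2. *)
Lemma cos_series_moment n t :
  P2.-integrable setT (EFin \o (fun x => series (cos_coeff' (t * x)) n)) /\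
  \int[P2]_x (series (cos_coeff' (t * x)) n) = series (exp_coeff (- (t ^+ 2 / 2))) n.
Proof.
elim: n => [|n [IHi IH]].
  have -> : (fun x : R => series (cos_coeff' (t * x)) 0) = fun=> 0.
    by apply/funext => x; rewrite /series/= big_geq.
  split; first by apply: (bounded_RI hp2 (C := 0)) => // x; rewrite normr0.
  by rewrite Rintegral_cst//= mul0r /series/= big_geq.
pose c := (-1) ^+ n * t ^+ n.*2 / n.*2`!%:R.
have E : (fun x : R => series (cos_coeff' (t * x)) n.+1) =
    fun x => series (cos_coeff' (t * x)) n + c * x ^+ n.*2.
  apply/funext => x; rewrite /series/= big_nat_recr//=; congr (_ + _).
  by rewrite /cos_coeff' -exprnP exprMn /c; ring.
have i2 := integrableZl measurableT c (integrable_even hp2 n).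
rewrite E; split; first exact: (integrableD measurableT IHi i2).
rewrite RintegralD// RintegralZl//; last exact: integrable_even.
rewrite IH /Rintegral (integral_even hp2)/= mom2E [RHS]/series/= big_nat_recr//=; congr (_ + _).
rewrite /exp_coeff/= /c -mul2n exprM.
have f0 : (n`!%:R : R) != 0 by rewrite pnatr_eq0 -lt0n fact_gt0.
have f1 : ((2 * n)`!%:R : R) != 0 by rewrite pnatr_eq0 -lt0n fact_gt0.
have -> : (- (t ^+ 2 / 2)) ^+ n = (-1) ^+ n * ((t ^+ 2) ^+ n / 2 ^+ n).
  by rewrite -expr_div_n -[RHS]exprMn mulN1r.
by field; rewrite f0 f1 expf_neq0.
Qed.

Lemma cos_series_le (x : R) n : `|series (cos_coeff' x) n| <= ch x.
Proof.
apply: le_trans (ch_sum_le n x); rewrite /series/= big_mkord; apply: (le_trans (ler_norm_sum _ _ _)).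
apply: ler_sum => k _; rewrite /cos_coeff' normrM normrM normrX normrN1 expr1n mul1r.
by rewrite !ger0_norm ?invr_ge0 ?exprn_double_ge0.
Qed.

(** Dominated convergence applies because all partial sums of the cosine series are bounded by the
    integrable cosh. *)
Lemma tmom_gaussian t : tmom hp2 0 t = expR (- (t ^+ 2 / 2)).
Proof.
have -> : tmom hp2 0 t = \int[P2]_x cos (t * x).
  by apply: eq_Rintegral => x _; rewrite mul0r oppr0 expR0 mul1r.
have mt : measurable_fun setT (fun x : R => t * x) by exact: measurable_funM.
have ig : P2.-integrable setT (fun x => (ch (t * x))%:E).
  apply/integrableP; split.
    by apply/measurable_EFinP; exact: (measurableT_comp (@measurable_ch R) mt).
  under eq_integral do rewrite gee0_abs ?lee_fin ?ch_ge0//.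
  by rewrite integral_ch ltry.
have mcos : measurable_fun setT (fun x : R => cos (t * x)) by exact: measurable_cosM.
have mf n : measurable_fun setT (fun x : R => (series (cos_coeff' (t * x)) n)%:E).
  by have [/integrableP[]] := cos_series_moment n t.
have [] := @dominated_convergence _ _ _ P2 setT measurableT
  (fun n (x : R) => (series (cos_coeff' (t * x)) n)%:E) (fun x => (cos (t * x))%:E)
  (fun x => (ch (t * x))%:E) mf _ _ ig _.
- exact/measurable_EFinP.
- apply: aeW => x _; apply/fine_cvgP; split; first exact: nearW.
  exact: cvg_cos_coeff'.
- by apply: aeW => x n _; rewrite lee_fin cos_series_le.
move=> icos _ cv; apply: EFin_inj.
have E n : (\int[P2]_x (series (cos_coeff' (t * x)) n)%:E = (series (exp_coeff (- (t ^+ 2 / 2))) n)%:E)%E.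
  have [i <-] := cos_series_moment n t.
  by rewrite /Rintegral fineK//; exact: (integrable_fin_num measurableT i).
have Ef : (fun n => \int[P2]_x (series (cos_coeff' (t * x)) n)%:E)%E =
    (fun n => (series (exp_coeff (- (t ^+ 2 / 2))) n)%:E).
  by apply/funext => n; exact: E.
have -> : (\int[P2]_x cos (t * x))%:E = (\int[P2]_x (cos (t * x))%:E)%E.
  rewrite /Rintegral fineK//; exact: (integrable_fin_num measurableT icos).
have cv1 : (fun n => \int[P2]_x (series (cos_coeff' (t * x)) n)%:E)%E @ \oo -->
    (expR (- (t ^+ 2 / 2)))%:E.
  by rewrite Ef; apply/fine_cvgP; split; [exact: nearW|exact: is_cvg_series_exp_coeff].
exact: (cvg_unique _ cv cv1).
Qed.

Lemma gaussian_scale (s : R) (g : R -> R) : 0 < s -> measurable_fun setT g -> (forall x, 0 <= g x) ->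
  (\int[leb]_x (normal_pdf 0 s x * g x)%:E = \int[P2]_x (g (s * x))%:E)%E.
Proof.
move=> s0; have [mr r0 r1] := rho_density hp2.
have s0' : s != 0 by rewrite gt_eqF.
have cp0 : 0 < cp (2 : R).
  have := r0 0; rewrite /rho; rewrite pmulr_lge0 ?expR_gt0// => c0; rewrite lt_neqAle c0 andbT.
  apply/eqP => /esym cE; move: r1; rewrite /rho cE.
  under eq_integral do rewrite mul0r.
  by rewrite integral0 => /esym/eqP; rewrite eqe oner_eq0.
(* This ratio is 1; comparing total masses proves it below without evaluating the Gamma value in
   [cp]. *)
pose q := s * normal_peak s / cp 2.
have q0 : 0 <= q by apply: divr_ge0; [apply: mulr_ge0; [exact: ltW|exact: normal_peak_ge0]|exact: ltW].
have E x : s * normal_pdf 0 s (s * x) = q * rho 2 x.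
  transitivity (s * normal_peak s * expR (- (x ^+ 2 / 2))).
    rewrite normal_pdfE//= mulrA; congr (_ * expR _); rewrite subr0 [_ *+ 2]mulr2n; field.
    by rewrite -[s ^+ 2 + _]mulr2n mulrn_eq0 expf_eq0/= (negbTE s0').
  by rewrite /rho -/(absp 2 x) absp2 /q; field; rewrite gt_eqF.
have key (h : R -> R) : measurable_fun setT h -> (forall x, 0 <= h x) ->
    (\int[leb]_x (normal_pdf 0 s x * h x)%:E = q%:E * \int[P2]_x (h (s * x))%:E)%E.
  move=> mh h0.
  have mhs : measurable_fun setT (fun x : R => h (s * x)).
    by apply: (measurableT_comp mh); exact: measurable_funM.
  rewrite (integral_homothety s0'); last 2 first.
  - by apply/measurable_EFinP; apply: measurable_funM => //; exact: measurable_normal_pdf.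
  - by move=> x; rewrite lee_fin mulr_ge0 ?normal_pdf_ge0.
  rewrite gtr0_norm// integral_rhoE// -!ge0_integralZl//.
  - by apply: eq_integral => x _; rewrite -!EFinM mulrA E; congr EFin; ring.
  - by apply/measurable_EFinP; apply: measurable_funM.
  - by move=> x _; rewrite lee_fin mulr_ge0.
  - apply/measurable_EFinP; apply: measurable_funM => //.
    apply: (measurableT_comp (measurable_normal_pdf 0 s)); exact: measurable_funM.
  - by move=> x _; rewrite lee_fin mulr_ge0 ?normal_pdf_ge0.
  - by rewrite lee_fin ltW.
have q1 : q = 1.
  have P1 : (\int[P2]_x (1%R)%:E = 1%E :> \bar R)%E.
    transitivity (1%:E * P2 setT)%E; first exact: integral_cst.
    by rewrite (probability_setT P2) mule1.
  have := key (fun=> 1) (measurable_cst _) (fun=> ler01); rewrite P1 mule1.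
  under eq_integral do rewrite mulr1.
  by rewrite integral_normal_pdf => E1; exact: (esym (EFin_inj E1)).
by move=> mg g0; rewrite key// q1 mul1e.
Qed.

Lemma gaussian_cos (s t a : R) : 0 < s ->
  \int[leb]_x (normal_pdf 0 s x * cos (t * x + a)) = cos a * expR (- (t ^+ 2 * s ^+ 2 / 2)).
Proof.
move=> s0; have mc := measurable_cosD t a.
have in1 := integrable_normal_pdf 0 s.
have ic : leb.-integrable setT (EFin \o (fun x : R => normal_pdf 0 s x * cos (t * x + a))).
  apply: le_integrable in1 => //.
  - by apply/measurable_EFinP; apply: measurable_funM => //; exact: measurable_normal_pdf.
  - by move=> x _ /=; rewrite lee_fin normrM ler_piMr// cos_max.
have E : \int[leb]_x (normal_pdf 0 s x * (1 + cos (t * x + a))) =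
    1 + cos a * expR (- (t ^+ 2 * s ^+ 2 / 2)).
  have m1 : measurable_fun setT (fun x : R => 1 + cos (t * x + a)).
    by apply: measurable_funD => //; exact: measurable_cosD.
  have p1 x : 0 <= 1 + cos (t * x + a) by have /andP[] := cos1_bounds (t * x + a).
  rewrite /Rintegral (gaussian_scale s0 m1 p1).
  rewrite -/(Rintegral P2 setT (fun x => 1 + cos (t * (s * x) + a))).
  have i1 : P2.-integrable setT (EFin \o (fun=> 1 : R)).
    by apply: (bounded_RI hp2 (C := 1)) => // x; rewrite normr1.
  have i2 : P2.-integrable setT (EFin \o (fun x => cos (t * (s * x) + a))).
    apply: (bounded_RI hp2 (C := 1)) => [|x]; last exact: cos_max.
    by under eq_fun do rewrite mulrA; exact: measurable_cosD.
  rewrite RintegralD// Rintegral_cst//= probability_setT/= mulr1; congr (_ + _).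
  have -> : t ^+ 2 * s ^+ 2 / 2 = (t * s) ^+ 2 / 2 by rewrite exprMn.
  rewrite -tmom_gaussian -tmom_phase//; apply: eq_Rintegral => x _.
  by rewrite mul0r oppr0 expR0 mul1r mulrA.
have N1 : \int[leb]_x (normal_pdf 0 s x) = 1 by rewrite /Rintegral integral_normal_pdf.
have -> : cos a * expR (- (t ^+ 2 * s ^+ 2 / 2)) =
  \int[leb]_x (normal_pdf 0 s x * (1 + cos (t * x + a))) - \int[leb]_x (normal_pdf 0 s x).
  by rewrite E N1; ring.
rewrite -RintegralB//.
- by apply: eq_Rintegral => x _; ring.
- have := integrableD measurableT in1 ic; apply: eq_integrable => // x _ /=.
  by rewrite -EFinD mulrDr mulr1.
Qed.

Lemma integral_normal_prob_fine (t : R) (f : R -> R) : measurable_fun setT f ->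
  fine (\int[normal_prob 0 t]_x (f x)%:E)%E = \int[leb]_x (normal_pdf 0 t x * f x).
Proof.
move=> mf; have hd : is_density leb (normal_pdf 0 t).
  split; [exact: measurable_normal_pdf|exact: normal_pdf_ge0|exact: integral_normal_pdf].
rewrite /Rintegral; congr fine.
rewrite (integral_density hd); last exact/measurable_EFinP.
by apply: eq_integral => x _; rewrite EFinM.
Qed.

End gaussian_characteristic_function.

(** * The limit law of the magnetization *)

Section central_limit_theorem.
Context (R : realType) (p : R).
Hypothesis hp : 2 <= p.
Local Notation leb := (@lebesgue_measure R).
Local Notation En := (En hp).
Local Notation Pn n := (tuple_prob (density_prob (rho_density hp)) n).
Local Notation M := (mom p 1).

Let p0 : 0 < p. Proof. by apply: lt_le_trans hp. Qed.

Let s := Num.sqrt M.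

Let s0 : 0 < s. Proof. by rewrite sqrtr_gt0 mom_gt0. Qed.

Let s2 : s ^+ 2 = M. Proof. by rewrite sqr_sqrtr// ltW// mom_gt0. Qed.

Let sV : (s ^+ 2)^-1 = betac p. Proof. by rewrite s2 mom1// invrK. Qed.

(** The limit before the quadratic weight acts: the damping leaves a constant and the sum is
    Gaussian of variance M. The weight is carried by the test function. *)
Definition limit_functional (beta : R) (g : R -> R) : R :=
  \int[leb]_x (expR (- (beta / 2 * M)) * normal_pdf 0 s x * g x).

Let tilt c := (Num.sqrt (betac p - c)^-1) : R.

Let tilt_gt0 c : c < betac p -> 0 < tilt c.
Proof. by move=> cb; rewrite sqrtr_gt0 invr_gt0 subr_gt0. Qed.

Let tiltV c : c < betac p -> (tilt c ^+ 2)^-1 = (s ^+ 2)^-1 - c.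
Proof. by move=> cb; rewrite sqr_sqrtr ?invr_ge0 ?subr_ge0 ?(ltW cb)// invrK sV. Qed.

Lemma limit_functional_gfun beta c : c < betac p -> exists K, gfun c K (limit_functional beta).
Proof.
move=> cb; pose k := expR (- (beta / 2 * M)); pose q := normal_peak s / normal_peak (tilt c).
have t0 := tilt_gt0 cb.
have q0 : 0 <= q by rewrite divr_ge0 ?normal_peak_ge0.
exists (k * q); apply: (@wint_gfun R c _ _ leb (fun x => k * normal_pdf 0 s x) id).
- by apply: measurable_funM => //; exact: measurable_normal_pdf.
- exact: measurable_id.
- by move=> x; rewrite mulr_ge0 ?expR_ge0 ?normal_pdf_ge0.
- have E x : k * normal_pdf 0 s x * expR (c / 2 * id x ^+ 2) = k * q * normal_pdf 0 (tilt c) x.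
    rewrite -mulrA [_ * expR _]mulrC (normal_pdf_tilt x _ _ (tiltV cb)) ?gt_eqF//.
    by rewrite mulrA.
  under eq_integral do rewrite E EFinM.
  rewrite ge0_integralZl//; last 3 first.
  - by apply/measurable_EFinP; exact: measurable_normal_pdf.
  - by move=> x _; rewrite lee_fin normal_pdf_ge0.
  - by rewrite lee_fin mulr_ge0 ?expR_ge0.
  by rewrite integral_normal_pdf mule1.
Qed.

Lemma limit_functional_cos beta t a :
  limit_functional beta (fun x => cos (t * x + a)) =
  expR (- (beta / 2 * M)) * (cos a * expR (- (t ^+ 2 * M / 2))).
Proof.
have in1 := integrable_normal_pdf 0 s.
have ic : leb.-integrable setT (EFin \o (fun x : R => normal_pdf 0 s x * cos (t * x + a))).
  apply: le_integrable in1 => //.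
  - apply/measurable_EFinP; apply: measurable_funM; [exact: measurable_normal_pdf|exact: measurable_cosD].
  - by move=> x _ /=; rewrite lee_fin normrM ler_piMr// cos_max.
rewrite /limit_functional -[M in RHS]s2 -gaussian_cos// -RintegralZl// s2.
by apply: eq_Rintegral => x _; rewrite mulrA.
Qed.

(** A parameter c strictly between beta and [betac] dominates the weight exp(beta x^2 / 2) while
    keeping the functionals bounded in n. *)
Lemma hat_functional_cvg beta (f : R -> R) (C : R) : 0 <= beta -> beta < betac p -> continuous f ->
  (forall x, `|f x| <= C) ->
  (fun n => hat_functional hp beta n (fun x => expR (beta / 2 * x ^+ 2) * f x)) @ \oo -->
  limit_functional beta (fun x => expR (beta / 2 * x ^+ 2) * f x).
Proof.
move=> b0 bc cf fC; pose c := (beta + betac p) / 2.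
have bc' : beta < c by rewrite /c; lra.
have cb : c < betac p by rewrite /c; lra.
have c0 : 0 <= c by exact: le_trans (ltW bc').
have [K1 K10 H1] := hat_functional_gfun hp b0 c0 cb.
have [K2 H2] := limit_functional_gfun beta cb.
pose K := Num.max K1 K2.
have K0 : 0 <= K by rewrite le_max K10.
apply: (@gfun_cvg R c K _ _ _ C beta K0) => //.
- by move=> n; apply: gfun_le (H1 n); rewrite le_max lexx.
- by apply: gfun_le H2; rewrite le_max lexx orbT.
- by move=> t a; rewrite limit_functional_cos; exact: hat_functional_cos.
- move=> x; apply: cvgM; last exact: cf.
  apply: (@continuous_comp _ _ _ (fun x : R => beta / 2 * x ^+ 2) expR); last exact: continuous_expR.
  by apply: cvgM; [exact: cvg_cst|exact: exprn_continuous].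
- by move=> x; rewrite normrM ger0_norm ?expR_ge0// mulrC ler_wpM2r ?expR_ge0.
Qed.

(** The weight is absorbed into the variance of the Gaussian; the prefactor is the same for all f,
    so it cancels in the Gibbs ratio. *)
Lemma limit_functional_tilt beta (f : R -> R) (C : R) : beta < betac p -> measurable_fun setT f ->
  (forall x, `|f x| <= C) ->
  limit_functional beta (fun x => expR (beta / 2 * x ^+ 2) * f x) =
  expR (- (beta / 2 * M)) * (normal_peak s / normal_peak (tilt beta)) *
  \int[leb]_x (normal_pdf 0 (tilt beta) x * f x).
Proof.
move=> bc mf fC; have t0 := tilt_gt0 bc.
have C0 : 0 <= C by exact: le_trans (fC 0).
rewrite -RintegralZl//.
  apply: eq_Rintegral => x _.
  have := normal_pdf_tilt x (lt0r_neq0 s0) (lt0r_neq0 t0) (tiltV bc) => E.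
  transitivity (expR (- (beta / 2 * M)) * (expR (beta / 2 * x ^+ 2) * normal_pdf 0 s x) * f x).
    by ring.
  by rewrite E; ring.
have in1 := integrableZl measurableT C (integrable_normal_pdf 0 (tilt beta)).
apply: le_integrable in1 => //.
- by apply/measurable_EFinP; apply: measurable_funM => //; exact: measurable_normal_pdf.
- move=> x _ /=; rewrite lee_fin normrM [leRHS]normrM mulrC (ger0_norm C0) ler_wpM2r//.
Qed.

(** A Gibbs average is a quotient of one functional at f and at 1, both multiplied by the quadratic
    weight; the denominator has a positive limit. *)
Lemma magn_clt beta (f : R -> R) : 0 <= beta -> beta < betac p -> continuous f ->
  (exists C : R, forall x, `|f x| <= C) ->
  (fun n : nat => gibbsE p n beta (fun v => f (Num.sqrt n%:R * magn v))) @ \oo -->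
  fine (\int[normal_prob 0 (Num.sqrt (betac p - beta)^-1)]_x (f x)%:E)%E.
Proof.
move=> b0 bc cf [C fC]; have mf := continuous_measurable_fun cf.
have t0 := tilt_gt0 bc.
pose g x := expR (beta / 2 * x ^+ 2) * f x; pose g1 (x : R) := expR (beta / 2 * x ^+ 2) * 1.
have qdE n v : size v = n -> quad_weight p beta v = expR (beta / 2 * (Num.sqrt n%:R * mh p v) ^+ 2).
  by move=> vn; rewrite exprMn sqr_sqrtr// /quad_weight vn; congr expR; field.
have ZE n : Zpart p n beta = hat_functional hp beta n g1.
  apply: EFin_inj; rewrite (ZpartE hp)//.
  have -> : En n (fun v => diag_weight p beta v * quad_weight p beta v) =
      (\int[Pn n]_v (diag_weight p beta v * g1 (Num.sqrt n%:R * mh p v))%:E)%E.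
    by apply: eq_integral => v _; rewrite /g1 mulr1 (qdE n) ?size_tuple.
  rewrite /hat_functional /Rintegral fineK//.
  have := ZpartE hp n b0.
  have -> : En n (fun v => diag_weight p beta v * quad_weight p beta v) =
      (\int[Pn n]_v (diag_weight p beta v * g1 (Num.sqrt n%:R * mh p v))%:E)%E.
    by apply: eq_integral => v _; rewrite /g1 mulr1 (qdE n) ?size_tuple.
  by move=> <-.
have GE n : gibbsE p n beta (fun v => f (Num.sqrt n%:R * magn v)) =
    hat_functional hp beta n g / hat_functional hp beta n g1.
  have mF : mseq (fun v => f (Num.sqrt n%:R * magn (hatv p v))).
    apply: (mseq_comp mf (F := fun v => Num.sqrt n%:R * mh p v)).
    by apply: mseqM; [exact: mseq_cst|exact: mseq_mh].
  rewrite (@gibbsE_eq _ _ hp n beta (fun v => f (Num.sqrt n%:R * magn v)) C b0 mF (fun v => fC _)) ZE.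
  congr (fine _ / _); apply: eq_integral => v _.
  by rewrite /g -/(mh p v) (qdE n) ?size_tuple// mulrA.
rewrite (_ : (fun n : nat => _) = fun n => hat_functional hp beta n g / hat_functional hp beta n g1); last first.
  by apply/funext => n; exact: GE.
rewrite integral_normal_prob_fine// -/(tilt beta).
have c1 : continuous (fun _ : R => 1 : R) by move=> x; exact: cvg_cst.
have n1 (x : R) : `|1 : R| <= 1 by rewrite normr1.
have h1 := hat_functional_cvg b0 bc c1 n1.
have h2 := hat_functional_cvg b0 bc cf fC.
have E2 := limit_functional_tilt bc mf fC.
have E1 := limit_functional_tilt bc (measurable_cst (1 : R)) n1.
pose q := expR (- (beta / 2 * M)) * (normal_peak s / normal_peak (tilt beta)).
have q0 : q != 0.
  by rewrite gt_eqF// mulr_gt0 ?expR_gt0// divr_gt0// normal_peak_gt0// gt_eqF.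
have N1 : \int[leb]_x (normal_pdf 0 (tilt beta) x * 1) = 1.
  under eq_Rintegral do rewrite mulr1.
  by rewrite /Rintegral integral_normal_pdf.
have -> : \int[leb]_x (normal_pdf 0 (tilt beta) x * f x) =
    limit_functional beta g / limit_functional beta g1.
  rewrite [limit_functional beta g]E2 [limit_functional beta g1]E1 -/q N1 mulr1.
  by rewrite mulrAC mulfV// mul1r.
apply: cvgM => //; apply: cvgV => //.
by rewrite [limit_functional beta g1]E1 -/q N1 mulr1.
Qed.

End central_limit_theorem.

Theorem theorem1p1 (R : realType) (p : R) (hp : 2 <= p) (beta : R)
  (hbeta : 0 <= beta) :
  (exists l : R,
     (fun n : nat => n%:R^-1 * ln (Zpart p n beta)) @ \oo --> l
     /\ (2 < p ->
         ereal_sup [set y : \bar R | exists z w : R,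
                      [/\ 0 <= z, 0 <= w & y = (F1 p beta z w)%:E]] = l%:E)
     /\ ereal_sup [set y : \bar R | exists u v : R,
                      [/\ 0 <= u, u < 1, 0 <= v & y = (F2 p beta u v)%:E]]
        = l%:E)
  /\
  (beta < betac p ->
     (forall eps : R, 0 < eps ->
        (fun n : nat => magn_prob p n beta [set x | eps <= `|x|]) @ \oo --> 0)
     /\ (forall f : R -> R, continuous f -> (exists M : R, forall x, `|f x| <= M) ->
          (fun n : nat => gibbsE p n beta (fun s => f (Num.sqrt n%:R * magn s)))
            @ \oo -->
          fine (\int[normal_prob 0 (Num.sqrt (betac p - beta)^-1)]_x (f x)%:E)%E)
     /\ (exists C : R, forall n : nat, Zpart p n beta <= C)
     /\ (fun n : nat => n%:R^-1 * ln (Zpart p n beta)) @ \oo --> 0)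
  /\
  (betac p < beta ->
     (exists K : set R,
        [/\ closed K, K `<=` `]0, 1]%classic &
         forall U : set R, open U -> K `|` [set - x | x in K] `<=` U ->
           (fun n : nat => magn_prob p n beta (~` U)) @ \oo --> 0])
     /\ (exists l : R, 0 < l /\
           (fun n : nat => n%:R^-1 * ln (Zpart p n beta)) @ \oo --> l)).
Proof.
split; last split.
- exists (free_energy p beta); split; first exact: free_energy_cvg.
  split=> [p2|]; last exact: ereal_sup_F2.
  exact: ereal_sup_F1.
- move=> bc; split; first exact: magn_prob_high_temperature.
  split; first by move=> f cf bf; exact: magn_clt.
  by split; [exact: Zpart_bounded|exact: Zpart_rate0].
- move=> bc; split; first exact: magn_prob_low_temperature.
  exists (free_energy p beta); split; first exact: free_energy_gt0.
  exact: free_energy_cvg.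
Qed.
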